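(* Let $(V_k)_{k\ge 1}$ be i.i.d. real random variables with mean zero and finite variance $\sigma^2>0$. Let $k_n=n^\alpha$ for some $\alpha\in(0,1)$, let $\gamma_1,\gamma_2>0$, and put $\theta_n=1+\gamma_1/k_n$, $\rho_n=-1-\gamma_2/k_n$. For each $n\ge 1$ let $X_{0,n}=\varepsilon_{0,n}=0$ and, for $k=1,\dots,n$, $$X_{k,n}=\theta_nX_{k-1,n}+\varepsilon_{k,n},\qquad \varepsilon_{k,n}=\rho_n\varepsilon_{k-1,n}+V_k,$$ and let $\hat\theta_n=\dfrac{\sum_{k=1}^nX_{k,n}X_{k-1,n}}{\sum_{k=1}^nX_{k-1,n}^2}$. Then, as $n\to\infty$ (with $\stackrel{\mathcal L}{\longrightarrow}$ denoting convergence in distribution and $C$ a standard Cauchy random variable): (1) if $\gamma_1>\gamma_2>0$, then $$\frac{1}{2\gamma_1}\sqrt{\frac{\gamma_2}{\gamma_1}}\;k_n\theta_n^n\rho_n^{-n}(\hat\theta_n-\theta_n)\stackrel{\mathcal L}{\longrightarrow}C;$$ (2) if $\gamma_2>\gamma_1>0$, then $$\frac{1}{2\gamma_2}\sqrt{\frac{\gamma_1}{\gamma_2}}\;k_n\rho_n^n\theta_n^{-n}(\hat\theta_n-\rho_n)\stackrel{\mathcal L}{\longrightarrow}C.$$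
   Context: $\hat\theta_n$ is the least squares estimator of $\theta_n$ based on $(X_{k,n})_{1\le k\le n}$. On the event that its denominator vanishes, $\hat\theta_n$ may be given an arbitrary value. *)

(* Defs.v *)
From HB Require Import structures.
From mathcomp Require Import all_boot all_order all_algebra finmap.
From mathcomp Require Import all_classical all_reals all_analysis measurable_realfun.

Set Implicit Arguments.
Unset Strict Implicit.
Unset Printing Implicit Defensive.

Import Order.TTheory GRing.Theory Num.Theory.
Import numFieldNormedType.Exports.

Local Open Scope classical_set_scope.
Local Open Scope ring_scope.

Section random_variables.
Context (d : measure_display) (T : measurableType d) (R : realType)
        (P : probability T R).

Definition mutually_independent (I : choiceType) (V : I -> {RV P >-> R}) :=
  forall (J : {fset I}) (A : I -> set R),
    (forall j, measurable (A j)) ->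
    P (\bigcap_(j in [set` J]) (V j @^-1` A j)) =
      (\prod_(j <- J) P (V j @^-1` A j))%E.

Definition identically_distributed (I : Type) (V : I -> {RV P >-> R}) :=
  forall (i j : I) (A : set R), measurable A ->
    distribution P (V i) A = distribution P (V j) A.

Definition iid (I : choiceType) (V : I -> {RV P >-> R}) :=
  mutually_independent V /\ identically_distributed V.

Definition standard_cauchy (C : {RV P >-> R}) :=
  forall A : set R, measurable A ->
    distribution P C A =
      (\int[lebesgue_measure]_(x in A) (pi * (1 + x ^+ 2))^-1%:E)%E.

End random_variables.

(* The limit may live on another probability space. *)
Definition cvg_in_law (d d' : measure_display) (T : measurableType d)
    (T' : measurableType d') (R : realType)
    (P : probability T R) (P' : probability T' R)
    (Y : nat -> {RV P >-> R}) (Z : {RV P' >-> R}) :=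
  forall x : R, {for x, continuous (cdf Z)} ->
    cdf (Y n) x @[n --> \oo] --> cdf Z x.

Section autoregression.
Context (T : Type) (R : realType).

(* Solution of Y_0 = 0, Y_k = a Y_(k-1) + u_k. The recursion only reads u_k
   for k >= 1. *)
Fixpoint ar1 (a : R) (u : nat -> T -> R) (k : nat) (w : T) : R :=
  if k is k'.+1 then a * ar1 a u k' w + u k w else 0.

(* The sequence V_1, V_2, ... is stored from index 0, so that V k stands for
   V_(k+1) and V k.-1 for V_k. *)
Definition noise (rho : R) (V : nat -> T -> R) : nat -> T -> R :=
  ar1 rho (fun k => V k.-1).

Definition process (theta rho : R) (V : nat -> T -> R) : nat -> T -> R :=
  ar1 theta (noise rho V).

(* The value of the estimator is left free where the denominator vanishes. *)
Definition least_squares (X : nat -> T -> R) (n : nat) (est : T -> R) :=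
  forall w : T,
    \sum_(1 <= k < n.+1) X k.-1 w ^+ 2 != 0 ->
    est w = (\sum_(1 <= k < n.+1) X k w * X k.-1 w) /
            (\sum_(1 <= k < n.+1) X k.-1 w ^+ 2).

End autoregression.

Section parameters.
Context (R : realType).

Definition k_ (alpha : R) (n : nat) : R := n%:R `^ alpha.

Definition theta_ (alpha gamma1 : R) (n : nat) : R := 1 + gamma1 / k_ alpha n.

Definition rho_ (alpha gamma2 : R) (n : nat) : R := - 1 - gamma2 / k_ alpha n.

End parameters.

(* Main.v *)
(* Both cases concern the root [a] of larger modulus, the other root being [b]:
   the process is symmetric in its two roots. It satisfies
   (a - b) X_k = a A_k - b B_k, where A and B are the first-order recursions with
   roots [a] and [b] driven by V; A_n = a^n sqrt(k_n) s_n and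
   B_n = b^n sqrt(k_n) t_n for weighted sums s_n, t_n of V. Up to errors which are
   powers of n times exponentially small quantities, sum X_k B_(k+1) is a multiple
   of A_n B_n and sum X_k^2 a multiple of A_n^2, so the normalised estimation error
   is a multiple of t_n / s_n. By the central limit theorem (s_n, t_n) is
   asymptotically Gaussian, with independent components because the products of
   the weights alternate in sign, and a ratio of independent centred normal
   variables is Cauchy.
   The ratio is never formed: t / s <= x means s (t - x s) <= 0, and the
   probability of such a double quadrant passes to the limit because its indicator
   is approximated by trigonometric polynomials, whose expectations are
   combinations of characteristic functions. *)

Require Import Defs.
From HB Require Import structures.
From mathcomp Require Import all_boot all_order all_algebra finmap.
From mathcomp Require Import all_classical all_reals all_analysis measurable_realfun.
From mathcomp Require Import ring lra.

Import Order.TTheory GRing.Theory Num.Theory.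
Import numFieldNormedType.Exports.

Local Open Scope classical_set_scope.
Local Open Scope ring_scope.

Set Implicit Arguments.
Unset Strict Implicit.
Unset Printing Implicit Defensive.

(** * Integration on a probability space *)

(** The constants of the theorem come from the following limits. With a near e and b near -e, where
    e is 1 or -1, a b / (a b - 1) tends to 1/2, a - b to 2 e, and k_n (a^2 - 1) to 2 gamma, where
    gamma belongs to a and delta to b. So k_n a^n b^-n times the estimation error is close to 2
    gamma e t / s. The limit variances of s and t are sigma^2 / (2 gamma) and sigma^2 / (2 delta),
    hence the factor sqrt(delta / gamma) / (2 gamma) leaves a ratio of standard normal variables, up
    to the sign e, which the symmetry of the normal law absorbs. The obstacle is that s can be
    arbitrarily small, so that errors in numerator and denominator cannot be carried through a
    division. They are collected in one random variable r: the event of interest agrees with a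
    double quadrant of (S, W), a rescaled form of (s, t - x s), except where |S W| or S^2 is at most
    r. It then suffices that E r tends to 0, because the limit law does not charge the two boundary
    lines. Escape of mass to infinity is excluded by bounded second moments. *)

Section dominated_convergence.
Context {d : measure_display} {T : measurableType d} {R : realType}
        {mu : {measure set T -> \bar R}}.
Implicit Types X Y : T -> R.

Lemma dominated_cvg_Rintegral (X_ : nat -> T -> R) X Y :
  (forall n, measurable_fun [set: T] (X_ n)) -> measurable_fun [set: T] X ->
  mu.-integrable [set: T] (EFin \o Y) ->
  {ae mu, forall w, X_ n w @[n --> \oo] --> X w} ->
  (forall n w, `|X_ n w| <= Y w) ->
  \int[mu]_w X_ n w @[n --> \oo] --> \int[mu]_w X w.
Proof.
move=> mX_ mX iY X_X X_Y.
have [] := @dominated_convergence _ T R mu [set: T] measurableT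
  (fun n w => (X_ n w)%:E) (EFin \o X) (EFin \o Y).
- by move=> n; exact/measurable_EFinP.
- exact/measurable_EFinP.
- by apply: filterS X_X => w Xw _; apply: cvg_EFin => //; exact: nearW.
- exact: iY.
- by apply: aeW => w n _ /=; rewrite lee_fin.
move=> iX _ cX; apply: fine_cvg; move: cX.
rewrite -[X in _ --> X -> _]fineK//; exact: integrable_fin_num.
Qed.

End dominated_convergence.

Section integrals.
Context {d : measure_display} {T : measurableType d} {R : realType}
        (P : probability T R).
Implicit Types X Y : T -> R.

Lemma bounded_integrable X (M : R) : measurable_fun [set: T] X ->
  (forall w, `|X w| <= M) -> P.-integrable [set: T] (EFin \o X).
Proof.
move=> mX XM; apply: measurable_bounded_integrable => //.
  by rewrite (le_lt_trans (probability_le1 _ _))// ltry.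
exists M; split; first exact: num_real.
by move=> x Mx w _ /=; exact: le_trans (XM w) (ltW Mx).
Qed.

Lemma dominated_integrable_real X Y : measurable_fun [set: T] X ->
  P.-integrable [set: T] (EFin \o Y) -> (forall w, `|X w| <= Y w) ->
  P.-integrable [set: T] (EFin \o X).
Proof.
move=> mX iY XY; apply: (le_integrable measurableT _ _ iY) => //.
  exact/measurable_EFinP.
by move=> w _ /=; rewrite lee_fin (le_trans (XY w))// ler_norm.
Qed.

Lemma EFin_Rintegral X : P.-integrable [set: T] (EFin \o X) ->
  (\int[P]_w X w)%:E = (\int[P]_w (X w)%:E)%E.
Proof. by move=> iX; rewrite fineK//; exact: integrable_fin_num. Qed.

Lemma Rintegral_cstT (c : R) : \int[P]_w c = c.
Proof. by rewrite Rintegral_cst//= probability_setT mulr1. Qed.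

Lemma Rintegral_indic (A : set T) : measurable A ->
  \int[P]_w \1_A w = fine (P A).
Proof. by move=> mA; rewrite /Rintegral integral_indic// setIT. Qed.

Lemma integrable_indicT (A : set T) : measurable A ->
  P.-integrable [set: T] (EFin \o (\1_A : T -> R)).
Proof.
move=> mA; apply: (bounded_integrable (M := 1)) => //.
by move=> w; rewrite indicE; case: (_ \in _); rewrite ?normr1 ?normr0.
Qed.

Lemma normr_Rintegral_le X Y :
  P.-integrable [set: T] (EFin \o X) -> P.-integrable [set: T] (EFin \o Y) ->
  (forall w, `|X w| <= Y w) -> `|\int[P]_w X w| <= \int[P]_w Y w.
Proof.
move=> iX iY XY; rewrite (le_trans (le_normr_Rintegral _ _))//.
by apply: le_Rintegral => //; exact: integrable_norm.
Qed.

Lemma integrable_cstT (c : R) : P.-integrable [set: T] (EFin \o cst c).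
Proof. exact: (bounded_integrable (M := `|c|)). Qed.

Lemma integrable_scaleT (c : R) X : P.-integrable [set: T] (EFin \o X) ->
  P.-integrable [set: T] (EFin \o (fun w => c * X w)).
Proof. by move=> iX; apply: (integrableZl measurableT c iX). Qed.

Lemma integrable_addT X Y : P.-integrable [set: T] (EFin \o X) ->
  P.-integrable [set: T] (EFin \o Y) ->
  P.-integrable [set: T] (EFin \o (fun w => X w + Y w)).
Proof. by move=> iX iY; exact: (integrableD measurableT iX iY). Qed.

Lemma integrable_subT X Y : P.-integrable [set: T] (EFin \o X) ->
  P.-integrable [set: T] (EFin \o Y) ->
  P.-integrable [set: T] (EFin \o (fun w => X w - Y w)).
Proof. by move=> iX iY; exact: (integrableB measurableT iX iY). Qed.

End integrals.
Arguments bounded_integrable {d T R P X} M _ _.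
Arguments integrable_cstT {d T R P} c.

Section trigonometric_integrals.
Context {d : measure_display} {T : measurableType d} {R : realType}
        {P : probability T R}.

Lemma measurable_cos : measurable_fun [set: R] (@cos R).
Proof. by apply: continuous_measurable_fun; exact: continuous_cos. Qed.

Lemma measurable_sin : measurable_fun [set: R] (@sin R).
Proof. by apply: continuous_measurable_fun; exact: continuous_sin. Qed.

Lemma integrable_cos (X : T -> R) : measurable_fun [set: T] X ->
  P.-integrable [set: T] (EFin \o (fun w => cos (X w))).
Proof.
move=> mX; apply: (bounded_integrable 1); last by move=> w; exact: cos_max.
exact: measurableT_comp measurable_cos mX.
Qed.

Lemma integrable_sin (X : T -> R) : measurable_fun [set: T] X ->
  P.-integrable [set: T] (EFin \o (fun w => sin (X w))).
Proof.
move=> mX; apply: (bounded_integrable 1); last by move=> w; exact: sin_max.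
exact: measurableT_comp measurable_sin mX.
Qed.

End trigonometric_integrals.

(** * Independence and joint laws *)

Section independence.
Context {d : measure_display} {T : measurableType d} {R : realType}
        (P : probability T R).
Implicit Types X Y : {mfun T >-> R}.
Local Open Scope ereal_scope.

Definition independent_pair X Y := forall A B : set R,
  measurable A -> measurable B ->
  P (X @^-1` A `&` Y @^-1` B) = P (X @^-1` A) * P (Y @^-1` B).

(** Both measures agree on measurable rectangles, which determines a product of probabilities. *)
Lemma independent_pair_distribution X Y : independent_pair X Y ->
  forall Z : set (R * R)%type, measurable Z ->
  P ((fun w => (X w, Y w)) @^-1` Z) =
  (distribution P X \x distribution P Y) Z.
Proof.
move=> XY Z mZ.
have mXY : measurable_fun [set: T] (fun w => (X w, Y w)).
  exact: measurable_fun_pair.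
pose F : {mfun T >-> (R * R)%type} := mfun_Sub (mem_set mXY).
by rewrite (@product_measure_unique _ _ _ _ _ _ _ (distribution P F)).
Qed.

Lemma independent_pair_comp X Y (f g : {mfun R >-> R}) :
  independent_pair X Y -> independent_pair (f \o X)%R (g \o Y)%R.
Proof.
move=> XY A B mA mB; have := XY (f @^-1` A) (g @^-1` B).
by apply; rewrite -[X in measurable X]setTI; exact: measurable_funP.
Qed.

(** Fubini under the joint law, which is the product of the marginals. Tonelli applied to |x| |y|
    first gives integrability of the product from first moments alone. *)
Lemma expectation_independent_mul X Y : independent_pair X Y ->
  P.-integrable [set: T] (EFin \o X) -> P.-integrable [set: T] (EFin \o Y) ->
  P.-integrable [set: T] (EFin \o (fun w => X w * Y w)%R) /\
  (\int[P]_w (X w * Y w) = \int[P]_w X w * \int[P]_w Y w)%R.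
Proof.
move=> XY iX iY.
have mXY : measurable_fun [set: T] (fun w => (X w, Y w)).
  exact: measurable_fun_pair.
pose F : {mfun T >-> (R * R)%type} := mfun_Sub (mem_set mXY).
have XYE : (fun z : R * R => (z.1 * z.2)%:E) \o F =
    EFin \o (fun w => X w * Y w)%R by [].
have mM : measurable_fun [set: (R * R)%type] (fun z : R * R => (z.1 * z.2)%:E).
  by apply/measurable_EFinP; exact: measurable_funM.
have iidX : (distribution P X).-integrable [set: R] EFin.
  by apply: integrable_pushforward => //; exact/measurable_EFinP.
have iidY : (distribution P Y).-integrable [set: R] EFin.
  by apply: integrable_pushforward => //; exact/measurable_EFinP.
have iprod : (distribution P X \x distribution P Y).-integrable
    [set: (R * R)%type] (fun z : R * R => (z.1 * z.2)%:E).
  apply/integrable12ltyP => //.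
  rewrite (eq_integral (fun x : R => `|x%:E| *
      \int[distribution P Y]_y `|(y : R)%:E|)); last first.
    move=> x _; rewrite -ge0_integralZl//.
      by apply: eq_integral => y _ /=; rewrite normrM EFinM.
    exact: measurableT_comp.
  have /integrableP[_ Yoo] := iidY; have /integrableP[_ Xoo] := iidX.
  rewrite ge0_integralZr//; last 2 first.
    exact: measurableT_comp.
    exact: integral_ge0.
  by rewrite lte_mul_pinfty// ?integral_ge0// ge0_fin_numE// integral_ge0.
have F_prod (f : R * R -> \bar R) :
    \int[distribution P F]_z f z = \int[distribution P X \x distribution P Y]_z f z.
  apply: eq_measure_integral => Z mZ _.
  exact: independent_pair_distribution.
have iXY : P.-integrable [set: T] (EFin \o (fun w => X w * Y w)%R).
  apply/integrableP; split; first exact/measurable_EFinP/measurable_funM.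
  have /integrableP[_] := iprod; rewrite -F_prod.
  by rewrite ge0_integral_distribution//; exact: measurableT_comp.
split=> //; apply: EFin_inj.
rewrite EFinM !EFin_Rintegral//.
transitivity (\int[distribution P F]_z (z.1 * z.2)%:E).
  by rewrite integral_distribution.
rewrite F_prod -integral12_prod_meas1//=.
transitivity (\int[distribution P X]_x (x : R)%:E * \int[distribution P Y]_y (y : R)%:E);
  last by rewrite !integral_distribution.
have fY : \int[distribution P Y]_y (y : R)%:E \is a fin_num.
  exact: integrable_fin_num iidY.
rewrite -(fineK fY) -integralZr//; apply: eq_integral => x _.
rewrite (fineK fY) -integralZl//.
Qed.
End independence.

Section partial_sums.
Context {d : measure_display} {T : measurableType d} {R : realType}
        (P : probability T R).
Local Open Scope ereal_scope.

(** The law of (X, Y) under P restricted to E and divided by P E agrees with the product of the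
    marginals on rectangles, so uniqueness of the product measure applies. The normalisation forces
    the separate treatment of a null E. *)
Lemma independent_triple_distribution (X Y : {mfun T >-> R}) (E : set T) :
  measurable E ->
  (forall A B : set R, measurable A -> measurable B ->
    P (X @^-1` A `&` Y @^-1` B `&` E) = P (X @^-1` A) * P (Y @^-1` B) * P E) ->
  forall Z : set (R * R)%type, measurable Z ->
  P ((fun w => (X w, Y w)) @^-1` Z `&` E) =
  (distribution P X \x distribution P Y) Z * P E.
Proof.
move=> mE XYE Z mZ.
have mXY : measurable_fun [set: T] (fun w => (X w, Y w)).
  exact: measurable_fun_pair.
pose F : {mfun T >-> (R * R)%type} := mfun_Sub (mem_set mXY).
have PEfin : P E \is a fin_num by exact: fin_num_measure.
have [PE0|PE0] := eqVneq (P E) 0.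
  rewrite PE0 mule0; apply: (@subset_measure0 _ _ _ P _ E) => //.
  by apply: measurableI => //; rewrite -[X in measurable X]setTI; exact (mXY measurableT _ mZ).
have r0 : (0 <= (fine (P E))^-1)%R by rewrite invr_ge0 fine_ge0.
have K : ((fine (P E))^-1)%:E * P E = 1.
  by rewrite -[X in _ * X]fineK// -EFinM mulVf// fine_eq0.
rewrite (@product_measure_unique _ _ _ _ _ _ _
  (mscale (NngNum r0) (pushforward (mrestr P mE) F))) //; last first.
  move=> A B mA mB; rewrite -[RHS]mul1e -K -muleA; congr (_ * _).
  by rewrite muleC; exact: XYE.
by rewrite /mscale /pushforward /mrestr/= muleAC K mul1e.
Qed.

Definition partial_sum (u : nat -> R) (V : nat -> {mfun T >-> R}) (k : nat) (w : T) : R :=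
  (\sum_(i < k) u i * V i w)%R.

Lemma measurable_partial_sum u V k : measurable_fun [set: T] (partial_sum u V k).
Proof. by apply: measurable_sum => i; exact: measurable_funM. Qed.

HB.instance Definition _ u V k := isMeasurableFun.Build _ _ _ _
  (partial_sum u V k) (measurable_partial_sum u V k).

(* The variables of the tail stay in the statement so that the induction can take the
   next summand from them. *)
Lemma independent_partial_sum_tail (V : nat -> {RV P >-> R}) (u : nat -> R) :
  mutually_independent V ->
  forall k (J : {fset nat}) (A : set R) (B : nat -> set R),
  (forall j, j \in J -> (k <= j)%N) -> measurable A ->
  (forall j, measurable (B j)) ->
  P (partial_sum u V k @^-1` A `&` \bigcap_(j in [set` J]) (V j @^-1` B j)) =
  P (partial_sum u V k @^-1` A) * \prod_(j <- J) P (V j @^-1` B j).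
Proof.
move=> hV; elim=> [|k IH] J A B kJ mA mB.
  have -> : partial_sum u V 0 = cst 0%R.
    by apply/funext => w; rewrite /partial_sum big_ord0.
  rewrite preimage_cst; case: ifP => _.
    by rewrite setTI probability_setT mul1e hV.
  by rewrite set0I measure0 mul0e.
have mcap (K : {fset nat}) : measurable (\bigcap_(j in [set` K]) (V j @^-1` B j)).
  by apply: fin_bigcap_measurable => // j _; exact: measurable_funPTI.
have kNJ : k \notin J by apply/negP => /kJ; rewrite ltnn.
pose Z := (fun z : R * R => z.1 + u k * z.2)%R @^-1` A.
have mZ : measurable Z.
  have mf : measurable_fun [set: (R * R)%type] (fun z : R * R => z.1 + u k * z.2)%R.
    by apply: measurable_funD => //; exact: measurable_funM.
  by rewrite -[X in measurable X]setTI; exact (mf measurableT _ mA).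
have ZE : partial_sum u V k.+1 @^-1` A =
    (fun w => (partial_sum u V k w, V k w)) @^-1` Z.
  by rewrite /Z; apply/seteqP; split => w /=; rewrite /partial_sum big_ord_recr.
(* The event on the next partial sum is a planar event for the pair formed by the current sum and
   [V k]; the remaining tail variables play the part of the third event. *)
have key (K : {fset nat}) : (forall j, j \in K -> (k < j)%N) ->
    P (partial_sum u V k.+1 @^-1` A `&` \bigcap_(j in [set` K]) (V j @^-1` B j)) =
    (distribution P (partial_sum u V k) \x distribution P (V k)) Z *
    \prod_(j <- K) P (V j @^-1` B j).
  move=> kK; rewrite ZE -hV//; apply: independent_triple_distribution => //.
  move=> A' B' mA' mB'.
  have kNK : k \notin K by apply/negP => /kK; rewrite ltnn.
  (* Placing [B'] at index k lets the induction hypothesis, used with k added to K, treat [V k] as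
     one more tail variable. *)
  pose B'' j := if j == k then B' else B j.
  have B''K j : j \in K -> B'' j = B j.
    by move=> jK; rewrite /B''; case: eqP => // jk; rewrite -jk jK in kNK.
  have B''k : B'' k = B' by rewrite /B'' eqxx.
  have := IH (k |` K)%fset A' B''.
  rewrite big_fsetU1//= B''k.
  rewrite [X in _ * (_ * X)](eq_big_seq (fun j => P (V j @^-1` B j))); last first.
    by move=> j jK; rewrite B''K.
  rewrite -hV// muleA => <-//; last 2 first.
  - by move=> j; rewrite !inE => /orP[/eqP->//|/kK/ltnW].
  - by move=> j; rewrite /B''; case: ifP.
  rewrite set_fsetU set_fset1 bigcap_setU bigcap_set1 B''k setIA.
  congr (P (_ `&` _)); apply: eq_bigcapr => j /= jK.
  by rewrite B''K.
rewrite key//; congr (_ * _).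
(* With an empty tail, [key] evaluates the event on the partial sum alone by the same product
   measure. *)
have := key fset0; rewrite set_fset0 bigcap_set0 setIT => ->//.
by rewrite big_seq_fset0 mule1.
Qed.

Lemma independent_partial_sum (V : nat -> {RV P >-> R}) (u : nat -> R) k :
  mutually_independent V -> independent_pair P (partial_sum u V k) (V k).
Proof.
move=> hV A B mA mB.
have := @independent_partial_sum_tail V u hV k [fset k]%fset A (fun=> B).
rewrite big_seq_fset1 set_fset1 bigcap_set1; apply => //.
by move=> j; rewrite inE => /eqP ->.
Qed.

End partial_sums.

(** * Taylor bounds for sine and cosine *)

Section trigonometric_bounds.
Context {R : realType}.
Implicit Types y : R.

Lemma sin_mean_value y : exists2 c, `|c| <= `|y| & sin y = cos c * y.
Proof.
have H (z : R) : 0 < z -> exists2 c, `|c| <= `|z| & sin z = cos c * z.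
  move=> z0.
  have [|c] := @MVT R (@sin R) (@cos R) 0 z z0.
    by apply: continuous_subspaceT; exact: continuous_sin.
  rewrite in_itv/= sin0 !subr0 => /andP[c0 cz] E; exists c => //.
  by rewrite !gtr0_norm// ltW.
have [y0|y0|<-] := ltgtP 0 y; first exact: H.
  have [|c cy E] := H (- y); first by rewrite oppr_gt0.
  exists c; first by rewrite -(normrN y).
  by apply: oppr_inj; rewrite -sinN E mulrN.
by exists 0 => //; rewrite sin0 mulr0.
Qed.

Lemma normr_sin_le y : `|sin y| <= `|y|.
Proof.
have [c _ ->] := sin_mean_value y.
by rewrite normrM ler_piMl// cos_max.
Qed.

Lemma oneB_cos y : 1 - cos y = 2 * sin (y / 2) ^+ 2.
Proof.
have -> : y = (y / 2) *+ 2 by rewrite -mulr_natr divfK.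
rewrite cos_mulr2n cos2sin2 -mulr_natr.
have -> : ((y / 2) *+ 2 / 2 = y / 2 :> R) by field.
by ring.
Qed.

Lemma oneB_cos_bound y : `|cos y - 1| <= Num.min `|y| (y ^+ 2 / 2).
Proof.
have s1 := normr_sin_le (y / 2); have s2 := sin_max (y / 2).
have E : `|cos y - 1| = 2 * `|sin (y / 2)| ^+ 2.
  rewrite -normrN opprB oneB_cos normrM normrX ger0_norm//.
have h : `|y / 2| = `|y| / 2 by rewrite normrM (@ger0_norm _ (2^-1)).
have ny : `|y| ^+ 2 = y ^+ 2 by rewrite real_normK// num_real.
rewrite h in s1; rewrite E le_min -ny.
have := normr_ge0 (sin (y / 2)); have := normr_ge0 y.
move: s1 s2; set s := `|sin _|; set t := `|y| => s1 s2 t0 s0.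
by apply/andP; split; nra.
Qed.

(** Since sin y - y = (cos c - 1) y with |c| <= |y|, the two bounds of [oneB_cos_bound] give the two
    branches. The minimum keeps the remainder integrable when only a second moment exists, and still
    makes it of smaller order than y^2 near 0. *)
Lemma sin_taylor y : `|sin y - y| <= y ^+ 2 * Num.min 1 `|y|.
Proof.
have [c cy ->] := sin_mean_value y.
have := oneB_cos_bound c; rewrite le_min => /andP[h1 h2].
rewrite -{2}(mul1r y) -mulrBl normrM.
have nc : `|c| ^+ 2 = c ^+ 2 by rewrite real_normK// num_real.
have ny : `|y| ^+ 2 = y ^+ 2 by rewrite real_normK// num_real.
rewrite -ny; rewrite -nc in h2.
have := normr_ge0 c; move: h1 h2 cy (normr_ge0 y).
set t := `|y|; set s := `|c|; set z := `|_ - 1| => h1 h2 cy t0 s0.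
have z0 : 0 <= z by rewrite /z.
have zt : z <= t * Num.min 1 t.
  by case: (leP 1 t) => t1; [nra|nra].
have := ler_wpM2r t0 zt; nra.
Qed.

(** With z = y / 2 the remainder factors as 2 (z - sin z) (z + sin z), which reduces it to
    [sin_taylor]. For |y| >= 1 the product is bounded by z^2 through [s4]; for |y| < 1 the cubic
    bound on z - sin z is used. *)
Lemma cos_taylor y : `|cos y - (1 - y ^+ 2 / 2)| <= y ^+ 2 * Num.min 1 `|y|.
Proof.
pose z := y / 2.
have yz : y = 2 * z by rewrite /z; field.
have E : cos y - (1 - y ^+ 2 / 2) = 2 * (z - sin z) * (z + sin z).
  by rewrite -[cos y](subKr 1) oneB_cos -/z yz; field.
have s1 := sin_taylor z; have s2 := normr_sin_le z.
rewrite E !normrM (@ger0_norm _ 2)// (distrC z).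
have ny : `|y| = 2 * `|z| by rewrite yz normrM (@ger0_norm _ 2).
have ny2 : `|y| ^+ 2 = y ^+ 2 by rewrite real_normK// num_real.
have nz : `|z| ^+ 2 = z ^+ 2 by rewrite real_normK// num_real.
have s3 : `|z + sin z| <= 2 * `|z|.
  by rewrite (le_trans (ler_normD _ _))//; lra.
have s4 : `|sin z - z| * `|z + sin z| <= `|z| ^+ 2.
  rewrite -normrM [_ * _](_ : _ = sin z ^+ 2 - z ^+ 2); last by ring.
  have sz : sin z ^+ 2 <= z ^+ 2.
    by rewrite -[leLHS]real_normK ?num_real// -nz lerXn2r ?nnegrE.
  by rewrite nz ler0_norm ?subr_le0//; have := sqr_ge0 (sin z); lra.
rewrite -ny2 ny; rewrite -nz in s1.
move: s1 s3 s4 (normr_ge0 (z + sin z)) (normr_ge0 z) (normr_ge0 (sin z - z)).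
set t := `|z|; set a := `|z + _|; set b := `|_ - z|.
move=> s1 s3 s4 a0 t0 b0.
case: (leP 1 (2 * t)) => t1; first by nra.
have m1 : Num.min 1 t = t by apply/min_idPr; lra.
rewrite m1 in s1.
have : b * a <= t ^+ 3 * (2 * t) by apply: ler_pM => //; nra.
have : 0 <= t ^+ 3 by exact: exprn_ge0.
have : t ^+ 3 = t * t * t by ring.
move=> -> h3 h4; nra.
Qed.

End trigonometric_bounds.

(** * Characteristic functions of weighted sums *)

Section characteristic_function.
Context {d : measure_display} {T : measurableType d} {R : realType}
        (P : probability T R) (V : nat -> {RV P >-> R}) (sigma : R).
Hypotheses (hV : iid V)
  (hmean : forall k, ('E_P[V k] = 0)%E)
  (hvar : forall k, ('V_P[V k] = (sigma ^+ 2)%:E)%E).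

Lemma second_moment k : (\int[P]_w ((V k w) ^+ 2)%:E = (sigma ^+ 2)%:E)%E.
Proof.
rewrite -(hvar k) /variance covariance.unlock hmean expectation.unlock.
by apply: eq_integral => w _; rewrite !fctE/= subr0 expr2.
Qed.

Lemma integrable_sqr k : P.-integrable [set: T] (EFin \o (fun w => V k w ^+ 2)).
Proof.
apply/integrableP; split; first exact/measurable_EFinP/measurable_funX.
rewrite [ltLHS](_ : _ = (sigma ^+ 2)%:E) ?ltry// -(second_moment k).
by apply: eq_integral => w _ /=; rewrite ger0_norm// sqr_ge0.
Qed.

Lemma integrable_V k : P.-integrable [set: T] (EFin \o V k).
Proof.
apply: (@dominated_integrable_real _ _ _ _ _ (fun w => 1 + V k w ^+ 2)) => //.
  exact: (integrable_addT (integrable_cstT 1) (integrable_sqr k)).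
move=> w; have : `|V k w| ^+ 2 = V k w ^+ 2 by rewrite real_normK// num_real.
by have := normr_ge0 (V k w); nra.
Qed.

Lemma mean_Rintegral k : \int[P]_w V k w = 0.
Proof. by have := hmean k; rewrite expectation.unlock /Rintegral => ->. Qed.

Lemma sqr_Rintegral k : \int[P]_w (V k w ^+ 2) = sigma ^+ 2.
Proof. by rewrite /Rintegral second_moment. Qed.

Lemma eq_law_Rintegral (f : R -> R) i j : measurable_fun [set: R] f ->
  (forall x, 0 <= f x) -> \int[P]_w f (V i w) = \int[P]_w f (V j w).
Proof.
move=> mf f0; congr fine.
have mEf : measurable_fun [set: R] (EFin \o f) by exact/measurable_EFinP.
have f0' x : (0 <= (EFin \o f) x)%E by rewrite lee_fin.
transitivity (\int[distribution P (V i)]_x (f x)%:E)%E.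
  by rewrite (ge0_integral_distribution (V i) mEf f0').
transitivity (\int[distribution P (V j)]_x (f x)%:E)%E; last first.
  by rewrite (ge0_integral_distribution (V j) mEf f0').
by apply: eq_measure_integral => A mA _; exact: hV.2.
Qed.

(** A continuous version of the Lindeberg quantity: it plays the role of the second moment of V
    restricted to |V| > 1 / r, and it tends to 0 with r by dominated convergence, without a third
    moment. *)
Definition truncated_variance (r : R) :=
  \int[P]_w (V 0%N w ^+ 2 * Num.min 1 (r * `|V 0%N w|)).

Let trunc (r x : R) : R := x ^+ 2 * Num.min 1 (r * `|x|).

Let measurable_trunc (r : R) : measurable_fun [set: R] (trunc r).
Proof.
apply: measurable_funM; first exact: measurable_funX.
apply: measurable_funTS; apply: measurable_minr => //.
by apply: measurable_funM => //; exact: measurable_normr.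
Qed.

Let trunc_ge0 (r x : R) : 0 <= r -> 0 <= trunc r x.
Proof.
by move=> r0; rewrite mulr_ge0 ?sqr_ge0// le_min ler01 mulr_ge0.
Qed.

Let trunc_le (r x : R) : 0 <= r -> `|trunc r x| <= x ^+ 2.
Proof.
move=> r0; rewrite ger0_norm ?trunc_ge0// ler_piMr ?sqr_ge0//.
by rewrite ge_min lexx.
Qed.

Let integrable_trunc (r : R) k : 0 <= r ->
  P.-integrable [set: T] (EFin \o (fun w => trunc r (V k w))).
Proof.
move=> r0; apply: (dominated_integrable_real _ (integrable_sqr k)).
  exact: measurableT_comp.
by move=> w; exact: trunc_le.
Qed.

Lemma truncated_variance_cvg0 (eta : nat -> R) : (forall n, 0 <= eta n) ->
  eta n @[n --> \oo] --> 0 -> truncated_variance (eta n) @[n --> \oo] --> 0.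
Proof.
move=> eta0 etac; rewrite -[X in _ --> X](Rintegral_cstT P).
apply: (dominated_cvg_Rintegral (X_ := fun n w => trunc (eta n) (V 0%N w))
  (Y := fun w => V 0%N w ^+ 2)) => //.
- by move=> n; exact: measurableT_comp.
- exact: integrable_sqr.
- apply: aeW => w; apply: (@squeeze_cvgr _ _ _ _ (cst 0)
    (fun n => V 0%N w ^+ 2 * (eta n * `|V 0%N w|))).
  + apply: nearW => n; rewrite trunc_ge0//= /trunc ler_wpM2l ?sqr_ge0//.
    by rewrite ge_min lexx orbT.
  + exact: cvg_cst.
  + rewrite -[X in _ --> X](mulr0 (V 0%N w ^+ 2)); apply: cvgM; first exact: cvg_cst.
    rewrite -[X in _ --> X](mul0r (`|V 0%N w|)); apply: cvgM => //.
    exact: cvg_cst.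
- by move=> n w; exact: trunc_le.
Qed.

(** Second order Taylor expansion under the expectation; the mean zero hypothesis removes the linear
    term of the sine. The bound [r] serves a whole row of weights, and the factor u^2 makes the
    errors of a row add up to a bounded sum of squares times a small quantity. *)
Lemma characteristic_function_bound k (u r : R) : `|u| <= r ->
  `|\int[P]_w cos (u * V k w) - (1 - sigma ^+ 2 * u ^+ 2 / 2)| <=
    u ^+ 2 * truncated_variance r /\
  `|\int[P]_w sin (u * V k w)| <= u ^+ 2 * truncated_variance r.
Proof.
move=> ur; have r0 : 0 <= r by rewrite (le_trans _ ur).
have mu : measurable_fun [set: T] (fun w => u * V k w).
  exact: measurable_funM.
have icos : P.-integrable [set: T] (EFin \o (fun w => cos (u * V k w))).
  exact: integrable_cos.
have isin : P.-integrable [set: T] (EFin \o (fun w => sin (u * V k w))).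
  exact: integrable_sin.
have itr : P.-integrable [set: T] (EFin \o (fun w => u ^+ 2 * trunc r (V k w))).
  by apply: integrable_scaleT; exact: integrable_trunc.
have i1 : P.-integrable [set: T] (EFin \o cst (1 : R)).
  exact: integrable_cstT.
have iq : P.-integrable [set: T] (EFin \o (fun w => - (u ^+ 2 / 2) * V k w ^+ 2)).
  by apply: integrable_scaleT; exact: integrable_sqr.
have iu : P.-integrable [set: T] (EFin \o (fun w => u * V k w)).
  by apply: integrable_scaleT; exact: integrable_V.
have -> : u ^+ 2 * truncated_variance r = \int[P]_w (u ^+ 2 * trunc r (V k w)).
  rewrite RintegralZl//; last exact: integrable_trunc.
  congr (_ * _); apply: (eq_law_Rintegral 0%N k (measurable_trunc r)).
  by move=> x; exact: trunc_ge0.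
have bound y : (u * y) ^+ 2 * Num.min 1 `|u * y| <= u ^+ 2 * trunc r y.
  rewrite /trunc mulrA -exprMn ler_wpM2l ?sqr_ge0// le_min !ge_min lexx/=.
  by rewrite normrM ler_wpM2r ?orbT.
split.
  have -> : 1 - sigma ^+ 2 * u ^+ 2 / 2 =
      \int[P]_w (1 + (- (u ^+ 2 / 2)) * V k w ^+ 2).
    rewrite RintegralD// RintegralZl//; last exact: integrable_sqr.
    by rewrite Rintegral_cstT sqr_Rintegral; field.
  rewrite -(RintegralB measurableT icos (integrable_addT i1 iq)).
  apply: normr_Rintegral_le => //.
    exact: (integrable_subT icos (integrable_addT i1 iq)).
  move=> w; apply: le_trans (bound _); apply: le_trans (cos_taylor _).
  rewrite le_eqVlt; apply/orP; left; apply/eqP; congr `|_ - _|.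
  by rewrite /cst; field.
have -> : \int[P]_w sin (u * V k w) = \int[P]_w (sin (u * V k w) - u * V k w).
  rewrite RintegralB// RintegralZl//; last exact: integrable_V.
  by rewrite mean_Rintegral mulr0 subr0.
apply: normr_Rintegral_le => //; first exact: (integrable_subT isin iu).
by move=> w; apply: le_trans (bound _); exact: sin_taylor.
Qed.

End characteristic_function.

Section central_limit.
Context {d : measure_display} {T : measurableType d} {R : realType}
        {P : probability T R} {V : nat -> {RV P >-> R}} {sigma : R}.

Lemma expectation_independent_comp (X Y : {mfun T >-> R}) (f g : R -> R) :
  independent_pair P X Y -> measurable_fun [set: R] f ->
  measurable_fun [set: R] g -> (forall x, `|f x| <= 1) ->
  (forall x, `|g x| <= 1) ->
  \int[P]_w (f (X w) * g (Y w)) = \int[P]_w f (X w) * \int[P]_w g (Y w).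
Proof.
move=> XY mf mg f1 g1.
pose F : {mfun R >-> R} := mfun_Sub (mem_set mf).
pose G : {mfun R >-> R} := mfun_Sub (mem_set mg).
have [||_ <- //] := expectation_independent_mul
  (independent_pair_comp F G XY).
- by apply: (bounded_integrable 1) => // w; exact: f1.
- by apply: (bounded_integrable 1) => // w; exact: g1.
Qed.

Lemma expectation_cosD (X Y : {mfun T >-> R}) : independent_pair P X Y ->
  \int[P]_w cos (X w + Y w) = \int[P]_w cos (X w) * \int[P]_w cos (Y w) -
    \int[P]_w sin (X w) * \int[P]_w sin (Y w).
Proof.
move=> XY.
rewrite -!expectation_independent_comp//; try exact: cos_max; try exact: sin_max;
  try exact: measurable_cos; try exact: measurable_sin.
rewrite -RintegralB//.
- by apply: eq_Rintegral => w _; rewrite cosD.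
- apply: (bounded_integrable 1) => [|w].
    by apply: measurable_funM; apply: measurableT_comp => //; exact: measurable_cos.
  by rewrite normrM mulr_ile1// cos_max.
- apply: (bounded_integrable 1) => [|w].
    by apply: measurable_funM; apply: measurableT_comp => //; exact: measurable_sin.
  by rewrite normrM mulr_ile1// sin_max.
Qed.

Lemma expectation_sinD (X Y : {mfun T >-> R}) : independent_pair P X Y ->
  \int[P]_w sin (X w + Y w) = \int[P]_w sin (X w) * \int[P]_w cos (Y w) +
    \int[P]_w cos (X w) * \int[P]_w sin (Y w).
Proof.
move=> XY.
rewrite -!expectation_independent_comp//; try exact: cos_max; try exact: sin_max;
  try exact: measurable_cos; try exact: measurable_sin.
rewrite -RintegralD//.
- by apply: eq_Rintegral => w _; rewrite sinD.
- apply: (bounded_integrable 1) => [|w].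
    apply: measurable_funM; apply: measurableT_comp => //.
      exact: measurable_sin.
    exact: measurable_cos.
  by rewrite normrM mulr_ile1// ?cos_max ?sin_max.
- apply: (bounded_integrable 1) => [|w].
    apply: measurable_funM; apply: measurableT_comp => //.
      exact: measurable_cos.
    exact: measurable_sin.
  by rewrite normrM mulr_ile1// ?cos_max ?sin_max.
Qed.

Lemma normr_expectation_cos (X : T -> R) : measurable_fun [set: T] X ->
  `|\int[P]_w cos (X w)| <= 1.
Proof.
move=> mX; rewrite -[leRHS](Rintegral_cstT P); apply: normr_Rintegral_le.
- exact: integrable_cos.
- exact: integrable_cstT.
- by move=> w; exact: cos_max.
Qed.

Lemma normr_expectation_sin (X : T -> R) : measurable_fun [set: T] X ->
  `|\int[P]_w sin (X w)| <= 1.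
Proof.
move=> mX; rewrite -[leRHS](Rintegral_cstT P); apply: normr_Rintegral_le.
- exact: integrable_sin.
- exact: integrable_cstT.
- by move=> w; exact: sin_max.
Qed.

(** From exp(-q) (1 + q) <= 1 the difference exp(-q) - 1 + q is at most q (1 - exp(-q)), hence at
    most q^2. *)
Lemma expRN_bound (q : R) : 0 <= q -> `|1 - q - expR (- q)| <= q ^+ 2.
Proof.
move=> q0; have h1 := expR_ge1Dx (- q); have h2 := expR_ge1Dx q.
have e : expR (- q) * expR q = 1 by rewrite -expRD addNr expR0.
have e0 := expR_gt0 (- q).
rewrite ler0_norm; last lra.
have : expR (- q) * (1 + q) <= 1 by rewrite -[leRHS]e ler_wpM2l// ltW.
set z := expR (- q) in h1 e0 * => hz.
have : 0 <= q * (z - 1 + q) by rewrite mulr_ge0//; lra.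
nra.
Qed.

Hypotheses (hV : iid V)
  (hmean : forall k, ('E_P[V k] = 0)%E)
  (hvar : forall k, ('V_P[V k] = (sigma ^+ 2)%:E)%E).

(** Lindeberg replacement, one summand at a time: all factors have modulus at most 1, so the errors
    simply add. A summand costs one [truncated_variance] for its cosine, one for its sine, and q^2
    for replacing 1 - q by exp(-q), where q = sigma^2 u^2 / 2 and q^2 <= sigma^4 / 4 r^2 u^2. *)
Lemma characteristic_function_partial_sum (u : nat -> R) (r : R) (n : nat) :
  (forall i, (i < n)%N -> `|u i| <= r) ->
  `|\int[P]_w cos (partial_sum u V n w) -
    expR (- (sigma ^+ 2 / 2 * \sum_(i < n) u i ^+ 2))| <=
    (2 * truncated_variance V r + sigma ^+ 4 / 4 * r ^+ 2) *
      \sum_(i < n) u i ^+ 2 /\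
  `|\int[P]_w sin (partial_sum u V n w)| <=
    (2 * truncated_variance V r + sigma ^+ 4 / 4 * r ^+ 2) *
      \sum_(i < n) u i ^+ 2.
Proof.
elim: n => [|n IH] ur.
  rewrite big_ord0 !mulr0 oppr0 expR0.
  have -> : partial_sum u V 0 = cst 0.
    by apply/funext => w; rewrite /partial_sum big_ord0.
  by rewrite /cst cos0 sin0 !Rintegral_cstT subrr normr0.
have ur' i : (i < n)%N -> `|u i| <= r by move=> m; apply: ur; rewrite ltnS ltnW.
have [IHc IHs] := IH ur'.
have un := ur n (ltnSn n).
have [Hc Hs] := characteristic_function_bound hV hmean hvar n un.
have mun : measurable_fun [set: T] (fun w => u n * V n w).
  exact: measurable_funM.
pose Y : {mfun T >-> R} := mfun_Sub (mem_set mun).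
have mlin : measurable_fun [set: R] (fun x => u n * x) by exact: measurable_funM.
have XY : independent_pair P (partial_sum u V n) Y.
  have := independent_pair_comp (mfun_Sub (mem_set (@measurable_id _ R setT)))
    (mfun_Sub (mem_set mlin)) (independent_partial_sum u n hV.1).
  by [].
have SE : partial_sum u V n.+1 = fun w => partial_sum u V n w + Y w.
  by apply/funext => w; rewrite /partial_sum big_ord_recr.
rewrite SE expectation_cosD// expectation_sinD// big_ord_recr/=.
have C1 := normr_expectation_cos (measurable_partial_sum u V n).
have S1 := normr_expectation_sin (measurable_partial_sum u V n).
have c1 := normr_expectation_cos mun.
set q := sigma ^+ 2 * u n ^+ 2 / 2 in Hc.
have q0 : 0 <= q by rewrite /q divr_ge0// mulr_ge0// sqr_ge0.
have qr : q ^+ 2 <= sigma ^+ 4 / 4 * r ^+ 2 * u n ^+ 2.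
  have -> : q ^+ 2 = sigma ^+ 4 / 4 * u n ^+ 2 * u n ^+ 2 by rewrite /q; field.
  have s4 : 0 <= sigma ^+ 4 / 4 by rewrite divr_ge0// exprn_even_ge0.
  rewrite ler_wpM2r ?sqr_ge0// ler_wpM2l//.
  by rewrite -(real_normK (num_real (u n))) lerXn2r// nnegrE (le_trans _ un).
have eq := expRN_bound q0.
rewrite !mulrDr opprD expRD.
have -> : sigma ^+ 2 / 2 * u n ^+ 2 = q by rewrite /q; field.
have eq1 : expR (- q) <= 1 by rewrite -expR0 ler_expR oppr_le0.
have eq0 := expR_ge0 (- q).
move: Hc Hs IHc IHs C1 S1 c1.
set c := \int[P]_w cos (u n * V n w); set s := \int[P]_w sin (u n * V n w).
set C := \int[P]_w cos (partial_sum u V n w).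
set S := \int[P]_w sin (partial_sum u V n w).
set p := expR (- (_ * \sum_(_ < _) _)).
set e := u n ^+ 2 * truncated_variance V r.
set K := 2 * truncated_variance V r + _.
set Q := \sum_(_ < _) _.
move=> Hc Hs IHc IHs C1 S1 c1.
have Ke : 2 * e + q ^+ 2 <= K * u n ^+ 2.
  by rewrite /K /e; lra.
have e0 : 0 <= e by rewrite (le_trans _ Hs).
split.
  have -> : C * c - S * s - p * expR (- q) =
    (C - p) * expR (- q) + C * (c - (1 - q)) + C * (1 - q - expR (- q)) - S * s.
    by ring.
  rewrite (le_trans (ler_normB _ _))//.
  rewrite (le_trans (lerD (ler_normD _ _) (lexx _)))//.
  rewrite (le_trans (lerD (lerD (ler_normD _ _) (lexx _)) (lexx _)))//.
  rewrite !normrM (@ger0_norm _ (expR _))//.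
  have h1 : `|C - p| * expR (- q) <= K * Q by rewrite (le_trans _ IHc)// ler_piMr.
  have h2 : `|C| * `|c - (1 - q)| <= e by rewrite (le_trans _ Hc)// ler_piMl.
  have h3 : `|C| * `|1 - q - expR (- q)| <= q ^+ 2 by rewrite (le_trans _ eq)// ler_piMl.
  have h4 : `|S| * `|s| <= e by rewrite (le_trans _ Hs)// ler_piMl.
  lra.
rewrite (le_trans (ler_normD _ _))// !normrM.
have h1 : `|S| * `|c| <= K * Q by rewrite (le_trans _ IHs)// ler_piMr.
have h4 : `|C| * `|s| <= e by rewrite (le_trans _ Hs)// ler_piMl.
by have := sqr_ge0 q; lra.
Qed.

End central_limit.

Section weighted_sums.
Context {d : measure_display} {T : measurableType d} {R : realType}
        {P : probability T R} {V : nat -> {RV P >-> R}} {sigma : R}.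
Hypotheses (hV : iid V)
  (hmean : forall k, ('E_P[V k] = 0)%E)
  (hvar : forall k, ('V_P[V k] = (sigma ^+ 2)%:E)%E).

Lemma partial_sum_second_moment (u : nat -> R) n :
  [/\ P.-integrable [set: T] (EFin \o partial_sum u V n),
      P.-integrable [set: T] (EFin \o (fun w => partial_sum u V n w ^+ 2)) &
      \int[P]_w (partial_sum u V n w ^+ 2) = sigma ^+ 2 * \sum_(i < n) u i ^+ 2].
Proof.
elim: n => [|n [i1 i2 IH]].
  have -> : partial_sum u V 0 = cst 0.
    by apply/funext => w; rewrite /partial_sum big_ord0.
  rewrite big_ord0 mulr0 /cst expr0n/= Rintegral_cstT.
  by split => //; exact: integrable_cstT.
have iV := integrable_V hmean hvar n.
have iV2 := integrable_sqr hmean hvar n.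
have [iSV ESV] := expectation_independent_mul (independent_partial_sum u n hV.1) i1 iV.
have SE : partial_sum u V n.+1 = fun w => partial_sum u V n w + u n * V n w.
  by apply/funext => w; rewrite /partial_sum big_ord_recr.
have j2 := integrable_scaleT (2 * u n) iSV.
have j3 := integrable_scaleT (u n ^+ 2) iV2.
have j12 := integrable_addT i2 j2.
have SE2 : (fun w => partial_sum u V n.+1 w ^+ 2) = (fun w =>
    partial_sum u V n w ^+ 2 + 2 * u n * (partial_sum u V n w * V n w) +
    u n ^+ 2 * V n w ^+ 2).
  by apply/funext => w; rewrite SE; ring.
split.
- rewrite SE; apply: integrable_addT => //; exact: integrable_scaleT.
- by rewrite SE2; exact: (integrable_addT j12 j3).
- rewrite SE2 (RintegralD measurableT j12 j3) (RintegralD measurableT i2 j2).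
  rewrite !RintegralZl// ESV (mean_Rintegral hmean) (sqr_Rintegral hmean hvar) IH.
  by rewrite big_ord_recr/= !mulr0 addr0 mulrDr (mulrC (u n ^+ 2)).
Qed.

(** Central limit theorem for a triangular array of weights, stated for the characteristic function
    at 1; other arguments, and other directions for a pair of sums, are reached by changing [u]. *)
Lemma partial_sum_cvg_normal (u : nat -> nat -> R) (r : nat -> R) (v : R) :
  (forall n i, (i < n)%N -> `|u n i| <= r n) -> r n @[n --> \oo] --> 0 ->
  \sum_(i < n) u n i ^+ 2 @[n --> \oo] --> v ->
  \int[P]_w cos (partial_sum (u n) V n w) @[n --> \oo] -->
    expR (- (sigma ^+ 2 / 2 * v)) /\
  \int[P]_w sin (partial_sum (u n) V n w) @[n --> \oo] --> (0 : R).
Proof.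
move=> ur r0 uv.
(* The absolute value is there for n = 0, where no weight forces [r n] to be nonnegative. *)
pose e n := (2 * truncated_variance V `|r n| + sigma ^+ 4 / 4 * `|r n| ^+ 2) *
  \sum_(i < n) u n i ^+ 2.
have nr0 : `|r n| @[n --> \oo] --> (0 : R).
  by rewrite -(@normr0 _ R); exact: cvg_norm.
have e0 : e n @[n --> \oo] --> (0 : R).
  rewrite -(mul0r v); apply: cvgM => //.
  have -> : (0 : R) = 2 * 0 + sigma ^+ 4 / 4 * (0 * 0) by rewrite !mulr0 addr0.
  apply: cvgD; (apply: cvgM; first exact: cvg_cst).
    by apply: (truncated_variance_cvg0 hmean hvar).
  exact: cvgM.
have bd n := characteristic_function_partial_sum hV hmean hvar
  (fun i (hi : (i < n)%N) => le_trans (ur n i hi) (ler_norm (r n))).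
split; last first.
  apply: (@squeeze_cvgr _ _ _ _ (fun n => - e n) e) => //.
    by apply: nearW => n; rewrite -ler_norml; exact: (bd n).2.
  by rewrite -oppr0; exact: cvgN.
pose g n := expR (- (sigma ^+ 2 / 2 * \sum_(i < n) u n i ^+ 2)).
have cg : g n @[n --> \oo] --> expR (- (sigma ^+ 2 / 2 * v)).
  rewrite /g; apply: (cvg_comp _ expR); last exact: continuous_expR.
  by apply: cvgN; apply: cvgM => //; exact: cvg_cst.
apply: (@squeeze_cvgr _ _ _ _ (fun n => g n - e n) (fun n => g n + e n)).
- by apply: nearW => n; rewrite -ler_distl; exact: (bd n).1.
- by rewrite -[X in _ --> X]subr0; exact: cvgB.
- by rewrite -[X in _ --> X]addr0; exact: cvgD.
Qed.

End weighted_sums.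

(** * Trigonometric approximation of the sign *)

Section smooth_sign.
Context {R : realType}.
Implicit Types (x y : R) (m : nat).

(* The odd cubic with fixed points 0, 1, -1 and zero derivative at 1 and -1, so that
   its iterates converge to the sign on [-1, 1] away from 0. *)
Definition sharpen x : R := (3 * x - x ^+ 3) / 2.

Definition soft_sign m x : R := iter m sharpen x.

Lemma sharpenN x : sharpen (- x) = - sharpen x.
Proof. by rewrite /sharpen; field. Qed.

Lemma soft_signN m x : soft_sign m (- x) = - soft_sign m x.
Proof. by elim: m => //= m IH; rewrite /soft_sign/= -/(soft_sign m _) IH sharpenN. Qed.

Lemma sharpen_itv x : 0 <= x <= 1 -> x <= sharpen x <= 1.
Proof.
move=> /andP[x0 x1]; rewrite /sharpen; apply/andP; split.
  have -> : (3 * x - x ^+ 3) / 2 = x + x * (1 - x ^+ 2) / 2 by field.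
  rewrite lerDl divr_ge0// mulr_ge0// subr_ge0 expr_le1//.
have -> : (3 * x - x ^+ 3) / 2 = 1 - (1 - x) ^+ 2 * (2 + x) / 2 by field.
rewrite gerBl divr_ge0// mulr_ge0// ?sqr_ge0//; lra.
Qed.

Lemma soft_sign_itv m x : 0 <= x <= 1 -> x <= soft_sign m x <= 1.
Proof.
move=> x01; have /andP[x0 x1] := x01.
elim: m => [|m /andP[h1 h2]]; first by rewrite /soft_sign/= lexx.
rewrite /soft_sign/= -/(soft_sign m _).
have /sharpen_itv/andP[h3 h4] : 0 <= soft_sign m x <= 1.
  by rewrite h2 (le_trans x0).
by rewrite h4 (le_trans h1).
Qed.

(** One iteration at y multiplies the distance to 1 by (2 - y - y^2) / 2, which is at most 1 - x / 2
    because the iterates stay above x. *)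
Lemma soft_sign_ge m x : 0 <= x <= 1 -> 1 - soft_sign m x <= (1 - x / 2) ^+ m.
Proof.
move=> x01; have /andP[x0 x1] := x01.
elim: m => [|m IH]; first by rewrite /soft_sign/= expr0; lra.
have /andP[h1 h2] := soft_sign_itv m x01.
rewrite /soft_sign/= -/(soft_sign m _) exprSr.
set y := soft_sign m x in IH h1 h2 *.
have -> : 1 - sharpen y = (1 - y) * ((2 - y - y ^+ 2) / 2).
  by rewrite /sharpen; field.
apply: ler_pM => //; first by lra.
- by nra.
- by nra.
Qed.

Lemma soft_sign_abs m x : `|x| <= 1 -> `|soft_sign m x| = soft_sign m `|x|.
Proof.
have pos y : 0 <= y -> `|y| <= 1 -> `|soft_sign m y| = soft_sign m y.
  move=> y0; rewrite (ger0_norm y0) => y1.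
  have /(soft_sign_itv m)/andP[h _] : 0 <= y <= 1 by rewrite y0.
  by rewrite ger0_norm// (le_trans y0).
move=> x1; have [x0|x0] := leP 0 x; first by rewrite (ger0_norm x0) pos.
by rewrite (ltr0_norm x0) -normrN -soft_signN pos ?normrN// oppr_ge0 ltW.
Qed.

Lemma soft_sign_norm_le1 m x : `|x| <= 1 -> `|soft_sign m x| <= 1.
Proof.
move=> x1; rewrite soft_sign_abs//.
by have /(soft_sign_itv m)/andP[] : 0 <= `|x| <= 1 by rewrite normr_ge0.
Qed.

(** The slope 3/2 of the cubic at 0 is its largest growth factor on [0, 1]. This locates the
    neighbourhood of 0 on which the approximate sign is not yet close to 1 in modulus. *)
Lemma soft_sign_norm_le m x : `|x| <= 1 -> `|soft_sign m x| <= (3 / 2) ^+ m * `|x|.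
Proof.
move=> x1; have x01 : 0 <= `|x| <= 1 by rewrite normr_ge0.
rewrite soft_sign_abs//; elim: m => [|m IH]; first by rewrite expr0 mul1r.
have /andP[h1 h2] := soft_sign_itv m x01.
rewrite /soft_sign/= -/(soft_sign m _) exprS -mulrA.
have : sharpen (soft_sign m `|x|) <= 3 / 2 * soft_sign m `|x|.
  rewrite /sharpen; have : 0 <= soft_sign m `|x| ^+ 3 by rewrite exprn_ge0// (le_trans _ h1).
  lra.
by move=> /le_trans; apply; rewrite ler_wpM2l.
Qed.

Lemma soft_sign_cvg x : x != 0 -> `|x| <= 1 ->
  soft_sign m x ^+ 2 @[m --> \oo] --> (1 : R).
Proof.
move=> x0 x1; have x01 : 0 <= `|x| <= 1 by rewrite normr_ge0.
have -> : (fun m => soft_sign m x ^+ 2) =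
    (fun m => soft_sign m `|x| * soft_sign m `|x|).
  apply/funext => m.
  by rewrite -expr2 -soft_sign_abs// real_normK// num_real.
suff h : soft_sign m `|x| @[m --> \oo] --> (1 : R).
  have h2 : soft_sign m `|x| * soft_sign m `|x| @[m --> \oo] --> (1 * 1 : R).
    exact: cvgM.
  by rewrite mulr1 in h2.
apply: (@squeeze_cvgr _ _ _ _ (fun m => 1 - (1 - `|x| / 2) ^+ m) (cst 1)).
- apply: nearW => m /=; have /andP[_ ->] := soft_sign_itv m x01.
  by rewrite andbT lerBlDr -lerBlDl soft_sign_ge.
- rewrite -[X in _ --> X]subr0; apply: cvgB; first exact: cvg_cst.
  apply: cvg_expr; rewrite ger0_norm; last by lra.
  by have : 0 < `|x| by [rewrite normr_gt0]; lra.
- exact: cvg_cst.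
Qed.

(* A trigonometric polynomial close to the sign of x for 0 < |x| <= L; large values
   of |x| are controlled by Chebyshev's inequality. *)
Definition periodic_sign (L : R) m x := soft_sign m (sin (x / L)).

Lemma periodic_sign_le1 L m x : `|periodic_sign L m x| <= 1.
Proof. by rewrite soft_sign_norm_le1// sin_max. Qed.

Lemma periodic_sign_sqr_le1 L m x : periodic_sign L m x ^+ 2 <= 1.
Proof.
rewrite -(real_normK (num_real (periodic_sign L m x))).
by rewrite expr_le1// periodic_sign_le1.
Qed.

Lemma periodic_sign_ge0 (L : R) m x : 0 < L -> 0 <= x <= L ->
  0 <= periodic_sign L m x.
Proof.
move=> L0 /andP[x0 xL]; have s0 : 0 <= sin (x / L).
  apply: sin_ge0_pi; rewrite divr_ge0 ?(ltW L0)//=.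
  rewrite (@le_trans _ _ 1)//; first by rewrite ler_pdivrMr// mul1r.
  by have := @pi_ge2 R; lra.
have /(soft_sign_itv m)/andP[h _] : 0 <= sin (x / L) <= 1 by rewrite s0 sin_le1.
exact: le_trans h.
Qed.

Lemma periodic_signN (L : R) m x : periodic_sign L m (- x) = - periodic_sign L m x.
Proof. by rewrite /periodic_sign mulNr sinN soft_signN. Qed.

(** The threshold is where the bound (3/2)^m |x| / L reaches 1/2. Below it the gap 1 - h^2 is at
    least 3/4, so three times the gap exceeds 1 and pays for any error in an indicator. *)
Lemma periodic_sign_small (L : R) m x : 0 < L -> 
  `|x| <= L / (2 * (3 / 2) ^+ m) -> periodic_sign L m x ^+ 2 <= 1 / 4.
Proof.
move=> L0 xL; rewrite -(real_normK (num_real (periodic_sign L m x))).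
have e0 : (0 : R) < (3 / 2) ^+ m by rewrite exprn_gt0.
have h : `|periodic_sign L m x| <= 1 / 2.
  rewrite (le_trans (soft_sign_norm_le m (sin_max _)))//.
  rewrite (@le_trans _ _ ((3 / 2) ^+ m * (`|x| / L)))//.
    rewrite ler_wpM2l ?(ltW e0)// (le_trans (normr_sin_le _))//.
    by rewrite normrM normfV (gtr0_norm L0).
  rewrite (@le_trans _ _ ((3 / 2) ^+ m * ((2 * (3 / 2) ^+ m)^-1)))//.
    rewrite ler_wpM2l ?(ltW e0)// ler_pdivrMr// mulrC//.
  by rewrite invfM mulrCA divff ?gt_eqF// mulr1 div1r.
have := normr_ge0 (periodic_sign L m x); nra.
Qed.

(* Pointwise form of the quadrant estimate: [b] is the truth value of an event which
   agrees with s w <= 0 outside the error set where |s w| or s^2 is at most [r]. *)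
Lemma product_sign_approx (L : R) m (s w r : R) (b : bool) : 0 < L -> 0 <= r ->
  (r < `|s * w| -> r < s ^+ 2 -> b = (s * w <= 0)) ->
  `|b%:R - (1 - periodic_sign L m s * periodic_sign L m w) / 2| <=
    3 * (1 - periodic_sign L m s ^+ 2) + 3 * (1 - periodic_sign L m w ^+ 2) +
    (s ^+ 2 + w ^+ 2) / L ^+ 2 + r / (L / (2 * (3 / 2) ^+ m)) ^+ 2.
Proof.
move=> L0 r0 hb; set de := L / _.
have de0 : 0 < de by rewrite divr_gt0// mulr_gt0// exprn_gt0.
set hs := periodic_sign L m s; set hw := periodic_sign L m w.
have hs1 := periodic_sign_sqr_le1 L m s; have hw1 := periodic_sign_sqr_le1 L m w.
have as1 := periodic_sign_le1 L m s; have aw1 := periodic_sign_le1 L m w.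
rewrite -/hs -/hw in hs1 hw1 as1 aw1.
have r' : 0 <= r / de ^+ 2 by rewrite divr_ge0// exprn_ge0// ltW.
have s' : 0 <= s ^+ 2 / L ^+ 2 by rewrite divr_ge0// sqr_ge0.
have w' : 0 <= w ^+ 2 / L ^+ 2 by rewrite divr_ge0// sqr_ge0.
rewrite (mulrDl (s ^+ 2)).
(* Since the left side never exceeds 1, in each exceptional case it is enough that one of the error
   terms is at least 1. *)
have triv : `|b%:R - (1 - hs * hw) / 2| <= 1.
  have := ler_norm (hs * hw); have := ler_norm (- (hs * hw)).
  have : `|hs * hw| <= 1 by rewrite normrM mulr_ile1.
  rewrite normrN => h1 h2 h3; rewrite ler_norml.
  by case: b {hb} => /=; lra.
have big x : L < `|x| -> 1 <= x ^+ 2 / L ^+ 2.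
  move=> Lx; rewrite ler_pdivlMr ?exprn_gt0// mul1r.
  by rewrite -(real_normK (num_real x)) lerXn2r ?nnegrE ?(ltW L0)// ltW.
have [sL|/big h] := leP `|s| L; last by lra.
have [wL|/big h] := leP `|w| L; last by lra.
have [/(periodic_sign_small L0)|sd] := leP `|s| de.
  by rewrite -/hs => h; lra.
have [/(periodic_sign_small L0)|wd] := leP `|w| de.
  by rewrite -/hw => h; lra.
(* If r >= de^2, the last error term is at least 1. Otherwise |s| and |w| exceed [de], so |s w| and
   s^2 exceed r and the truth value of the event is known. *)
have [rd|rd] := leP (de ^+ 2) r.
  have : 1 <= r / de ^+ 2 by rewrite ler_pdivlMr ?exprn_gt0// mul1r.
  by lra.
have -> : b = (s * w <= 0).
  apply: hb.
    by rewrite normrM (lt_le_trans rd)// expr2 ler_pM ?ltW// ltW.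
  rewrite -(real_normK (num_real s)) (lt_le_trans rd)//.
  by apply: lerXn2r; rewrite ?nnegrE ?normr_ge0 ?ltW.
(* Applied to the moduli of the two approximate signs, whose true signs are those of s and w on
   [-L, L]; the four sign cases then differ only in bookkeeping. *)
have main x y : 0 <= x -> 0 <= y -> x ^+ 2 <= 1 -> y ^+ 2 <= 1 ->
    1 - x * y <= (1 - x ^+ 2) + (1 - y ^+ 2) /\ 0 <= 1 - x * y.
  move=> x0 y0 x1 y1; have hx : x <= 1 by nra.
  have hy : y <= 1 by nra.
  by split; nra.
have pos x : 0 <= x -> `|x| <= L -> 0 <= periodic_sign L m x.
  by move=> x0 xL; apply: periodic_sign_ge0 => //; rewrite x0 -(ger0_norm x0).
have neg x : x < 0 -> `|x| <= L -> 0 <= - periodic_sign L m x.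
  move=> x0 xL; rewrite -periodic_signN pos ?oppr_ge0 ?(ltW x0)//.
  by rewrite normrN.
have nz x : de < `|x| -> x != 0.
  by move=> h; rewrite -normr_gt0 (lt_trans de0).
have [s0|s0] := leP 0 s; have [w0|w0] := leP 0 w.
- have sp : 0 < s by rewrite lt_def s0 nz.
  have wp : 0 < w by rewrite lt_def w0 nz.
  have -> /= : (s * w <= 0) = false by apply/negbTE; rewrite -ltNge mulr_gt0.
  have [h1 h2] := main _ _ (pos s s0 sL) (pos w w0 wL) hs1 hw1.
  rewrite -/hs -/hw in h1 h2.
  by rewrite sub0r normrN ger0_norm; lra.
- rewrite mulr_ge0_le0 ?(ltW w0)//=.
  have [||h1 h2] := main _ _ (pos s s0 sL) (neg w w0 wL); rewrite ?sqrrN//.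
  rewrite -/hs -/hw sqrrN mulrN in h1 h2.
  by rewrite ger0_norm; lra.
- rewrite mulr_le0_ge0 ?(ltW s0)//=.
  have [||h1 h2] := main _ _ (neg s s0 sL) (pos w w0 wL); rewrite ?sqrrN//.
  rewrite -/hs -/hw sqrrN mulNr in h1 h2.
  by rewrite ger0_norm; lra.
- have -> /= : (s * w <= 0) = false.
    by apply/negbTE; rewrite -ltNge nmulr_lgt0.
  have [||h1 h2] := main _ _ (neg s s0 sL) (neg w w0 wL); rewrite ?sqrrN//.
  rewrite -/hs -/hw !sqrrN mulrNN in h1 h2.
  by rewrite sub0r normrN ger0_norm; lra.
Qed.

End smooth_sign.

(** The functions whose expectation is a linear combination of values of the characteristic function
    of a pair. As an inductive predicate it gives integrability and convergence by induction;
    closure under products, needed for the cubic, is a double induction on the product-to-sum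
    formulas. *)
Inductive trigonometric {R : realType} : (R -> R -> R) -> Prop :=
| trigonometric_cos a b : trigonometric (fun s t => cos (a * s + b * t))
| trigonometric_sin a b : trigonometric (fun s t => sin (a * s + b * t))
| trigonometric_add f g : trigonometric f -> trigonometric g ->
    trigonometric (fun s t => f s t + g s t)
| trigonometric_scale c f : trigonometric f ->
    trigonometric (fun s t => c * f s t).

Section trigonometric_theory.
Context {R : realType}.
Implicit Types f g : R -> R -> R.

Lemma cosM_cos (A B : R) :
  cos A * cos B = 1 / 2 * (cos (A - B) + cos (A + B)).
Proof. by rewrite cosB cosD; field. Qed.

Lemma cosM_sin (A B : R) :
  cos A * sin B = 1 / 2 * (sin (A + B) + -1 * sin (A - B)).
Proof. by rewrite sinB sinD; field. Qed.

Lemma sinM_cos (A B : R) :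
  sin A * cos B = 1 / 2 * (sin (A + B) + sin (A - B)).
Proof. by rewrite sinB sinD; field. Qed.

Lemma sinM_sin (A B : R) :
  sin A * sin B = 1 / 2 * (cos (A - B) + -1 * cos (A + B)).
Proof. by rewrite cosB cosD; field. Qed.

Lemma trigonometric_ext f g : (forall s t, f s t = g s t) ->
  trigonometric f -> trigonometric g.
Proof.
by move=> fg; have -> : g = f by apply/funext => s; apply/funext => t.
Qed.

Lemma trigonometric_cst (c : R) : trigonometric (fun _ _ => c).
Proof.
apply: trigonometric_ext (trigonometric_scale c (trigonometric_cos 0 0)).
by move=> s t; rewrite !mul0r addr0 cos0 mulr1.
Qed.

Lemma trigonometric_mul f g : trigonometric f -> trigonometric g ->
  trigonometric (fun s t => f s t * g s t).
Proof.
move=> hf; elim: hf g => {f} [a b|a b|f1 f2 _ IH1 _ IH2|c f _ IH] g hg.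
- elim: hg => {g} [a' b'|a' b'|g1 g2 _ IH1 _ IH2|c g _ IH].
  + apply: trigonometric_ext (trigonometric_scale (1 / 2) (trigonometric_add
      (trigonometric_cos (a - a') (b - b')) (trigonometric_cos (a + a') (b + b')))).
    move=> s t; rewrite (cosM_cos (a * s + b * t)); congr (_ * (_ + _));
      try congr (-1 * _); congr (_ _); ring.
  + apply: trigonometric_ext (trigonometric_scale (1 / 2) (trigonometric_add
      (trigonometric_sin (a + a') (b + b'))
      (trigonometric_scale (-1) (trigonometric_sin (a - a') (b - b'))))).
    move=> s t; rewrite (cosM_sin (a * s + b * t)); congr (_ * (_ + _));
      try congr (-1 * _); congr (_ _); ring.
  + apply: trigonometric_ext (trigonometric_add IH1 IH2).
    by move=> s t; rewrite mulrDr.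
  + apply: trigonometric_ext (trigonometric_scale c IH).
    by move=> s t; rewrite mulrCA.
- elim: hg => {g} [a' b'|a' b'|g1 g2 _ IH1 _ IH2|c g _ IH].
  + apply: trigonometric_ext (trigonometric_scale (1 / 2) (trigonometric_add
      (trigonometric_sin (a + a') (b + b')) (trigonometric_sin (a - a') (b - b')))).
    move=> s t; rewrite (sinM_cos (a * s + b * t)); congr (_ * (_ + _));
      try congr (-1 * _); congr (_ _); ring.
  + apply: trigonometric_ext (trigonometric_scale (1 / 2) (trigonometric_add
      (trigonometric_cos (a - a') (b - b'))
      (trigonometric_scale (-1) (trigonometric_cos (a + a') (b + b'))))).
    move=> s t; rewrite (sinM_sin (a * s + b * t)); congr (_ * (_ + _));
      try congr (-1 * _); congr (_ _); ring.
  + apply: trigonometric_ext (trigonometric_add IH1 IH2).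
    by move=> s t; rewrite mulrDr.
  + apply: trigonometric_ext (trigonometric_scale c IH).
    by move=> s t; rewrite mulrCA.
- apply: trigonometric_ext (trigonometric_add (IH1 g hg) (IH2 g hg)).
  by move=> s t; rewrite mulrDl.
- apply: trigonometric_ext (trigonometric_scale c (IH g hg)).
  by move=> s t; rewrite mulrA.
Qed.

Lemma trigonometric_soft_sign m f : trigonometric f ->
  trigonometric (fun s t => soft_sign m (f s t)).
Proof.
move=> hf; elim: m => // m IH.
apply: trigonometric_ext (trigonometric_add (trigonometric_scale (3 / 2) IH)
  (trigonometric_scale (- (1 / 2)) (trigonometric_mul IH (trigonometric_mul IH IH)))).
by move=> s t; rewrite /= /soft_sign/= -/(soft_sign m _) /sharpen; field.
Qed.

Lemma trigonometric_periodic_sign1 (L : R) m :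
  trigonometric (fun s _ => periodic_sign L m s).
Proof.
apply: trigonometric_ext (trigonometric_soft_sign m (trigonometric_sin L^-1 0)).
by move=> s t; rewrite mul0r addr0 mulrC.
Qed.

Lemma trigonometric_periodic_sign2 (L : R) m :
  trigonometric (fun _ t => periodic_sign L m t).
Proof.
apply: trigonometric_ext (trigonometric_soft_sign m (trigonometric_sin 0 L^-1)).
by move=> s t; rewrite mul0r add0r mulrC.
Qed.

Lemma trigonometric_oneB_sqr f : trigonometric f ->
  trigonometric (fun s t => 1 - f s t ^+ 2).
Proof.
move=> hf; apply: trigonometric_ext (trigonometric_add (trigonometric_cst 1)
  (trigonometric_scale (-1) (trigonometric_mul hf hf))).
by move=> s t; rewrite mulN1r expr2.
Qed.

Lemma integrable_trigonometric d (T : measurableType d) (P : probability T R)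
  f (X Y : T -> R) : trigonometric f -> measurable_fun [set: T] X ->
  measurable_fun [set: T] Y ->
  P.-integrable [set: T] (EFin \o (fun w => f (X w) (Y w))).
Proof.
move=> hf mX mY.
have mlin a b : measurable_fun [set: T] (fun w => a * X w + b * Y w).
  by apply: measurable_funD; exact: measurable_funM.
elim: hf => {f} [a b|a b|f g _ IHf _ IHg|c f _ IH].
- exact: integrable_cos.
- exact: integrable_sin.
- exact: integrable_addT.
- exact: integrable_scaleT.
Qed.

End trigonometric_theory.

(** * Convergence of double quadrant probabilities *)

Section quadrant_probability.
Context {R : realType} {d d0 : measure_display} {T : measurableType d}
  {T0 : measurableType d0} {P : probability T R} {P0 : probability T0 R}
  {S W : nat -> T -> R} {G H : T0 -> R}.
Hypotheses (mS : forall n, measurable_fun [set: T] (S n))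
  (mW : forall n, measurable_fun [set: T] (W n))
  (mG : measurable_fun [set: T0] G) (mH : measurable_fun [set: T0] H).
Hypothesis cvg_cos : forall a b,
  \int[P]_w cos (a * S n w + b * W n w) @[n --> \oo] -->
  \int[P0]_w cos (a * G w + b * H w).
Hypothesis cvg_sin : forall a b,
  \int[P]_w sin (a * S n w + b * W n w) @[n --> \oo] -->
  \int[P0]_w sin (a * G w + b * H w).

Lemma cvg_trigonometric f : trigonometric f ->
  \int[P]_w f (S n w) (W n w) @[n --> \oo] --> \int[P0]_w f (G w) (H w).
Proof.
elim=> {f} [a b|a b|f g hf IHf hg IHg|c f hf IH].
- exact: cvg_cos.
- exact: cvg_sin.
- rewrite RintegralD//; try exact: integrable_trigonometric.
  have -> : (fun n => \int[P]_w (f (S n w) (W n w) + g (S n w) (W n w))) =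
      (fun n => \int[P]_w f (S n w) (W n w) + \int[P]_w g (S n w) (W n w)).
    apply/funext => n.
    by rewrite RintegralD//; exact: integrable_trigonometric.
  exact: cvgD.
- rewrite RintegralZl//; try exact: integrable_trigonometric.
  have -> : (fun n => \int[P]_w (c * f (S n w) (W n w))) =
      (fun n => c * \int[P]_w f (S n w) (W n w)).
    apply/funext => n.
    by rewrite RintegralZl//; exact: integrable_trigonometric.
  apply: cvgM => //; exact: cvg_cst.
Qed.

End quadrant_probability.

Section quadrant_approximation.
Context {R : realType} {d : measure_display} {T : measurableType d}
  {P : probability T R} {X Y : T -> R}.
Hypotheses (mX : measurable_fun [set: T] X) (mY : measurable_fun [set: T] Y)
  (iX : P.-integrable [set: T] (EFin \o (fun w => X w ^+ 2)))
  (iY : P.-integrable [set: T] (EFin \o (fun w => Y w ^+ 2))).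

Lemma quadrant_approx (L : R) m (r : T -> R) (E : set T) : 0 < L ->
  measurable E -> P.-integrable [set: T] (EFin \o r) ->
  (forall w, 0 <= r w) ->
  (forall w, r w < `|X w * Y w| -> r w < X w ^+ 2 -> (w \in E) = (X w * Y w <= 0)) ->
  `|fine (P E) -
    \int[P]_w ((1 - periodic_sign L m (X w) * periodic_sign L m (Y w)) / 2)| <=
    3 * \int[P]_w (1 - periodic_sign L m (X w) ^+ 2) +
    3 * \int[P]_w (1 - periodic_sign L m (Y w) ^+ 2) +
    (\int[P]_w (X w ^+ 2) + \int[P]_w (Y w ^+ 2)) / L ^+ 2 +
    (\int[P]_w r w) / (L / (2 * (3 / 2) ^+ m)) ^+ 2.
Proof.
move=> L0 mE ir r0 hE.
have tX := trigonometric_periodic_sign1 L m.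
have tY := trigonometric_periodic_sign2 L m.
have i1 := integrable_trigonometric P (trigonometric_oneB_sqr tX) mX mY.
have i2 := integrable_trigonometric P (trigonometric_oneB_sqr tY) mX mY.
have i3 : P.-integrable [set: T] (EFin \o
    (fun w => (1 - periodic_sign L m (X w) * periodic_sign L m (Y w)) / 2)).
  apply: (@integrable_trigonometric R d T P (fun s t =>
    (1 - periodic_sign L m s * periodic_sign L m t) / 2) X Y _ mX mY).
  apply: trigonometric_ext (trigonometric_scale (1 / 2) (trigonometric_add
    (trigonometric_cst 1) (trigonometric_scale (-1) (trigonometric_mul tX tY)))).
  by move=> s t; field.
have iE := integrable_indicT P mE.
rewrite -(Rintegral_indic P mE) -RintegralB//.
set de := (L / _) ^+ 2.
pose bd w := 3 * (1 - periodic_sign L m (X w) ^+ 2) +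
  3 * (1 - periodic_sign L m (Y w) ^+ 2) +
  L ^- 2 * (X w ^+ 2 + Y w ^+ 2) + de^-1 * r w.
have j1 := integrable_scaleT 3 i1.
have j2 := integrable_scaleT 3 i2.
have j12 := integrable_addT j1 j2.
have j3 := integrable_scaleT (L ^- 2) (integrable_addT iX iY).
have j4 := integrable_scaleT de^-1 ir.
have j123 := integrable_addT j12 j3.
have ibd : P.-integrable [set: T] (EFin \o bd) by exact: (integrable_addT j123 j4).
rewrite [leRHS](_ : _ = \int[P]_w bd w).
  apply: normr_Rintegral_le => //; first exact: (integrable_subT iE i3).
  move=> w; rewrite /bd indicE (mulrC (L ^- 2)) (mulrC de^-1).
  by apply: product_sign_approx => //; exact: hE.
rewrite /bd (RintegralD measurableT j123 j4) (RintegralD measurableT j12 j3).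
rewrite (RintegralD measurableT j1 j2) !RintegralZl//; last exact: integrable_addT.
by rewrite RintegralD// (mulrC (L ^- 2)) (mulrC de^-1).
Qed.

(** Where 0 < |X| <= L the gap tends to 0, hence also in mean by dominated convergence. Where |X| >
    L it is at most 1, which is at most X^2 / L^2. At X = 0 the approximate sign vanishes for every
    m, so this set must be null. *)
Lemma periodic_sign_gap (L e : R) : 0 < L -> 0 < e ->
  P [set w | X w = 0] = 0%E ->
  \forall m \near \oo, \int[P]_w (1 - periodic_sign L m (X w) ^+ 2) <=
    e + (\int[P]_w (X w ^+ 2)) / L ^+ 2.
Proof.
move=> L0 e0 X0.
have mI : measurable [set w | `|X w| <= L].
  rewrite [X in measurable X](_ : _ = (fun w => `|X w|) @^-1` `]-oo, L]).
    by rewrite -[X in measurable X]setTI; apply: measurableT_comp => //.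
  by apply/seteqP; split => w /=; rewrite in_itv.
pose f m w : R := (1 - periodic_sign L m (X w) ^+ 2) * \1_[set w | `|X w| <= L] w.
have ih m := integrable_trigonometric P
  (trigonometric_oneB_sqr (trigonometric_periodic_sign1 L m)) mX mY.
have mh m : measurable_fun [set: T] (fun w => 1 - periodic_sign L m (X w) ^+ 2).
  by have /integrableP[/measurable_EFinP] := ih m.
have mf m : measurable_fun [set: T] (f m).
  by apply: measurable_funM => //; exact: measurable_indic.
have f0 m w : 0 <= f m w by rewrite mulr_ge0// subr_ge0 periodic_sign_sqr_le1.
have f1 m w : `|f m w| <= 1.
  rewrite ger0_norm// /f indicE mulr_ile1//.
  - by rewrite subr_ge0 periodic_sign_sqr_le1.
  - by rewrite gerBl sqr_ge0.
  - by case: (_ \in _).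
have cf : \int[P]_w f m w @[m --> \oo] --> \int[P]_w 0.
  apply: (dominated_cvg_Rintegral (Y := cst 1)) => //.
    exact: integrable_cstT.
  exists [set w | X w = 0]; split => //.
    rewrite [X in measurable X](_ : _ = X @^-1` [set 0])//.
    by rewrite -[X in measurable X]setTI; exact: mX.
  move=> w /= h; apply: contrapT => Xw0; apply: h; move/eqP: Xw0 => Xw0.
  rewrite /f indicE; have [h|h] := boolP (w \in _); last first.
    by under eq_fun do rewrite mulr0; exact: cvg_cst.
  under eq_fun do rewrite mulr1.
  rewrite -(subrr 1); apply: cvgB; first exact: cvg_cst.
  apply: soft_sign_cvg; last exact: sin_max.
  have XL : `|X w| <= L by rewrite inE in h.
  have sin_neq0 x : 0 < x -> x <= L -> sin (x / L) != 0.
    move=> x0 xL; rewrite gt_eqF// sin_gt0_pi// divr_gt0//=.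
    rewrite (@le_lt_trans _ _ 1)//; first by rewrite ler_pdivrMr// mul1r.
    by have := @pi_ge2 R; lra.
  have [x0|x0|x0] := ltgtP 0 (X w).
  - by apply: sin_neq0 => //; rewrite -(ger0_norm (ltW x0)).
  - rewrite -oppr_eq0 -sinN -mulNr; apply: sin_neq0; first by rewrite oppr_gt0.
    by rewrite -(ler0_norm (ltW x0)).
  - by rewrite -x0 eqxx in Xw0.
rewrite Rintegral_cstT in cf.
have /cvgrPdist_le/(_ e e0) := cf.
apply: filterS => m; rewrite sub0r normrN => hm.
have {}hm : \int[P]_w f m w <= e by rewrite (le_trans _ hm)// ler_norm.
apply: le_trans (lerD hm (lexx _)).
rewrite mulrC -RintegralZl// -RintegralD//; last 2 first.
- by apply: (bounded_integrable 1) => //; exact: mf.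
- exact: integrable_scaleT.
apply: le_Rintegral => //.
- apply: integrable_addT; last exact: integrable_scaleT.
  by apply: (bounded_integrable 1) => //; exact: mf.
- move=> w _; rewrite /f indicE; have [h|h] := boolP (w \in _).
    by rewrite mulr1 lerDl mulr_ge0// ?sqr_ge0// invr_ge0 sqr_ge0.
  have XL : L < `|X w| by rewrite ltNge; apply/negP => XL; move/negP: h; rewrite inE.
  rewrite mulr0 add0r mulrC (@le_trans _ _ 1)// ?gerBl ?sqr_ge0//.
  rewrite ler_pdivlMr ?exprn_gt0// mul1r -(real_normK (num_real (X w))).
  by apply: lerXn2r; rewrite ?nnegrE ?normr_ge0 ?(ltW L0)// ltW.
Qed.

End quadrant_approximation.

Section quadrant_convergence.
Context {R : realType} {d d0 : measure_display} {T : measurableType d}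
  {T0 : measurableType d0} {P : probability T R} {P0 : probability T0 R}
  {S W : nat -> T -> R} {G H : T0 -> R}.
Hypotheses (mS : forall n, measurable_fun [set: T] (S n))
  (mW : forall n, measurable_fun [set: T] (W n))
  (mG : measurable_fun [set: T0] G) (mH : measurable_fun [set: T0] H).
Hypothesis cvg_cos : forall a b,
  \int[P]_w cos (a * S n w + b * W n w) @[n --> \oo] -->
  \int[P0]_w cos (a * G w + b * H w).
Hypothesis cvg_sin : forall a b,
  \int[P]_w sin (a * S n w + b * W n w) @[n --> \oo] -->
  \int[P0]_w sin (a * G w + b * H w).
Hypotheses
  (iS : forall n, P.-integrable [set: T] (EFin \o (fun w => S n w ^+ 2)))
  (iW : forall n, P.-integrable [set: T] (EFin \o (fun w => W n w ^+ 2)))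
  (iG : P0.-integrable [set: T0] (EFin \o (fun w => G w ^+ 2)))
  (iH : P0.-integrable [set: T0] (EFin \o (fun w => H w ^+ 2))).

(** The order of choice is L, then m, then n: L makes all second moment terms small, m makes the
    gaps of the limit pair small, and n transfers them. The gaps of [S n] and [W n] are not
    estimated directly; as expectations of trigonometric polynomials they are close to those of the
    limit. *)
Lemma quadrant_cvg (E : nat -> set T) (r : nat -> T -> R) (M : R) :
  (\forall n \near \oo, \int[P]_w (S n w ^+ 2) <= M) ->
  (\forall n \near \oo, \int[P]_w (W n w ^+ 2) <= M) ->
  P0 [set w | G w = 0] = 0%E -> P0 [set w | H w = 0] = 0%E ->
  (forall n, measurable (E n)) ->
  (forall n, P.-integrable [set: T] (EFin \o r n)) ->
  (forall n w, 0 <= r n w) -> \int[P]_w r n w @[n --> \oo] --> 0 ->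
  (\forall n \near \oo, forall w, r n w < `|S n w * W n w| ->
    r n w < S n w ^+ 2 -> (w \in E n) = (S n w * W n w <= 0)) ->
  fine (P (E n)) @[n --> \oo] --> fine (P0 [set w | G w * H w <= 0]).
Proof.
move=> SM WM G0 H0 mE ir r0 cr hE.
have mE0 : measurable [set w | G w * H w <= 0].
  rewrite [X in measurable X](_ : _ = (fun w => G w * H w) @^-1` `]-oo, 0]).
    by rewrite -[X in measurable X]setTI; apply: measurable_funM.
  by apply/seteqP; split => w /=; rewrite in_itv.
set g2 := \int[P0]_w (G w ^+ 2); set h2 := \int[P0]_w (H w ^+ 2).
have g20 : 0 <= g2 by apply: Rintegral_ge0 => w _; exact: sqr_ge0.
have h20 : 0 <= h2 by apply: Rintegral_ge0 => w _; exact: sqr_ge0.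
apply/cvgrPdist_le => e e0.
(* Total coefficient of L^-2: 2 |M| from the second moments of [S n] and [W n], and 7 = 1 + 3 + 3
   from the second moments of the limit, its own gaps, and the transferred gaps. The whole error is
   then at most e / 4 + 20 c. *)
pose K := 2 * `|M| + 7 * (g2 + h2) + 1.
have K0 : 0 < K by rewrite /K; have := normr_ge0 M; lra.
pose L := Num.sqrt (4 * K / e).
have L0 : 0 < L by rewrite sqrtr_gt0 divr_gt0// mulr_gt0.
have LK : K / L ^+ 2 = e / 4.
  rewrite sqr_sqrtr; last by rewrite divr_ge0// ?(ltW e0)// mulr_ge0// ltW.
  by field; rewrite !gt_eqF.
pose c := e / 100.
have c0 : 0 < c by rewrite divr_gt0.
have /filter_ex[m [hG hH]] : \forall m \near \oo,
    \int[P0]_w (1 - periodic_sign L m (G w) ^+ 2) <= c + g2 / L ^+ 2 /\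
    \int[P0]_w (1 - periodic_sign L m (H w) ^+ 2) <= c + h2 / L ^+ 2.
  near=> m; split; near: m.
    exact: (periodic_sign_gap mG mH iG).
  exact: (periodic_sign_gap mH mG iH).
have tX := trigonometric_periodic_sign1 L m.
have tY := trigonometric_periodic_sign2 L m.
have t3 : trigonometric (fun s t =>
    (1 - periodic_sign L m s * periodic_sign L m t) / 2).
  apply: trigonometric_ext (trigonometric_scale (1 / 2) (trigonometric_add
    (trigonometric_cst 1) (trigonometric_scale (-1) (trigonometric_mul tX tY)))).
  by move=> s t; field.
have c1 := cvg_trigonometric mS mW mG mH cvg_cos cvg_sin (trigonometric_oneB_sqr tX).
have c2 := cvg_trigonometric mS mW mG mH cvg_cos cvg_sin (trigonometric_oneB_sqr tY).
have c3 := cvg_trigonometric mS mW mG mH cvg_cos cvg_sin t3.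
(* For the limit pair the event is exactly the double quadrant, so the error variable is 0. *)
have b0 := @quadrant_approx R d0 T0 P0 G H mG mH iG iH L m (cst 0)
  [set w | G w * H w <= 0] L0 mE0 (integrable_cstT 0) (fun=> lexx 0) _.
have {}b0 := b0 (fun w _ _ => asboolb _).
rewrite /= Rintegral_cstT mul0r addr0 -/g2 -/h2 in b0.
set de := (L / (2 * (3 / 2) ^+ m)) ^+ 2.
have de0 : 0 < de by rewrite exprn_gt0// divr_gt0// mulr_gt0// exprn_gt0.
have cde0 : 0 < c * de by rewrite mulr_gt0.
near=> n.
have n1 : `|\int[P0]_w (1 - periodic_sign L m (G w) ^+ 2) -
    \int[P]_w (1 - periodic_sign L m (S n w) ^+ 2)| <= c.
  by near: n; move/cvgrPdist_le: c1; exact.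
have n2 : `|\int[P0]_w (1 - periodic_sign L m (H w) ^+ 2) -
    \int[P]_w (1 - periodic_sign L m (W n w) ^+ 2)| <= c.
  by near: n; move/cvgrPdist_le: c2; exact.
have n3 : `|\int[P0]_w ((1 - periodic_sign L m (G w) * periodic_sign L m (H w)) / 2) -
    \int[P]_w ((1 - periodic_sign L m (S n w) * periodic_sign L m (W n w)) / 2)| <= c.
  by near: n; move/cvgrPdist_le: c3; exact.
have n4 : `|0 - \int[P]_w r n w| <= c * de.
  by near: n; move/cvgrPdist_le: cr; exact.
have n5 : \int[P]_w (S n w ^+ 2) <= M by near: n.
have n6 : \int[P]_w (W n w ^+ 2) <= M by near: n.
have bn := @quadrant_approx R d T P (S n) (W n) (mS n) (mW n) (iS n) (iW n) L m
  (r n) (E n) L0 (mE n) (ir n) (r0 n).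
have hEn : forall w, r n w < `|S n w * W n w| -> r n w < S n w ^+ 2 ->
  (w \in E n) = (S n w * W n w <= 0) by near: n.
have {}bn := bn hEn.
have n7 : (\int[P]_w r n w) / de <= c.
  rewrite ler_pdivrMr// (le_trans _ n4)// sub0r normrN ler_norm//.
rewrite -/de in bn.
have n8 : (\int[P]_w (S n w ^+ 2) + \int[P]_w (W n w ^+ 2)) / L ^+ 2 <= 2 * `|M| / L ^+ 2.
  rewrite ler_pM2r ?invr_gt0 ?exprn_gt0//.
  by rewrite (le_trans (lerD n5 n6))// mulr_natl mulr2n lerD// ler_norm.
have n9 : 2 * `|M| / L ^+ 2 + 7 * ((g2 + h2) / L ^+ 2) <= e / 4.
  by rewrite -LK mulrA -mulrDl ler_pM2r ?invr_gt0 ?exprn_gt0// /K lerDl.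
rewrite (mulrDl g2) in b0; rewrite (mulrDl g2) in n9.
move: b0 bn hG hH n1 n2 n3; rewrite !ler_norml.
set A := fine (P0 _); set B := fine (P (E n)).
set t := \int[P0]_w (_ / 2); set tn := \int[P]_w (_ / 2).
set x := \int[P0]_w (1 - periodic_sign L m (G w) ^+ 2).
set xn := \int[P]_w (1 - periodic_sign L m (S n w) ^+ 2).
set y := \int[P0]_w (1 - periodic_sign L m (H w) ^+ 2).
set yn := \int[P]_w (1 - periodic_sign L m (W n w) ^+ 2).
have -> : e = 100 * c by rewrite /c; field.
move=> b0 bn hG hH n1 n2 n3.
rewrite (_ : e / 4 = 25 * c) in n9; last by rewrite /c; field.
have g2L : 0 <= g2 / L ^+ 2 by rewrite divr_ge0// sqr_ge0.
have h2L : 0 <= h2 / L ^+ 2 by rewrite divr_ge0// sqr_ge0.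
move: b0 bn n1 n2 n3 => /andP[b1 b2] /andP[b3 b4] /andP[n11 n12] /andP[n21 n22] /andP[n31 n32].
clear LK n4 n5 n6.
by apply/andP; split; lra.
Unshelve. all: by end_near. Qed.

End quadrant_convergence.

(** * The standard normal law and the Cauchy law *)

Section standard_normal.
Context {R : realType}.
Local Notation mu := (@lebesgue_measure R).

Definition std_normal : probability (measurableTypeR R) R := normal_prob 0 1.

Definition std_pdf (x : R) : R := normal_pdf 0 1 x.

Lemma std_pdfE x : std_pdf x = normal_peak 1 * expR (- (x ^+ 2 / 2)).
Proof.
rewrite /std_pdf normal_pdfE ?oner_eq0// /normal_fun subr0 expr1n.
by rewrite mulNr.
Qed.

Lemma std_pdf_ge0 x : 0 <= std_pdf x.
Proof. exact: normal_pdf_ge0. Qed.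

Lemma measurable_std_pdf : measurable_fun [set: R] std_pdf.
Proof. exact: measurable_normal_pdf. Qed.

Lemma continuous_std_pdf : continuous std_pdf.
Proof. by apply: continuous_normal_pdf; rewrite oner_eq0. Qed.

Lemma normal_peak1_sqr : normal_peak 1 ^+ 2 = (2 * pi)^-1 :> R.
Proof.
rewrite /normal_peak exprVn sqr_sqrtr; last first.
  by rewrite mulrn_wge0// mulr_ge0// ?pi_ge0// sqr_ge0.
by rewrite expr1n mul1r -mulr_natl.
Qed.

Lemma std_normal_dominates : std_normal `<< mu.
Proof. exact: normal_prob_dominates. Qed.

Lemma std_normal_set1 (c : R) : std_normal [set c] = 0%E.
Proof.
move/null_content_dominatesP: std_normal_dominates; apply => //.
exact: lebesgue_measure_set1.
Qed.

(** The change of variables holds with the Radon-Nikodym derivative, which agrees almost everywhere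
    with the density because both have the same integral over every measurable set. *)
Lemma ge0_integral_std_normal (f : R -> \bar R) :
  measurable_fun [set: R] f -> (forall x, 0 <= f x)%E ->
  (\int[std_normal]_x f x = \int[mu]_x (f x * (std_pdf x)%:E))%E.
Proof.
move=> mf f0.
have dom := std_normal_dominates.
rewrite -(Radon_Nikodym_SigmaFinite.change_of_variables dom)//.
have mRN := measurable_int _ (Radon_Nikodym_SigmaFinite.f_integrable dom).
apply: ae_eq_integral => //.
- exact: emeasurable_funM.
- apply: emeasurable_funM => //; apply/measurable_EFinP; exact: measurable_std_pdf.
apply: ae_eqe_mul2l; apply: integral_ae_eq => //.
- exact: Radon_Nikodym_SigmaFinite.f_integrable.
- by apply/measurable_EFinP; exact: measurable_std_pdf.
- by move=> E _ mE; rewrite -Radon_Nikodym_SigmaFinite.f_integral.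
Qed.

(** Half of the exponent pays for the polynomial: 1 + x^2 <= 4 exp(x^2 / 4). What remains is a
    Gaussian of variance 2, an integrable majorant for anything of quadratic growth times the
    density. *)
Lemma sqr_std_pdf_le x :
  (1 + x ^+ 2) * std_pdf x <= 4 * normal_peak 1 * normal_fun 0 (Num.sqrt 2) x.
Proof.
rewrite std_pdfE mulrCA.
have -> (p F : R) : 4 * p * F = p * (4 * F) by ring.
rewrite ler_wpM2l ?normal_peak_ge0//.
have e4 : Num.sqrt 2 ^+ 2 *+ 2 = 4 :> R by rewrite sqr_sqrtr// -(mulr_natr 2 2) -natrM.
rewrite /normal_fun subr0 e4 mulNr.
rewrite [x ^+ 2 / 2](_ : _ = x ^+ 2 / 4 + x ^+ 2 / 4); last by field.
rewrite opprD expRD mulrA ler_wpM2r ?expR_ge0//.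
rewrite expRN ler_pdivrMr ?expR_gt0//.
by have := expR_ge1Dx (x ^+ 2 / 4); have := sqr_ge0 x; lra.
Qed.

Lemma integrable_gauss_bound :
  mu.-integrable [set: R]
    (EFin \o (fun x : R => 4 * normal_peak 1 * normal_fun 0 (Num.sqrt 2) x)).
Proof.
have s0 : Num.sqrt 2 != 0 :> R by rewrite gt_eqF// sqrtr_gt0.
have i1 := @integrable_normal_pdf R 0 (Num.sqrt 2).
have p0 := normal_peak_gt0 s0.
rewrite (_ : EFin \o _ =
  (fun x => (4 * normal_peak 1 / normal_peak (Num.sqrt 2))%:E *
    (normal_pdf 0 (Num.sqrt 2) x)%:E))%E.
  exact: integrableZl.
apply/funext => x /=; rewrite -EFinM; congr EFin.
by rewrite normal_pdfE// mulrA mulfVK// gt_eqF.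
Qed.

Lemma integrable_std_pdf_dominated (f : R -> R) (c : R) :
  measurable_fun [set: R] f -> 0 <= c -> (forall x, `|f x| <= c * (1 + x ^+ 2)) ->
  mu.-integrable [set: R] (EFin \o (fun x => f x * std_pdf x)).
Proof.
move=> mf c0 fc.
have ic : mu.-integrable [set: R]
    (EFin \o (fun x => c * (4 * normal_peak 1 * normal_fun 0 (Num.sqrt 2) x))).
  exact: (integrableZl measurableT c integrable_gauss_bound).
apply: (le_integrable measurableT _ _ ic).
  by apply/measurable_EFinP; apply: measurable_funM => //; exact: measurable_std_pdf.
move=> x _ /=; rewrite lee_fin normrM (ger0_norm (std_pdf_ge0 x)).
apply: le_trans (ler_norm _).
rewrite (le_trans (ler_wpM2r (std_pdf_ge0 x) (fc x)))//.
have -> : c * (1 + x ^+ 2) * std_pdf x = c * ((1 + x ^+ 2) * std_pdf x) by rewrite mulrA.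
by apply: ler_wpM2l => //; exact: sqr_std_pdf_le.
Qed.

Lemma integrable_sqr_std_normal :
  std_normal.-integrable [set: R] (EFin \o (fun x : R => x ^+ 2)).
Proof.
apply/integrableP; split.
  by apply/measurable_EFinP; exact: measurable_funX.
rewrite ge0_integral_std_normal//; last first.
  by apply: measurableT_comp => //; apply/measurable_EFinP; exact: measurable_funX.
have : mu.-integrable [set: R] (EFin \o (fun x : R => x ^+ 2 * std_pdf x)).
  apply: (@integrable_std_pdf_dominated _ 1) => //.
  by move=> x; rewrite ger0_norm ?sqr_ge0// mul1r lerDr.
move=> /integrableP[_]; apply: le_lt_trans.
rewrite le_eqVlt; apply/orP; left; apply/eqP; apply: eq_integral => x _ /=.
by rewrite (normrM (x ^+ 2)) (ger0_norm (std_pdf_ge0 x)).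
Qed.

Lemma Rintegral_std_normal (f : R -> R) : measurable_fun [set: R] f ->
  (forall x, `|f x| <= 1) -> \int[std_normal]_x f x = \int[mu]_x (f x * std_pdf x).
Proof.
move=> mf f1.
have if1 : std_normal.-integrable [set: R] (EFin \o f).
  exact: (bounded_integrable 1).
have ifp : mu.-integrable [set: R] (EFin \o (fun x => f x * std_pdf x)).
  apply: (@integrable_std_pdf_dominated _ 1) => // x.
  by rewrite (le_trans (f1 x))// mul1r lerDl sqr_ge0.
have ip : mu.-integrable [set: R] (EFin \o std_pdf).
  exact: integrable_normal_pdf.
have p1 : \int[mu]_x std_pdf x = 1.
  by rewrite /Rintegral integral_normal_pdf.
(* Adding 1 makes the integrand nonnegative, so that [ge0_integral_std_normal] applies; the integral
   of the constant is subtracted afterwards. *)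
have h : \int[std_normal]_x (f x + 1) = \int[mu]_x (f x * std_pdf x + std_pdf x).
  congr fine; rewrite ge0_integral_std_normal.
  - by apply: eq_integral => x _; rewrite -EFinM mulrDl mul1r.
  - by apply/measurable_EFinP; exact: measurable_funD.
  - by move=> x; rewrite lee_fin; have := f1 x; rewrite ler_norml => /andP[]; lra.
move: h; rewrite RintegralD//; last exact: integrable_cstT.
by rewrite Rintegral_cstT RintegralD// p1 => /addIr.
Qed.

End standard_normal.

(** * Characteristic function of the standard normal law *)

Section normal_characteristic_function.
Context {R : realType}.
Local Notation mu := (@lebesgue_measure R).
Implicit Types t c x : R.

Lemma is_derive_std_pdf x : is_derive x (1 : R) std_pdf (- x * std_pdf x).
Proof.
have -> : @std_pdf R = (fun x => normal_peak 1 * expR (- (x ^+ 2 / 2))).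
  by apply/funext => y; rewrite std_pdfE.
by apply: is_derive_eq; rewrite /GRing.scale/=; field.
Qed.

Lemma is_derive_sin_phase t c x :
  is_derive x (1 : R) (fun x => sin (t * x + c)) (t * cos (t * x + c)).
Proof. by apply: is_derive_eq; rewrite /GRing.scale/=; ring. Qed.

Lemma is_derive_cos_phase t c x :
  is_derive t (1 : R) (fun t => cos (t * x + c) * std_pdf x)
    (- x * sin (t * x + c) * std_pdf x).
Proof. by apply: is_derive_eq; rewrite /GRing.scale/=; ring. Qed.

Let primitive t c x : R := - (std_pdf x * sin (t * x + c)).

Let density t c x : R :=
  x * sin (t * x + c) * std_pdf x - t * (cos (t * x + c) * std_pdf x).

(* Integrating this derivative over the line gives the differential equation
   F' = - t F for the Fourier transform F of the density. *)
Lemma is_derive_primitive t c x :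
  is_derive x (1 : R) (primitive t c) (density t c x).
Proof.
have h1 := is_derive_std_pdf x; have h2 := is_derive_sin_phase t c x.
rewrite /primitive; apply: is_derive_eq; rewrite /density /GRing.scale/=; ring.
Qed.

#[local] Existing Instance is_derive_std_pdf.

Lemma continuous_density t c : continuous (density t c).
Proof.
move=> x; apply: differentiable_continuous; apply/derivable1_diffP.
exact: ex_derive.
Qed.

Lemma measurable_trig_phase t c :
  measurable_fun [set: R] (fun x => cos (t * x + c)) /\
  measurable_fun [set: R] (fun x => sin (t * x + c)).
Proof.
split; apply: continuous_measurable_fun => x;
  apply: differentiable_continuous; apply/derivable1_diffP; exact: ex_derive.
Qed.

Lemma integrable_cos_std_pdf t c :
  mu.-integrable [set: R] (EFin \o (fun x => cos (t * x + c) * std_pdf x)).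
Proof.
apply: (@integrable_std_pdf_dominated _ _ 1) => //.
  exact: (measurable_trig_phase t c).1.
by move=> x; rewrite mul1r (le_trans (cos_max _))// lerDl sqr_ge0.
Qed.

Lemma integrable_id_sin_std_pdf t c :
  mu.-integrable [set: R] (EFin \o (fun x => x * sin (t * x + c) * std_pdf x)).
Proof.
apply: (@integrable_std_pdf_dominated _ _ 1) => //.
  by apply: measurable_funM => //; exact: (measurable_trig_phase t c).2.
move=> x; rewrite mul1r normrM.
have h : `|x| <= 1 + x ^+ 2.
  by have := real_normK (num_real x); have := normr_ge0 x; nra.
by rewrite (le_trans _ h)// ler_piMr// sin_max.
Qed.

Lemma integrable_density t c : mu.-integrable [set: R] (EFin \o density t c).
Proof.
have h := integrableZl measurableT t (integrable_cos_std_pdf t c).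
exact: (integrableB measurableT (integrable_id_sin_std_pdf t c) h).
Qed.

Lemma std_pdf_cvg0 : std_pdf n%:R @[n --> \oo] --> (0 : R).
Proof.
apply: (@squeeze_cvgr _ _ _ _ (cst 0) (fun n => 4 * normal_peak 1 * harmonic n)).
- apply: nearW => n; rewrite std_pdf_ge0/= /harmonic ler_pdivlMr ?ltr0n// mulrC.
  have nf1 : normal_fun 0 (Num.sqrt 2) n%:R <= 1 :> R.
    by rewrite -expR0 ler_expR mulNr oppr_le0 divr_ge0 ?sqr_ge0// mulrn_wge0 ?sqr_ge0.
  apply: (@le_trans _ _ ((1 + n%:R ^+ 2) * std_pdf n%:R)).
    rewrite ler_wpM2r ?std_pdf_ge0// -natrX -natr1 addrC lerD2l ler_nat.
    by case: n {nf1} => // n; rewrite -[leqLHS]expn1 leq_pexp2l.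
  rewrite (le_trans (sqr_std_pdf_le _))// ler_piMr//.
  by rewrite mulr_ge0 ?normal_peak_ge0.
- exact: cvg_cst.
- rewrite -[X in _ --> X](mulr0 (4 * normal_peak 1)).
  by apply: cvgM; [exact: cvg_cst|exact: cvg_harmonic].
Qed.

(** On [-n, n] the fundamental theorem of calculus leaves boundary terms of at most twice the
    density at n, which vanish as n grows; dominated convergence identifies the limit with the full
    integral. *)
Lemma Rintegral_density t c : \int[mu]_x density t c x = 0.
Proof.
have c1 : \int[mu]_x (density t c x * \1_`[- n%:R, n%:R] x) @[n --> \oo] -->
    \int[mu]_x density t c x.
  apply: (@dominated_cvg_Rintegral _ _ R mu
    (fun n x => density t c x * \1_`[- n%:R, n%:R] x) (density t c)
    (fun x => `|density t c x|)).
  - move=> n; apply: measurable_funM; last exact: measurable_indic.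
    by apply: continuous_measurable_fun; exact: continuous_density.
  - by apply: continuous_measurable_fun; exact: continuous_density.
  - exact: (integrable_norm (integrable_density t c)).
  - apply: aeW => x; apply: cvg_near_cst; near=> n.
    rewrite indicE mem_set ?mulr1// /= in_itv/= -ler_norml.
    by near: n; exact: nbhs_infty_ger.
  - move=> n x; rewrite normrM ler_piMr// indicE.
    by case: (_ \in _); rewrite ?normr1 ?normr0.
have c2 : \int[mu]_x (density t c x * \1_`[- n%:R, n%:R] x) @[n --> \oo] --> (0 : R).
  apply: (@squeeze_cvgr _ _ _ _ (fun n => - (2 * std_pdf n%:R)) (fun n => 2 * std_pdf n%:R)).
  - near=> n; rewrite -ler_norml.
    have -> : \int[mu]_x (density t c x * \1_`[- n%:R, n%:R] x) =
        primitive t c n%:R - primitive t c (- n%:R).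
      transitivity (\int[mu]_(x in `[(- n%:R), n%:R]) density t c x).
        rewrite [RHS]Rintegral_mkcond; apply: eq_Rintegral => x _.
        by rewrite patchE indicE; case: ifPn => _; rewrite ?mulr1 ?mulr0.
      rewrite /Rintegral.
      rewrite (@continuous_FTC2 _ _ (primitive t c))//.
      - by rewrite ltrNl (@lt_le_trans _ _ 0)// ?oppr_lt0 ltr0n; near: n; exists 1%N.
      - by apply: continuous_subspaceT; exact: continuous_density.
      - split.
        + by move=> x _; have hp := is_derive_primitive t c x; exact: ex_derive.
        + apply: cvg_at_right_filter; apply: differentiable_continuous.
          apply/derivable1_diffP; have hp := is_derive_primitive t c (- n%:R).
          exact: ex_derive.
        + apply: cvg_at_left_filter; apply: differentiable_continuous.
          apply/derivable1_diffP; have hp := is_derive_primitive t c n%:R.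
          exact: ex_derive.
      - move=> x _; rewrite derive1E; have hp := is_derive_primitive t c x.
        exact: derive_val.
    rewrite /primitive opprK mulrN addrC.
    have sN : std_pdf (- n%:R) = std_pdf n%:R :> R by rewrite !std_pdfE sqrrN.
    rewrite sN (le_trans (ler_normB _ _))// !normrM (ger0_norm (std_pdf_ge0 _)).
    have p0 := std_pdf_ge0 (n%:R : R).
    have h y : std_pdf n%:R * `|sin y| <= std_pdf n%:R :> R by rewrite ler_piMr// sin_max.
    by have := h (t * n%:R + c); have := h (- (t * n%:R) + c); lra.
  - rewrite -[X in _ --> X]oppr0; apply: cvgN; rewrite -[X in _ --> X](mulr0 2).
    by apply: cvgM; [exact: cvg_cst|exact: std_pdf_cvg0].
  - rewrite -[X in _ --> X](mulr0 2).
    by apply: cvgM; [exact: cvg_cst|exact: std_pdf_cvg0].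
exact: cvg_unique c1 c2.
Unshelve. all: by end_near. Qed.

(** The integral F satisfies F' = - u F and F 0 = cos c, so F u exp(u^2 / 2) is constant. The phase
    [c] lets one computation serve cosine and sine, the latter through c = - pi / 2. *)
Lemma Rintegral_cos_std_pdf t c :
  \int[mu]_x (cos (t * x + c) * std_pdf x) = expR (- (t ^+ 2 / 2)) * cos c.
Proof.
pose f u x := cos (u * x + c) * std_pdf x.
pose F u := \int[mu]_x f u x.
have d1f u x : partial1of2 f u x = - (x * sin (u * x + c) * std_pdf x).
  rewrite /partial1of2 derive1E; have h := is_derive_cos_phase u c x.
  by rewrite derive_val; ring.
have ibound : mu.-integrable [set: R] (EFin \o (fun x => `|x| * std_pdf x)).
  apply: (@integrable_std_pdf_dominated _ _ 1) => // x.
  rewrite mul1r normr_id.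
  by have := real_normK (num_real x); have := normr_ge0 x; nra.
have F' (u : R) : derivable F u 1 /\ derive1 F u = \int[mu]_x partial1of2 f u x.
  have Iu : `]u - 1, u + 1[%classic u.
    by rewrite /= in_itv/=; apply/andP; split; lra.
  have intf v : `]u - 1, u + 1[%classic v -> mu.-integrable [set: R] (EFin \o f v).
    by move=> _; exact: integrable_cos_std_pdf.
  have derf v x : `]u - 1, u + 1[%classic v -> [set: R] x -> derivable (f ^~ x) v 1.
    by move=> _ _; have h := is_derive_cos_phase v c x; exact: ex_derive.
  have g0 x : 0 <= `|x| * std_pdf x by rewrite mulr_ge0// std_pdf_ge0.
  have ub v x : `]u - 1, u + 1[%classic v -> [set: R] x ->
      `|partial1of2 f v x| <= `|x| * std_pdf x.
    move=> _ _; rewrite d1f normrN normrM (ger0_norm (std_pdf_ge0 _)).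
    by rewrite ler_wpM2r ?std_pdf_ge0// normrM ler_piMr// sin_max.
  split.
    exact: (derivable_under_integral measurableT Iu intf derf g0 ibound ub).
  exact: (differentiation_under_integral measurableT Iu intf derf g0 ibound ub).
have dF u : is_derive u (1 : R) F (- u * F u).
  have [dFu Fu] := F' u.
  apply: DeriveDef => //; rewrite -derive1E Fu.
  rewrite (_ : partial1of2 f u = fun x => - 1 * (x * sin (u * x + c) * std_pdf x)); last first.
    by apply/funext => x; rewrite d1f mulN1r.
  rewrite RintegralZl//; last exact: integrable_id_sin_std_pdf.
  have := Rintegral_density u c; rewrite /density RintegralB//; last 2 first.
    exact: integrable_id_sin_std_pdf.
    exact: (integrableZl measurableT u (integrable_cos_std_pdf u c)).
  rewrite RintegralZl//; last exact: integrable_cos_std_pdf.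
  by move/subr0_eq => ->; rewrite mulN1r mulNr.
have E u : is_derive u (1 : R) (fun u => F u * expR (u ^+ 2 / 2)) 0.
  by have h := dF u; apply: is_derive_eq; rewrite /GRing.scale/=; field.
have := is_derive_0_is_cst t 0 E.
rewrite expr0n/= mul0r expR0 mulr1.
have -> : F 0 = cos c.
  rewrite /F /f; under eq_Rintegral do rewrite mul0r add0r.
  rewrite RintegralZl//; last exact: integrable_normal_pdf.
  by rewrite /Rintegral integral_normal_pdf mulr1.
move=> <-; rewrite -/(F t) mulrC -mulrA -expRD subrr expR0 mulr1//.
Qed.

End normal_characteristic_function.

(** * Two independent standard normal variables *)

Section normal_pair.
Context {R : realType}.
Local Notation mu := (@lebesgue_measure R).
Implicit Types t c x : R.

Local Notation T2 := (measurableTypeR R * measurableTypeR R)%type.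

Definition normal_pair : probability T2 R :=
  (std_normal \x std_normal)%E.

Lemma std_normal_cos t c :
  \int[std_normal]_y cos (t * y + c) = expR (- (t ^+ 2 / 2)) * cos c.
Proof.
rewrite Rintegral_std_normal; last by move=> y; exact: cos_max.
  exact: Rintegral_cos_std_pdf.
exact: (measurable_trig_phase t c).1.
Qed.

Let mfst : measurable_fun [set: T2] (fun z : T2 => z.1).
Proof. exact: measurable_fst. Qed.

Let msnd : measurable_fun [set: T2] (fun z : T2 => z.2).
Proof. exact: measurable_snd. Qed.

Lemma Rintegral_normal_pair_fst (f : R -> R) : measurable_fun [set: R] f ->
  (forall y, `|f y| <= 1) ->
  \int[normal_pair]_z f z.1 = \int[std_normal]_y f y.
Proof.
move=> mf f1.
have mfz : measurable_fun [set: T2] (fun z : T2 => f z.1).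
  exact: measurableT_comp.
have iz : normal_pair.-integrable [set: T2] (EFin \o (fun z : T2 => f z.1)).
  exact: (bounded_integrable 1).
rewrite /Rintegral -(integral12_prod_meas1 iz); congr fine.
apply: eq_integral => y _.
rewrite -[LHS]/(\int[std_normal]_x cst (f y)%:E x)%E.
by rewrite integral_cst// -[RHS]mule1; congr (_ * _)%E; exact: probability_setT.
Qed.

Lemma Rintegral_normal_pair_snd (f : R -> R) : measurable_fun [set: R] f ->
  (forall y, `|f y| <= 1) ->
  \int[normal_pair]_z f z.2 = \int[std_normal]_y f y.
Proof.
move=> mf f1.
have mfz : measurable_fun [set: T2] (fun z : T2 => f z.2).
  exact: measurableT_comp.
have iz : normal_pair.-integrable [set: T2] (EFin \o (fun z : T2 => f z.2)).
  exact: (bounded_integrable 1).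
rewrite /Rintegral -(integral21_prod_meas1 iz); congr fine.
apply: eq_integral => y _.
rewrite -[LHS]/(\int[std_normal]_x cst (f y)%:E x)%E.
by rewrite integral_cst// -[RHS]mule1; congr (_ * _)%E; exact: probability_setT.
Qed.

Lemma independent_normal_pair (f g : R -> R)
  (mf : measurable_fun [set: R] f) (mg : measurable_fun [set: R] g)
  (X Y : {mfun T2 >-> R}) :
  (forall z, X z = f z.1) -> (forall z, Y z = g z.2) ->
  independent_pair normal_pair X Y.
Proof.
move=> hX hY A B mA mB.
have mA' : measurable (f @^-1` A) by rewrite -[X in measurable X]setTI; exact: mf.
have mB' : measurable (g @^-1` B) by rewrite -[X in measurable X]setTI; exact: mg.
have -> : X @^-1` A = (f @^-1` A) `*` setT.
  by apply/seteqP; split => z /=; rewrite hX; [|case].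
have -> : Y @^-1` B = setT `*` (g @^-1` B).
  by apply/seteqP; split => z /=; rewrite hY; [|case].
rewrite -setXI setTI setIT.
rewrite /normal_pair/= !product_measure1E//; congr (_ * _)%E.
  rewrite -[LHS]mule1; congr (_ * _)%E; apply/esym.
  exact: (probability_setT std_normal).
rewrite -[LHS]mul1e; congr (_ * _)%E; apply/esym.
exact: (probability_setT std_normal).
Qed.

Lemma std_normal_sin t : \int[std_normal]_y sin (t * y) = 0.
Proof.
have := std_normal_cos t (- (pi / 2)); rewrite cosN cos_pihalf mulr0 => <-.
by apply: eq_Rintegral => y _; rewrite cosBpihalf.
Qed.

Lemma normal_pair_cos a b c :
  \int[normal_pair]_z cos (a * z.1 + (b * z.2 + c)) =
  expR (- ((a ^+ 2 + b ^+ 2) / 2)) * cos c.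
Proof.
have mX : measurable_fun [set: T2]
    (fun z : T2 => a * z.1) by exact: measurable_funM.
have mY : measurable_fun [set: T2]
    (fun z : T2 => b * z.2 + c).
  by apply: measurable_funD => //; exact: measurable_funM.
have mf : measurable_fun [set: R] (fun y : R => a * y) by exact: measurable_funM.
have mg : measurable_fun [set: R] (fun y : R => b * y + c).
  by apply: measurable_funD => //; exact: measurable_funM.
pose X : {mfun T2 >-> R} := mfun_Sub (mem_set mX).
pose Y : {mfun T2 >-> R} := mfun_Sub (mem_set mY).
have XY : independent_pair normal_pair X Y by exact: (independent_normal_pair mf mg).
have := expectation_cosD XY; rewrite /X /Y/= => ->.
rewrite (Rintegral_normal_pair_fst (f := fun y => cos (a * y))); last 2 first.
- exact: measurableT_comp (@measurable_cos R) mf.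
- by move=> y; exact: cos_max.
rewrite (Rintegral_normal_pair_fst (f := fun y => sin (a * y))); last 2 first.
- exact: measurableT_comp (@measurable_sin R) mf.
- by move=> y; exact: sin_max.
rewrite (Rintegral_normal_pair_snd (f := fun y => cos (b * y + c))); last 2 first.
- exact: measurableT_comp (@measurable_cos R) mg.
- by move=> y; exact: cos_max.
rewrite std_normal_sin mul0r subr0 std_normal_cos.
have -> : \int[std_normal]_y cos (a * y) = expR (- (a ^+ 2 / 2)).
  have := std_normal_cos a 0; rewrite cos0 mulr1 => <-.
  by apply: eq_Rintegral => y _; rewrite addr0.
by rewrite mulrA -expRD mulrDl opprD.
Qed.

Lemma normal_pair_linear_cos x a b :
  \int[normal_pair]_z cos (a * z.1 + b * (z.2 - x * z.1)) =
  expR (- ((a - b * x) ^+ 2 + b ^+ 2) / 2).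
Proof.
rewrite mulNr -[RHS]mulr1 -[X in _ * X](@cos0 R) -normal_pair_cos.
by apply: eq_Rintegral => z _; congr cos; ring.
Qed.

Lemma normal_pair_linear_sin x a b :
  \int[normal_pair]_z sin (a * z.1 + b * (z.2 - x * z.1)) = 0.
Proof.
have := normal_pair_cos (a - b * x) b (- (pi / 2)).
rewrite cosN cos_pihalf mulr0 => <-; apply: eq_Rintegral => z _.
by rewrite -cosBpihalf; congr cos; ring.
Qed.

Lemma integrable_normal_pair_fst_sqr :
  normal_pair.-integrable [set: T2] (EFin \o (fun z : T2 => z.1 ^+ 2)).
Proof.
apply/integrable12ltyP.
  by apply/measurable_EFinP; apply: measurable_funX.
have /integrableP[_] := @integrable_sqr_std_normal R; apply: le_lt_trans.
rewrite le_eqVlt; apply/orP; left; apply/eqP; apply: eq_integral => y _ /=.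
rewrite -[LHS]/(\int[std_normal]_x cst `|y ^+ 2|%:E x)%E.
by rewrite integral_cst// -[RHS]mule1; congr (_ * _)%E; exact: probability_setT.
Qed.

Lemma integrable_normal_pair_linear_sqr x :
  normal_pair.-integrable [set: T2]
    (EFin \o (fun z : T2 => (z.2 - x * z.1) ^+ 2)).
Proof.
have isnd : normal_pair.-integrable [set: T2] (EFin \o (fun z : T2 => z.2 ^+ 2)).
  apply/integrable21ltyP.
    by apply/measurable_EFinP; apply: measurable_funX.
  have /integrableP[_] := @integrable_sqr_std_normal R; apply: le_lt_trans.
  rewrite le_eqVlt; apply/orP; left; apply/eqP; apply: eq_integral => y _ /=.
  rewrite -[LHS]/(\int[std_normal]_x cst `|y ^+ 2|%:E x)%E.
  by rewrite integral_cst// -[RHS]mule1; congr (_ * _)%E; exact: probability_setT.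
apply: (dominated_integrable_real _ (integrable_addT (integrable_scaleT 2 isnd)
  (integrable_scaleT (2 * x ^+ 2) integrable_normal_pair_fst_sqr))).
  by apply: measurable_funX; apply: measurable_funB => //; exact: measurable_funM.
move=> z /=; rewrite ger0_norm ?sqr_ge0//.
by have := sqr_ge0 (z.2 + x * z.1); nra.
Qed.

Lemma normal_pair_fst_eq0 : normal_pair [set z | z.1 = 0] = 0%E.
Proof.
have -> : [set z : T2 | z.1 = 0] = [set 0] `*` setT.
  by apply/seteqP; split => -[u v] //= [].
rewrite /normal_pair/= product_measure1E//.
rewrite -[RHS](mul0e (std_normal [set: R])); congr (_ * _)%E.
exact: std_normal_set1.
Qed.

Lemma normal_pair_linear_eq0 x : normal_pair [set z | z.2 - x * z.1 = 0] = 0%E.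
Proof.
rewrite /normal_pair /= /product_measure1 integral0_eq// => y _ /=.
rewrite (_ : xsection _ y = [set x * y]); first exact: std_normal_set1.
apply/seteqP; split => v /=; rewrite /xsection/= inE/=.
  by move/subr0_eq.
by move=> ->; rewrite subrr.
Qed.

End normal_pair.

(** * The Cauchy law as the law of a normal ratio *)

Section cauchy_ratio.
Context {R : realType}.
Local Notation mu := (@lebesgue_measure R).
Local Notation T2 := (measurableTypeR R * measurableTypeR R)%type.
Implicit Types x y a c g : R.

Lemma std_pdfN x : std_pdf (- x) = std_pdf x.
Proof. by rewrite !std_pdfE sqrrN. Qed.

Lemma std_normal_ray_reflect c :
  std_normal `[c, +oo[%classic = std_normal `]-oo, (- c)]%classic.
Proof.
rewrite /std_normal /= /normal_prob.
rewrite ge0_integration_by_substitutionNy.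
- by apply: eq_integral => x _ /=; rewrite -!/(std_pdf _) std_pdfN.
- by apply: continuous_subspaceT; exact: continuous_std_pdf.
- by move=> x _; exact: std_pdf_ge0.
Qed.

Lemma std_normal_ray_scale x a : 0 < a ->
  std_normal `]-oo, (a * x)]%classic =
  (\int[mu]_(y in `]-oo, x]) (a * std_pdf (a * y))%:E)%E.
Proof.
move=> a0; rewrite /std_normal /= /normal_prob.
have dF y : is_derive y (1 : R) (fun y : R => a * y) a.
  by apply: is_derive_eq; rewrite /GRing.scale/=; ring.
have F' : derive1 (fun y : R => a * y) = cst a.
  by apply/funext => y; rewrite derive1E; have h := dF y; exact: derive_val.
rewrite (@increasing_ge0_integration_by_substitutionNy _ (fun y : R => a * y)).
- by apply: eq_integral => y _; rewrite F' /= mulrC.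
- by move=> u v _ _ uv; rewrite ltr_pM2l.
- by rewrite F' => y _; exact: cst_continuous.
- by rewrite F'; exact: is_cvg_cst.
- by rewrite F'; exact: cvg_cst.
- split; first by move=> y _; have h := dF y; exact: ex_derive.
  apply: cvg_at_left_filter; apply: differentiable_continuous.
  by apply/derivable1_diffP; have h := dF x; exact: ex_derive.
- by apply: gt0_cvgMrNy => //; exact: cvg_id.
- by apply: continuous_subspaceT; exact: continuous_std_pdf.
- by move=> y _; exact: std_pdf_ge0.
Qed.

(** The substitution v = g y turns the condition into y <= x whatever the sign of g, with Jacobian
    |g|. For negative g the section is an upper ray, which is first reflected. *)
Lemma std_normal_wedge_section x g : g != 0 ->
  std_normal [set v | g * (v - x * g) <= 0] =
  (\int[mu]_(y in `]-oo, x]) (`|g| * std_pdf (g * y))%:E)%E.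
Proof.
move=> g0; have [gp|gn|/esym/eqP] := ltgtP 0 g; last by rewrite (negbTE g0).
  rewrite gtr0_norm// -std_normal_ray_scale//; congr (std_normal _).
  by apply/seteqP; split => v /=; rewrite in_itv/= pmulr_rle0// subr_le0 mulrC.
rewrite ltr0_norm//.
transitivity (std_normal `]-oo, ((- g) * x)]%classic).
  rewrite mulNr -std_normal_ray_reflect; congr (std_normal _).
  by apply/seteqP; split => v /=; rewrite in_itv/= andbT nmulr_rle0// subr_ge0 mulrC.
rewrite (@std_normal_ray_scale x (- g)); last by rewrite oppr_gt0.
apply: eq_integral => y _.
by rewrite (mulNr g y) std_pdfN.
Qed.

Lemma integral_gauss_half c : 0 < c ->
  (\int[mu]_(g in `[0%R, +oo[) (g * expR (- (c * g ^+ 2)))%:E = ((2 * c)^-1)%:E)%E.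
Proof.
move=> c0.
pose F g := - ((2 * c)^-1 * expR (- (c * g ^+ 2))).
have dF g : is_derive g (1 : R) F (g * expR (- (c * g ^+ 2))).
  by rewrite /F; apply: is_derive_eq; rewrite /GRing.scale/=; field; rewrite gt_eqF.
have cf : continuous (fun g : R => g * expR (- (c * g ^+ 2))).
  by move=> g; apply: differentiable_continuous; apply/derivable1_diffP; exact: ex_derive.
rewrite (@ge0_continuous_FTC2y R _ F 0 0).
- by rewrite -EFinB sub0r /F expr0n/= mulr0 oppr0 expR0 mulr1 opprK.
- by move=> g g0; rewrite mulr_ge0// expR_ge0.
- exact: continuous_subspaceT.
- rewrite /F -[X in _ --> X]oppr0; apply: cvgN; rewrite -[X in _ --> X](mulr0 (2 * c)^-1).
  apply: cvgM; first exact: cvg_cst.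
  apply: (cvg_comp (fun g => c * g ^+ 2) (fun z => expR (- z))); last exact: cvgr_expR.
  by apply: gt0_cvgMry => //; exact: cvgr_expr2.
- by move=> g _; have h := dF g; exact: ex_derive.
- apply: cvg_at_right_filter; apply: differentiable_continuous.
  by apply/derivable1_diffP; have h := dF 0; exact: ex_derive.
- by move=> g _; rewrite derive1E; have h := dF g; exact: derive_val.
Qed.

(** The left side is the density at y of the ratio of two independent standard normal variables. The
    two densities multiply to exp(- (1 + y^2) g^2 / 2) / (2 pi), and evenness reduces the integral
    to [integral_gauss_half]. *)
Lemma integral_abs_std_pdf y :
  (\int[mu]_g (`|g| * std_pdf (g * y) * std_pdf g)%:E = ((pi * (1 + y ^+ 2))^-1)%:E)%E.
Proof.
pose c := (1 + y ^+ 2) / 2.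
have c0 : 0 < c by rewrite divr_gt0// ltr_wpDr// sqr_ge0.
have E g : `|g| * std_pdf (g * y) * std_pdf g =
    (2 * pi)^-1 * (`|g| * expR (- (c * g ^+ 2))).
  rewrite !std_pdfE -normal_peak1_sqr /c.
  have -> : - ((1 + y ^+ 2) / 2 * g ^+ 2) = - ((g * y) ^+ 2 / 2) + - (g ^+ 2 / 2) by field.
  by rewrite expRD; ring.
have cexp : continuous (fun g : R => expR (- (c * g ^+ 2))).
  by move=> g; apply: differentiable_continuous; apply/derivable1_diffP; exact: ex_derive.
under eq_integral do rewrite E.
rewrite ge0_symfun_integralT.
- rewrite (_ : [set x : R | 0 <= x] = `[0, +oo[%classic); last first.
    by apply/seteqP; split => g /=; rewrite in_itv/= andbT.
  rewrite (eq_integral (fun g : measurableTypeR R =>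
      ((2 * pi)^-1)%:E * ((g : R) * expR (- (c * (g : R) ^+ 2)))%:E)%E); last first.
    by move=> g; rewrite inE/= in_itv/= andbT => g0; rewrite ger0_norm// EFinM.
  rewrite ge0_integralZl//.
  + rewrite integral_gauss_half// -!EFinM; congr EFin; rewrite /c.
    have q0 : 1 + y ^+ 2 != 0 by rewrite gt_eqF// ltr_wpDr// sqr_ge0.
    by move: (@pi R) (@pi_gt0 R) => p p0; field; rewrite q0 gt_eqF.
  + apply/measurable_funTS/measurable_EFinP; apply: measurable_funM => //.
    by apply: continuous_measurable_fun; exact: cexp.
  + by move=> g; rewrite /= in_itv/= andbT => g0; rewrite lee_fin mulr_ge0// expR_ge0.
  + by rewrite lee_fin invr_ge0 mulr_ge0// pi_ge0.
- by move=> g; rewrite mulr_ge0 ?invr_ge0 ?mulr_ge0 ?pi_ge0// expR_ge0.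
- move=> g; apply: cvgM; first exact: cvg_cst.
  by apply: cvgM; [exact: norm_continuous|exact: cexp].
- by move=> g /=; rewrite normrN sqrrN.
Qed.

(** Sections at fixed g become integrals over the ray up to x, and Tonelli exchanges the integrals,
    so that the inner one over g is the Cauchy density. *)
Lemma normal_pair_wedge x :
  normal_pair [set z | z.1 * (z.2 - x * z.1) <= 0] =
  (\int[mu]_(y in `]-oo, x]) ((pi * (1 + y ^+ 2))^-1)%:E)%E.
Proof.
pose h (z : T2) : R :=
  (`|z.1| * std_pdf (z.1 * z.2) * std_pdf z.1) * \1_`]-oo, x] z.2.
have h0 z : 0 <= h z by rewrite /h !mulr_ge0 ?std_pdf_ge0.
have mh : measurable_fun [set: T2] (EFin \o h).
  apply/measurable_EFinP; rewrite /h.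
  apply: measurable_funM; last by apply: measurableT_comp => //; exact: measurable_indic.
  apply: measurable_funM.
    apply: measurable_funM; first by apply: measurableT_comp => //.
    apply: measurableT_comp; first exact: measurable_std_pdf.
    by apply: measurable_funM.
  by apply: measurableT_comp => //; exact: measurable_std_pdf.
have mW : measurable [set z : T2 | z.1 * (z.2 - x * z.1) <= 0].
  rewrite [X in measurable X](_ : _ =
      (fun z : T2 => z.1 * (z.2 - x * z.1)) @^-1` `]-oo, 0]).
    rewrite -[X in measurable X]setTI.
    have mw : measurable_fun [set: T2] (fun z : T2 => z.1 * (z.2 - x * z.1)).
      by apply: measurable_funM => //; apply: measurable_funB => //; exact: measurable_funM.
    exact (mw measurableT _ (measurable_itv _)).
  by apply/seteqP; split => z /=; rewrite in_itv.
have mxs := measurable_fun_xsection std_normal mW.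
rewrite /normal_pair /= /product_measure1.
transitivity (\int[mu]_g \int[mu]_y (h (g, y))%:E)%E.
  rewrite (ge0_integral_std_normal mxs)//.
  apply: ae_eq_integral => //.
  - apply: emeasurable_funM => //; apply/measurable_EFinP; exact: measurable_std_pdf.
  - exact: (measurable_fun_fubini_tonelli_F _ mh).
  (* At g = 0 the section is the whole line and the formula fails, but this single point is null. *)
  - exists [set 0]; split => //; first exact: lebesgue_measure_set1.
    move=> g /= hg; apply: contrapT => /eqP g0; apply: hg => _.
    have -> : xsection [set z : T2 | z.1 * (z.2 - x * z.1) <= 0] g =
        [set v | g * (v - x * g) <= 0].
      by apply/seteqP; split => v /=; rewrite /xsection/= inE.
    rewrite std_normal_wedge_section// -ge0_integralZr//; last 3 first.
    + apply/measurable_funTS/measurable_EFinP; apply: measurable_funM => //.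
      by apply: measurableT_comp; [exact: measurable_std_pdf|exact: measurable_funM].
    + by move=> y _; rewrite lee_fin mulr_ge0// std_pdf_ge0.
    + by rewrite lee_fin std_pdf_ge0.
    rewrite [LHS]integral_mkcond; apply: eq_integral => y _.
    by rewrite patchE /h indicE/=; case: ifPn => _; rewrite ?mulr1 ?mulr0.
rewrite (fubini_tonelli _ mh)//.
transitivity (\int[mu]_y ((pi * (1 + y ^+ 2))^-1 * \1_`]-oo, x] y)%:E)%E.
  apply: eq_integral => y _; rewrite EFinM -integral_abs_std_pdf.
  rewrite -ge0_integralZr//.
  - apply/measurable_EFinP; apply: measurable_funM; last exact: measurable_std_pdf.
    apply: measurable_funM => //.
    by apply: measurableT_comp; [exact: measurable_std_pdf|exact: measurable_funM].
  - by move=> g _; rewrite lee_fin !mulr_ge0 ?std_pdf_ge0.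
rewrite [RHS]integral_mkcond; apply: eq_integral => y _.
by rewrite patchE indicE; case: ifPn => _; rewrite ?mulr1 ?mulr0.
Qed.

End cauchy_ratio.

(** * The autoregressive process *)

Section two_root_recursion.
Context {T : Type} {R : realType}.
Variables (V : nat -> T -> R) (w : T).
Implicit Types (a b : R) (k n : nat).

Lemma noiseS a k : noise a V k.+1 w = a * noise a V k w + V k w.
Proof. by []. Qed.

Lemma processS a b k :
  process a b V k.+1 w = a * process a b V k w + noise b V k.+1 w.
Proof. by []. Qed.

Lemma process_noise a b k : (a - b) * process a b V k w =
  a * noise a V k w - b * noise b V k w.
Proof.
elim: k => [|k IH]; first by rewrite /process /noise /= !mulr0 subrr.
rewrite processS !noiseS mulrDr mulrCA IH; ring.
Qed.

Lemma processC a b k : a != b -> process a b V k w = process b a V k w.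
Proof.
move=> ab; apply: (mulfI (x := a - b)); first by rewrite subr_eq0.
by rewrite process_noise -(opprB b a) mulNr process_noise opprB.
Qed.

Lemma noiseE a n : a != 0 ->
  noise a V n w = a ^+ n * \sum_(i < n) a ^- i.+1 * V i w.
Proof.
move=> a0; elim: n => [|n IH]; first by rewrite big_ord0 mulr0.
rewrite noiseS IH big_ord_recr/= mulrDr !mulrA -exprS divff ?mul1r//.
by rewrite expf_neq0.
Qed.

(* Hence the cross sum is only of order A_n B_n when a b - 1 stays away from 0. *)
Lemma noise_cross_energy a b n : noise a V n w * noise b V n w =
  (a * b - 1) * \sum_(k < n) noise a V k w * noise b V k w +
  a * \sum_(k < n) noise a V k w * V k w +
  b * \sum_(k < n) noise b V k w * V k w + \sum_(k < n) V k w ^+ 2.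
Proof.
elim: n => [|n IH]; first by rewrite !big_ord0 /noise/=; ring.
rewrite !big_ord_recr/= !noiseS.
transitivity (noise a V n w * noise b V n w +
  (a * b - 1) * (noise a V n w * noise b V n w) +
  a * (noise a V n w * V n w) + b * (noise b V n w * V n w) + V n w ^+ 2).
  by ring.
rewrite {1}IH; ring.
Qed.

(** A deliberately crude pathwise bound for all noise terms: the errors are divided by exponentially
    large quantities, so lost powers of n do no harm. *)
Definition mass n : R := \sum_(i < n) `|V i w|.

Lemma mass_ge0 n : 0 <= mass n.
Proof. exact: sumr_ge0. Qed.

(** Cauchy-Schwarz by induction: the mixed term is controlled by (Q - m z)^2 >= 0 and the induction
    hypothesis, after multiplication by m, whence the separate case m = 0. It replaces the squared
    mass by a variable with a known mean. *)
Lemma mass_sqr n : mass n ^+ 2 <= n%:R * \sum_(i < n) V i w ^+ 2.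
Proof.
rewrite /mass; elim: n => [|n IH]; first by rewrite !big_ord0 expr0n mulr0.
rewrite !big_ord_recr/=; set Q := \sum_(_ < _) `|_| in IH *.
set S := \sum_(_ < _) _ ^+ 2 in IH *.
have Q0 : 0 <= Q by exact: sumr_ge0.
have S0 : 0 <= S by apply: sumr_ge0 => i _; exact: sqr_ge0.
have vz : V n w ^+ 2 = `|V n w| ^+ 2 by rewrite real_normK// num_real.
rewrite vz; set z := `|V n w|; have z0 : 0 <= z by exact: normr_ge0.
rewrite -natr1; move: IH; set m : R := n%:R => IH.
case: n @m @Q @S IH Q0 S0 {vz} z z0 => [|n] m Q S IH Q0 S0 z z0.
  have -> : Q = 0 by rewrite /Q big_ord0.
  have -> : m = 0 by [].
  by rewrite !add0r mul1r; lra.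
have m0 : 0 < m by rewrite /m ltr0n.
have h : 0 <= (Q - m * z) ^+ 2 by exact: sqr_ge0.
suff : 2 * Q * z <= S + m * z ^+ 2 by nra.
rewrite -(ler_pM2l m0); nra.
Qed.

Lemma normr_noise_le a k n : 1 <= `|a| -> (k <= n)%N ->
  `|noise a V k w| <= `|a| ^+ n * mass n.
Proof.
move=> a1 kn.
have h : `|noise a V k w| <= `|a| ^+ k * mass k.
  elim: k {kn} => [|k IH]; first by rewrite /mass big_ord0 mulr0 normr0.
  rewrite noiseS (le_trans (ler_normD _ _))// normrM /mass big_ord_recr/= mulrDr.
  rewrite lerD//; first by rewrite exprS -mulrA ler_wpM2l.
  by rewrite ler_peMl// exprn_ege1.
apply: (le_trans h); apply: ler_pM => //.
- exact: mass_ge0.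
- exact: ler_weXn2l.
- rewrite /mass -!(big_mkord xpredT (fun i => `|V i w|)) [leRHS](big_cat_nat (n := k))//=.
  by rewrite lerDl sumr_ge0.
Qed.

Lemma normr_sum_mass (f : nat -> R) (c : R) n : 0 <= c ->
  (forall k, (k < n)%N -> `|f k| <= c) ->
  `|\sum_(k < n) f k * V k w| <= c * mass n.
Proof.
move=> c0 fc; rewrite (le_trans (ler_norm_sum _ _ _))// /mass mulr_sumr.
by apply: ler_sum => i _; rewrite normrM ler_wpM2r// fc.
Qed.

Lemma normr_sum_sqr n : `|\sum_(k < n) V k w ^+ 2| <= mass n ^+ 2.
Proof.
rewrite ger0_norm; last by apply: sumr_ge0 => i _; exact: sqr_ge0.
rewrite [leRHS]expr2 {2}/mass mulr_sumr; apply: ler_sum => i _.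
rewrite -(real_normK (num_real (V i w))) expr2 ler_wpM2r//.
by rewrite /mass (bigD1 i)//= lerDl sumr_ge0.
Qed.

End two_root_recursion.

(** * Numerator and denominator of the estimation error *)

Section normalised_sums.
Context {T : Type} {R : realType}.
Variables (V : nat -> T -> R) (w : T) (a b : R) (n : nat).
Hypotheses (b1 : 1 < `|b|) (ba : `|b| < `|a|) (a2 : `|a| <= 2) (ab0 : a * b < 0).
Local Notation A k := (noise a V k w).
Local Notation B k := (noise b V k w).
Local Notation X k := (process a b V k w).
Local Notation v k := (V k w).
Local Notation Q := (mass V w n).
Local Notation ra := (`|a| ^+ n).
Local Notation rb := (`|b| ^+ n).

Let a1 : 1 < `|a|. Proof. exact: lt_trans ba. Qed.
Let b2 : `|b| <= 2. Proof. exact: le_trans (ltW ba) a2. Qed.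
Let Q0 : 0 <= Q. Proof. exact: mass_ge0. Qed.
Let ra1 : 1 <= ra. Proof. by rewrite exprn_ege1// ltW. Qed.
Let rb1 : 1 <= rb. Proof. by rewrite exprn_ege1// ltW. Qed.
Let rba : rb <= ra. Proof. by rewrite lerXn2r ?nnegrE// ltW. Qed.

Let SAv : `|\sum_(k < n) A k * v k| <= ra * Q * Q.
Proof.
apply: (@normr_sum_mass T R V w (fun k => A k) _ n); first by rewrite mulr_ge0 ?exprn_ge0.
by move=> k kn; apply: normr_noise_le; [exact: ltW|exact: ltnW].
Qed.

Let SBv : `|\sum_(k < n) B k * v k| <= rb * Q * Q.
Proof.
apply: (@normr_sum_mass T R V w (fun k => B k) _ n); first by rewrite mulr_ge0 ?exprn_ge0.
by move=> k kn; apply: normr_noise_le; [exact: ltW|exact: ltnW].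
Qed.

Let Svv : `|\sum_(k < n) v k ^+ 2| <= Q ^+ 2.
Proof. exact: normr_sum_sqr. Qed.

Let SBB : `|\sum_(k < n) B k * B k| <= n%:R * (rb * Q) ^+ 2.
Proof.
rewrite (le_trans (ler_norm_sum _ _ _))//.
rewrite -[Z in Z%:R * _](card_ord n) -sum1_card natr_sum mulr_suml.
apply: ler_sum => k _; rewrite mul1r normrM expr2.
have h : `|B k| <= rb * Q by apply: normr_noise_le; [exact: ltW|exact: ltnW].
by apply: ler_pM.
Qed.

Let An : `|A n| <= ra * Q. Proof. by apply: normr_noise_le => //; exact: ltW. Qed.
Let Bn : `|B n| <= rb * Q. Proof. by apply: normr_noise_le => //; exact: ltW. Qed.

Let ab1 : 1 <= `|a * b - 1|.
Proof. by move: ab0; set p := a * b => p0; rewrite ltr0_norm; lra. Qed.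

Let ab_ratio : `|a * b / (a * b - 1)| <= 1.
Proof.
rewrite (normrM (a * b)) normfV ler_pdivrMr ?(lt_le_trans ltr01)// mul1r.
by move: ab0; set p := a * b => p0; rewrite !ltr0_norm; lra.
Qed.

Let triangle4 (x y z t : R) : `|x + y + z + t| <= `|x| + `|y| + `|z| + `|t|.
Proof.
rewrite (le_trans (ler_normD _ _))// lerD2r (le_trans (ler_normD _ _))//.
by rewrite lerD2r ler_normD.
Qed.

Let cross_error : `|a * \sum_(k < n) A k * v k + b * \sum_(k < n) B k * v k +
  \sum_(k < n) v k ^+ 2| <= 5 * ra * Q ^+ 2.
Proof.
rewrite (le_trans (ler_normD _ _))//.
rewrite (le_trans (lerD (ler_normD _ _) (lexx _)))// !normrM.
have h1 : `|a| * `|\sum_(k < n) A k * v k| <= 2 * (ra * Q * Q) by exact: ler_pM.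
have h2 : `|b| * `|\sum_(k < n) B k * v k| <= 2 * (rb * Q * Q) by exact: ler_pM.
have h3 : rb * Q ^+ 2 <= ra * Q ^+ 2 by rewrite ler_wpM2r ?sqr_ge0.
have h4 : 1 * Q ^+ 2 <= ra * Q ^+ 2 by rewrite ler_wpM2r ?sqr_ge0.
by move: Svv; rewrite expr2 in h3 h4 *; lra.
Qed.

(** Expanding (a - b) X_k B_(k+1) leaves the sum of A_k B_k, which [noise_cross_energy] trades for
    A_n B_n; as a b < 0, the factor a b / (a b - 1) has modulus at most 1. The 9 is 5 from the error
    of this trade plus 2 + 2 from the sums against the noise, and 4 bounds b^2. *)
Lemma numerator_bound :
  `|(a - b) * \sum_(k < n) X k * B k.+1 - a * b / (a * b - 1) * (A n * B n)| <=
  (9 * ra + 4 * n%:R * rb ^+ 2) * Q ^+ 2.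
Proof.
have E : (a - b) * \sum_(k < n) X k * B k.+1 =
    a * b * \sum_(k < n) A k * B k - b ^+ 2 * \sum_(k < n) B k * B k +
    a * \sum_(k < n) A k * v k - b * \sum_(k < n) B k * v k.
  rewrite !mulr_sumr -!sumrB -big_split/= -sumrB; apply: eq_bigr => k _.
  by rewrite mulrA process_noise noiseS; ring.
set SAB := \sum_(k < n) A k * B k in E.
set er := a * \sum_(k < n) A k * v k + b * \sum_(k < n) B k * v k +
  \sum_(k < n) v k ^+ 2.
have AB : A n * B n = (a * b - 1) * SAB + er.
  by rewrite noise_cross_energy /er /SAB; ring.
have ab1' : a * b - 1 != 0 by rewrite lt_eqF//; have := ab0; lra.
have -> : (a - b) * \sum_(k < n) X k * B k.+1 - a * b / (a * b - 1) * (A n * B n) =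
    - (a * b / (a * b - 1) * er) + (- (b ^+ 2 * \sum_(k < n) B k * B k)) +
    a * \sum_(k < n) A k * v k + (- (b * \sum_(k < n) B k * v k)).
  by rewrite E AB; field.
rewrite (le_trans (triangle4 _ _ _ _))// !normrN !normrM.
have h0 : `|a * b / (a * b - 1)| * `|er| <= 1 * (5 * ra * Q ^+ 2).
  by apply: ler_pM => //; exact: cross_error.
rewrite !normrM in h0.
have h1 : `|a| * `|\sum_(k < n) A k * v k| <= 2 * (ra * Q * Q) by exact: ler_pM.
have h2 : `|b| * `|\sum_(k < n) B k * v k| <= 2 * (rb * Q * Q) by exact: ler_pM.
have h3 : rb * Q ^+ 2 <= ra * Q ^+ 2 by rewrite ler_wpM2r ?sqr_ge0.
have bb : `|b| * `|b| <= 2 ^+ 2 by rewrite expr2; exact: ler_pM.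
have h4 : `|b| * `|b| * `|\sum_(k < n) B k * B k| <= 2 ^+ 2 * (n%:R * (rb * Q) ^+ 2).
  by apply: ler_pM.
have h5 : 2 ^+ 2 * (n%:R * (rb * Q) ^+ 2) = 4 * n%:R * rb ^+ 2 * Q ^+ 2 by ring.
rewrite h5 in h4; rewrite mulrDl.
have h6 : ra * Q * Q = ra * Q ^+ 2 by ring.
have h7 : rb * Q * Q = rb * Q ^+ 2 by ring.
rewrite h6 in h1; rewrite h7 in h2; lra.
Qed.

(** [noise_cross_energy] is used twice, for a with itself and for a with b. The first use divides an
    error of size 5 by a^2 - 1, which tends to 0, and multiplies by a^2 <= 4. The second bounds the
    cross sum by 6 ra rb, and 48 = 2 * 4 * 6. *)
Lemma denominator_bound :
  `|(a - b) ^+ 2 * \sum_(k < n) X k ^+ 2 - a ^+ 2 / (a ^+ 2 - 1) * A n ^+ 2| <=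
  (20 * ra / (a ^+ 2 - 1) + 48 * (ra * rb) + 4 * n%:R * rb ^+ 2) * Q ^+ 2.
Proof.
have E : (a - b) ^+ 2 * \sum_(k < n) X k ^+ 2 =
    a ^+ 2 * \sum_(k < n) A k * A k - 2 * (a * b) * \sum_(k < n) A k * B k +
    b ^+ 2 * \sum_(k < n) B k * B k.
  rewrite !mulr_sumr -!sumrB -big_split/=; apply: eq_bigr => k _.
  by rewrite -exprMn process_noise; ring.
set SAB := \sum_(k < n) A k * B k in E.
set er := a * \sum_(k < n) A k * v k + b * \sum_(k < n) B k * v k +
  \sum_(k < n) v k ^+ 2.
have AB : A n * B n = (a * b - 1) * SAB + er.
  by rewrite noise_cross_energy /er /SAB; ring.
set er' := 2 * a * \sum_(k < n) A k * v k + \sum_(k < n) v k ^+ 2.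
have AA : A n * A n = (a ^+ 2 - 1) * \sum_(k < n) A k * A k + er'.
  by rewrite noise_cross_energy /er'; ring.
have a21 : 0 < a ^+ 2 - 1.
  by rewrite subr_gt0 -(real_normK (num_real a)) exprn_egt1.
have a21' : a ^+ 2 - 1 != 0 by rewrite gt_eqF.
have -> : (a - b) ^+ 2 * \sum_(k < n) X k ^+ 2 - a ^+ 2 / (a ^+ 2 - 1) * A n ^+ 2 =
    - (a ^+ 2 * (er' / (a ^+ 2 - 1))) + 2 * - (a * b * SAB) +
    b ^+ 2 * \sum_(k < n) B k * B k + 0.
  by rewrite E (expr2 (A n)) AA; field.
rewrite (le_trans (triangle4 _ _ _ _))// normr0 addr0 normrN.
have aa : `|a ^+ 2| <= 4.
  have -> : 4 = 2 ^+ 2 :> R by ring.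
  by rewrite normrX lerXn2r ?nnegrE.
have h6 : ra * Q * Q = ra * Q ^+ 2 by ring.
have h4 : 1 * Q ^+ 2 <= ra * Q ^+ 2 by rewrite ler_wpM2r ?sqr_ge0.
have her' : `|er'| <= 5 * ra * Q ^+ 2.
  rewrite (le_trans (ler_normD _ _))// !normrM (@ger0_norm _ 2)//.
  have h1 : `|a| * `|\sum_(k < n) A k * v k| <= 2 * (ra * Q * Q) by exact: ler_pM.
  by rewrite h6 in h1; move: Svv; lra.
have t1 : `|a ^+ 2 * (er' / (a ^+ 2 - 1))| <= 20 * ra / (a ^+ 2 - 1) * Q ^+ 2.
  rewrite normrM (normrM er') normfV (gtr0_norm a21).
  have -> : 20 * ra / (a ^+ 2 - 1) * Q ^+ 2 = 4 * (5 * ra * Q ^+ 2 / (a ^+ 2 - 1)).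
    by field.
  by apply: ler_pM => //; rewrite ?ler_wpM2r ?divr_ge0 ?invr_ge0 ?(ltW a21).
have hSAB : `|SAB| <= 6 * (ra * rb) * Q ^+ 2.
  have e1 : (a * b - 1) * SAB = A n * B n - er by rewrite AB addrK.
  have h1 : `|A n| * `|B n| <= ra * Q * (rb * Q) by exact: ler_pM.
  have h2 : `|(a * b - 1) * SAB| <= ra * Q * (rb * Q) + 5 * ra * Q ^+ 2.
    by rewrite e1 (le_trans (ler_normB _ _))// normrM lerD.
  have h3 : 1 * `|SAB| <= `|(a * b - 1) * SAB| by rewrite normrM ler_wpM2r.
  have h5 : ra * Q ^+ 2 * 1 <= ra * Q ^+ 2 * rb.
    by rewrite ler_wpM2l// mulr_ge0 ?sqr_ge0// (le_trans _ ra1).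
  have h7 : ra * Q * (rb * Q) = ra * Q ^+ 2 * rb by ring.
  by lra.
have t2 : `|2 * - (a * b * SAB)| <= 48 * (ra * rb) * Q ^+ 2.
  rewrite normrM normrN normrM (@ger0_norm _ 2)// normrM.
  have h1 : `|a| * `|b| <= 2 * 2 by exact: ler_pM.
  have h2 : `|a| * `|b| * `|SAB| <= 2 * 2 * (6 * (ra * rb) * Q ^+ 2) by apply: ler_pM.
  by lra.
have bb : `|b ^+ 2| <= 2 ^+ 2 by rewrite normrX lerXn2r ?nnegrE.
have t3 : `|b ^+ 2 * \sum_(k < n) B k * B k| <= 2 ^+ 2 * (n%:R * (rb * Q) ^+ 2).
  by rewrite normrM; apply: ler_pM.
have h5 : 2 ^+ 2 * (n%:R * (rb * Q) ^+ 2) = 4 * n%:R * rb ^+ 2 * Q ^+ 2 by ring.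
rewrite h5 in t3.
have -> (x y z q : R) : (x + y + z) * q = x * q + y * q + z * q by ring.
by lra.
Qed.

End normalised_sums.

Section estimator_event.
Context {T : Type} {R : realType}.
Variables (V : nat -> T -> R) (w : T) (a b : R) (n : nat).
Hypotheses (b1 : 1 < `|b|) (ba : `|b| < `|a|) (a2 : `|a| <= 2) (ab0 : a * b < 0).
Variables (kappa gamma lambda mu c x : R).
Hypotheses (kappa1 : 1 <= kappa) (gamma0 : 0 < gamma) (lambda0 : 0 < lambda)
  (mu0 : 0 < mu) (n0 : (0 < n)%N).
Hypotheses (a_gap : 2 * gamma / kappa <= a ^+ 2 - 1)
  (a_ratio : (2 * gamma)^-1 <= a ^+ 2 / (kappa * (a ^+ 2 - 1))).

Local Notation s := (\sum_(i < n) (a ^- i.+1 / Num.sqrt kappa) * V i w).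
Local Notation t := (\sum_(i < n) (b ^- i.+1 / Num.sqrt kappa) * V i w).
Local Notation num := (\sum_(k < n) process a b V k w * noise b V k.+1 w).
Local Notation den := (\sum_(k < n) process a b V k w ^+ 2).
Local Notation ra := (`|a| ^+ n).
Local Notation rb := (`|b| ^+ n).
Local Notation beta := (a * b / (a * b - 1)).
Local Notation alph := (a ^+ 2 / (kappa * (a ^+ 2 - 1))).

(** The coefficients of the errors after division of the numerator by a^n b^n kappa and of the
    denominator by a^(2n) kappa^2. The term 10 / gamma is 20 / (a^2 - 1) with a^2 - 1 >= 2 gamma /
    kappa, and 56 = 4 + 48 + 4. *)
Definition error_rate : R :=
  n%:R * ((9 + 10 / gamma) / rb + 56 * (rb / ra)).

(** The first summand converts the errors to the scale of S W, with 4 bounding |a - b|; the second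
    converts them to the scale of S^2, where they must not spoil the positivity of the
    denominator. *)
Definition error_weight : R :=
  lambda * mu * (4 * `|c| + `|x|) + 2 * gamma * lambda ^+ 2.

Let a1 : 1 < `|a|. Proof. exact: lt_trans ba. Qed.
Let na0 : 0 < `|a|. Proof. exact: lt_trans a1. Qed.
Let a0 : a != 0. Proof. by rewrite -normr_gt0 (lt_trans ltr01). Qed.
Let b0 : b != 0. Proof. by rewrite -normr_gt0 (lt_trans ltr01). Qed.
Let k0 : 0 < kappa. Proof. exact: lt_le_trans kappa1. Qed.
Let sk0 : 0 < Num.sqrt kappa. Proof. by rewrite sqrtr_gt0. Qed.
Let skE : Num.sqrt kappa ^+ 2 = kappa. Proof. by rewrite sqr_sqrtr// ltW. Qed.
Let ra0 : 0 < ra. Proof. by rewrite exprn_gt0// (lt_trans ltr01). Qed.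
Let rb0 : 0 < rb. Proof. by rewrite exprn_gt0// (lt_trans ltr01). Qed.
Let a21 : 0 < a ^+ 2 - 1.
Proof. by rewrite (lt_le_trans _ a_gap)// divr_gt0// mulr_gt0. Qed.

Lemma noise_scaled d : d != 0 -> noise d V n w =
  d ^+ n * Num.sqrt kappa * \sum_(i < n) (d ^- i.+1 / Num.sqrt kappa) * V i w.
Proof.
move=> d0; rewrite noiseE// -mulrA; congr (_ * _).
rewrite mulr_sumr; apply: eq_bigr => i _.
by rewrite mulrA mulrCA divff ?mulr1// gt_eqF.
Qed.

Let sign_stable (y e : R) : `|e| < `|y| -> (y + e <= 0) = (y <= 0).
Proof.
move=> ey; have [y0|y0] := leP y 0.
  have h := ler_norm e; rewrite (ler0_norm y0) in ey.
  by apply/idP; lra.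
have h := ler_norm (- e); rewrite normrN in h; rewrite (gtr0_norm y0) in ey.
by apply/negbTE; rewrite -ltNge; lra.
Qed.

Let EN : R := (9 / rb + 4 * n%:R * (rb / ra)) * mass V w n ^+ 2 / kappa.
Let ED : R := (20 / (ra * (a ^+ 2 - 1)) + 48 * (rb / ra) +
  4 * n%:R * (rb / ra) ^+ 2) * mass V w n ^+ 2 / kappa ^+ 2.

Let N : R := (a - b) * num / (a ^+ n * b ^+ n * kappa).
Let D : R := (a - b) ^+ 2 * den / ((a ^+ n) ^+ 2 * kappa ^+ 2).

Let an0 : a ^+ n != 0. Proof. by rewrite expf_neq0. Qed.
Let bn0 : b ^+ n != 0. Proof. by rewrite expf_neq0. Qed.
Let kn0 : kappa != 0. Proof. by rewrite gt_eqF. Qed.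

Let NE : `|N - beta * (s * t)| <= EN.
Proof.
have AB : noise a V n w * noise b V n w = a ^+ n * b ^+ n * kappa * (s * t).
  rewrite !noise_scaled//.
  transitivity (a ^+ n * b ^+ n * Num.sqrt kappa ^+ 2 * (s * t)); first by ring.
  by rewrite skE.
have -> : N - beta * (s * t) = ((a - b) * num - beta * (noise a V n w * noise b V n w)) /
    (a ^+ n * b ^+ n * kappa).
  rewrite AB /N; field.
  by rewrite kn0 bn0 an0 lt_eqF//; have := ab0; lra.
rewrite normrM normfV !normrM !normrX (gtr0_norm k0).
rewrite ler_pdivrMr ?mulr_gt0//.
apply: (le_trans (numerator_bound V w n b1 ba a2 ab0)).
rewrite le_eqVlt; apply/orP; left; apply/eqP.
by rewrite /EN; field; rewrite kn0 !gt_eqF.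
Qed.

Let DE : `|D - alph * s ^+ 2| <= ED.
Proof.
have AA : noise a V n w ^+ 2 = (a ^+ n) ^+ 2 * kappa * s ^+ 2.
  rewrite noise_scaled//.
  transitivity ((a ^+ n) ^+ 2 * Num.sqrt kappa ^+ 2 * s ^+ 2); first by ring.
  by rewrite skE.
have -> : D - alph * s ^+ 2 =
    ((a - b) ^+ 2 * den - a ^+ 2 / (a ^+ 2 - 1) * noise a V n w ^+ 2) /
    ((a ^+ n) ^+ 2 * kappa ^+ 2).
  rewrite AA /D; field.
  by rewrite kn0 an0 gt_eqF.
rewrite normrM normfV (normrM ((a ^+ n) ^+ 2)) !normrX (gtr0_norm k0).
rewrite ler_pdivrMr ?mulr_gt0 ?exprn_gt0//.
apply: (le_trans (denominator_bound V w n b1 ba a2 ab0)).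
rewrite le_eqVlt; apply/orP; left; apply/eqP.
by rewrite /ED; field; rewrite kn0 !gt_eqF.
Qed.

Let ENED : EN + ED <= error_rate * (n%:R * \sum_(i < n) V i w ^+ 2).
Proof.
have hQ := mass_sqr V w n; set S2 := \sum_(i < n) _ in hQ *.
have n1 : 1 <= n%:R :> R by rewrite ler1n.
have q0 : 0 < rb / ra by rewrite divr_gt0.
have q1 : rb / ra <= 1.
  by rewrite ler_pdivrMr// mul1r lerXn2r ?nnegrE// ltW.
have ir : ra^-1 <= rb^-1.
  by rewrite lef_pV2 ?posrE// lerXn2r ?nnegrE// ltW.
have irb : 0 < rb^-1 by rewrite invr_gt0.
have ik : kappa^-1 <= 1 by rewrite invf_le1.
have ik0 : 0 < kappa^-1 by rewrite invr_gt0.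
have ia : (a ^+ 2 - 1)^-1 <= kappa / (2 * gamma).
  rewrite -[leRHS]invrK lef_pV2 ?posrE ?invr_gt0 ?divr_gt0 ?mulr_gt0//.
  by rewrite invfM invrK mulrC.
have M0 : 0 <= mass V w n ^+ 2 by exact: sqr_ge0.
have eN : EN <= n%:R * (9 / rb + 4 * (rb / ra)) * mass V w n ^+ 2.
  have c0 : 0 <= 9 / rb + 4 * n%:R * (rb / ra).
    by rewrite addr_ge0// mulr_ge0// ltW.
  apply: (@le_trans _ _ ((9 / rb + 4 * n%:R * (rb / ra)) * mass V w n ^+ 2)).
    by rewrite /EN ler_piMr// mulr_ge0.
  by rewrite ler_wpM2r//; move: q0 irb n1; set q := rb / ra; set i := rb^-1; nra.
have eD : ED <= n%:R * (10 / gamma / rb + 52 * (rb / ra)) * mass V w n ^+ 2.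
  have h1 : ra^-1 * (a ^+ 2 - 1)^-1 <= rb^-1 * (kappa / (2 * gamma)).
    by apply: ler_pM => //; rewrite invr_ge0 ltW.
  have g0 : 0 < 10 / gamma * rb^-1 by rewrite mulr_gt0// divr_gt0.
  have h2 : 20 / (ra * (a ^+ 2 - 1)) * kappa^-1 ^+ 2 <= n%:R * (10 / gamma * rb^-1).
    apply: (@le_trans _ _ (10 / gamma * rb^-1 * kappa^-1)); last first.
      by rewrite (@le_trans _ _ (10 / gamma * rb^-1))// ?ler_piMr ?ler_peMl// ltW.
    have -> : 10 / gamma * rb^-1 * kappa^-1 =
        20 * (rb^-1 * (kappa / (2 * gamma))) * kappa^-1 ^+ 2.
      by field; rewrite kn0 !gt_eqF.
    by rewrite ler_wpM2r ?sqr_ge0// invfM ler_wpM2l.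
  have h3 : (48 * (rb / ra) + 4 * n%:R * (rb / ra) ^+ 2) * kappa^-1 ^+ 2 <=
      n%:R * (52 * (rb / ra)).
    have k2 : kappa^-1 ^+ 2 <= 1 by rewrite expr_le1// ltW.
    have c0 : 0 <= 48 * (rb / ra) + 4 * n%:R * (rb / ra) ^+ 2.
      by rewrite addr_ge0 ?mulr_ge0 ?sqr_ge0// ltW.
    apply: (@le_trans _ _ (48 * (rb / ra) + 4 * n%:R * (rb / ra) ^+ 2)).
      by rewrite ler_piMr.
    have h4 : n%:R * (rb / ra) ^+ 2 <= n%:R * (rb / ra).
      by rewrite ler_wpM2l// expr2 ler_piMr// ltW.
    have h5 : rb / ra <= n%:R * (rb / ra) by rewrite ler_peMl// ltW.
    by lra.
  have -> : ED = (20 / (ra * (a ^+ 2 - 1)) * kappa^-1 ^+ 2 +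
      (48 * (rb / ra) + 4 * n%:R * (rb / ra) ^+ 2) * kappa^-1 ^+ 2) * mass V w n ^+ 2.
    by rewrite /ED; field; rewrite kn0 !gt_eqF.
  rewrite ler_wpM2r//; rewrite (mulrDr n%:R); exact: lerD.
have -> : error_rate * (n%:R * S2) = n%:R * (9 / rb + 4 * (rb / ra)) * (n%:R * S2) +
    n%:R * (10 / gamma / rb + 52 * (rb / ra)) * (n%:R * S2).
  by rewrite /error_rate; ring.
have c1 : 0 <= n%:R * (9 / rb + 4 * (rb / ra)).
  by apply: mulr_ge0 => //; apply: addr_ge0; apply: mulr_ge0 => //; exact: ltW.
have c2 : 0 <= n%:R * (10 / gamma / rb + 52 * (rb / ra)).
  apply: mulr_ge0 => //; apply: addr_ge0; apply: mulr_ge0 => //; try exact: ltW.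
  by rewrite divr_ge0// ltW.
apply: lerD.
  by rewrite (le_trans eN)// ler_wpM2l.
by rewrite (le_trans eD)// ler_wpM2l.
Qed.

(** Once D > 0 the event reads c (a - b) N - x D <= 0. The main part of the left side is S W /
    (lambda mu), and an error smaller than it in modulus cannot change its sign. *)
Lemma estimator_event (est : R) :
  let S := lambda * s in
  let W := mu * (c * (a - b) * beta * t - x * alph * s) in
  let r := error_weight * error_rate * (n%:R * \sum_(i < n) V i w ^+ 2) in
  (den != 0 -> est = num / den) ->
  r < `|S * W| -> r < S ^+ 2 ->
  (c * (kappa * a ^+ n * b ^- n) * est <= x) = (S * W <= 0).
Proof.
move=> S W r hest rSW rS.
have w0 : 0 <= lambda * mu * (4 * `|c| + `|x|).
  by rewrite mulr_ge0 ?addr_ge0 ?mulr_ge0// ltW.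
have w1 : 0 <= 2 * gamma * lambda ^+ 2 by rewrite mulr_ge0 ?sqr_ge0 ?mulr_ge0// ltW.
have EN0 : 0 <= EN by rewrite (le_trans _ NE).
have ED0 : 0 <= ED by rewrite (le_trans _ DE).
have r1 : (lambda * mu * (4 * `|c| + `|x|) + 2 * gamma * lambda ^+ 2) * (EN + ED) <= r.
  rewrite [leRHS](_ : _ = error_weight * (error_rate * (n%:R * \sum_(i < n) V i w ^+ 2))).
    by rewrite ler_wpM2l// addr_ge0.
  exact/esym/mulrA.
(* This is where r < S^2 enters: it keeps ED below s^2 / (2 gamma), a lower bound for the main part
   of D. *)
have D0 : 0 < D.
  have h1 : 2 * gamma * lambda ^+ 2 * ED < lambda ^+ 2 * s ^+ 2.
    rewrite -exprMn (le_lt_trans _ rS)// (le_trans _ r1)//.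
    by rewrite ler_pM// ?lerDr ?lerDl.
  have h2 : 2 * gamma * ED < s ^+ 2.
    by rewrite -(ltr_pM2l (exprn_gt0 2 lambda0)) mulrCA mulrA; lra.
  have h3 : ED < (2 * gamma)^-1 * s ^+ 2 by rewrite ltr_pdivlMl// mulr_gt0.
  have h4 : (2 * gamma)^-1 * s ^+ 2 <= alph * s ^+ 2 by rewrite ler_wpM2r ?sqr_ge0.
  by move: DE; rewrite ler_norml => /andP[h5 _]; lra.
have abn0 : a - b != 0.
  rewrite subr_eq0; apply/eqP => ab; move: ab0; rewrite ab -expr2.
  by rewrite ltNge sqr_ge0.
(* Hence the arbitrary value of the estimator on a vanishing denominator never enters. *)
have den0 : den != 0.
  by apply/eqP => h; move: D0; rewrite /D h mulr0 mul0r ltxx.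
have YE : c * (kappa * a ^+ n * b ^- n) * est = c * (a - b) * N / D.
  rewrite (hest den0) /N /D; field.
  by rewrite kn0 an0 bn0 den0 abn0.
rewrite YE ler_pdivrMr// -subr_le0.
have lm0 : 0 < lambda * mu by rewrite mulr_gt0.
have -> : c * (a - b) * N - x * D = S * W / (lambda * mu) +
    (c * (a - b) * (N - beta * (s * t)) - x * (D - alph * s ^+ 2)).
  rewrite /S /W; set al := alph; set be := beta; field.
  by rewrite !gt_eqF.
rewrite sign_stable.
  by rewrite pmulr_lle0 ?invr_gt0.
rewrite normrM normfV (gtr0_norm lm0) ltr_pdivlMr// (le_lt_trans _ rSW)//.
rewrite (le_trans _ r1)// mulrC.
have ab4 : `|a - b| <= 4.
  by rewrite (le_trans (ler_normB _ _))//; have := a2; have := ba; lra.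
have h1 : `|c * (a - b) * (N - beta * (s * t)) - x * (D - alph * s ^+ 2)| <=
    (4 * `|c| + `|x|) * (EN + ED).
  rewrite (le_trans (ler_normB _ _))// !(normrM (c * _)) (normrM c) (normrM x).
  have g1 : `|c| * `|a - b| * `|N - beta * (s * t)| <= `|c| * 4 * EN.
    by rewrite ler_pM ?mulr_ge0// ler_wpM2l.
  have g2 : `|x| * `|D - alph * s ^+ 2| <= `|x| * ED by rewrite ler_wpM2l.
  have g3 : 0 <= `|c| * ED by rewrite mulr_ge0.
  have g4 : 0 <= `|x| * EN by rewrite mulr_ge0.
  by lra.
rewrite (le_trans (ler_wpM2l (ltW lm0) h1))// mulrA ler_wpM2r ?addr_ge0//.
by rewrite lerDl.
Qed.

End estimator_event.

(** * The two roots *)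

Section rates.
Context {R : realType}.
Variable alpha : R.
Hypothesis halpha : 0 < alpha < 1.
Local Notation kappa n := (k_ alpha n).
Implicit Types (n : nat) (g h : R).

Let alpha0 : 0 < alpha. Proof. by case/andP: halpha. Qed.
Let alpha1 : alpha < 1. Proof. by case/andP: halpha. Qed.

Lemma k_ge1 n : (0 < n)%N -> 1 <= kappa n.
Proof.
move=> n0; rewrite /k_ -[leLHS](powRr0 n%:R); apply: ler_powR; last exact: ltW.
by rewrite ler1n.
Qed.

Lemma kV_cvg0 : (kappa n)^-1 @[n --> \oo] --> 0.
Proof.
apply/cvgrPdist_le => e e0; near=> n.
have n0 : (0 < n)%N by near: n; exists 1%N.
have k0 : 0 < kappa n by rewrite (lt_le_trans ltr01)// k_ge1.
rewrite sub0r normrN ger0_norm ?invr_ge0 ?(ltW k0)//.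
rewrite -[leRHS]invrK lef_pV2 ?posrE ?invr_gt0//.
have -> : e^-1 = (e^-1 `^ alpha^-1) `^ alpha.
  by rewrite -powRrM mulVf ?gt_eqF// powRr1// invr_ge0 ltW.
apply: ge0_ler_powR; rewrite ?nnegrE ?powR_ge0 ?(ltW alpha0)//.
by near: n; exact: nbhs_infty_ger.
Unshelve. all: by end_near. Qed.

Lemma k_exponent n : (0 < n)%N -> n%:R / kappa n = n%:R `^ (1 - alpha).
Proof.
move=> n0; rewrite powRD; last by rewrite pnatr_eq0 -lt0n n0 implybT.
by rewrite powRr1// powRN.
Qed.

(** The power is at least exp(g' n^(1 - alpha)), and since alpha < 1 this beats every power of n.
    The case h = 0 serves powers of the minor root; h = delta serves the quotient of the two roots,
    which is 1 + (gamma - delta) / (kappa + delta). *)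
Lemma geometric_growth g h : 0 < g -> 0 <= h ->
  exists C : R, 0 <= C /\ forall n, (0 < n)%N ->
    n%:R ^+ 3 / (1 + g / (kappa n + h)) ^+ n <= C * n%:R^-1.
Proof.
move=> g0 h0.
(* The order at which exp z >= (z / j)^j yields n^4, since (1 - alpha) j >= 4. *)
pose j := Num.bound (4 / (1 - alpha)).
have d0 : 0 < 1 - alpha by rewrite subr_gt0.
have jb : 4 / (1 - alpha) < j%:R.
  by apply: archi_boundP; rewrite divr_ge0// ltW.
have j0 : 0 < j%:R :> R by rewrite (lt_trans _ jb)// divr_gt0.
have jd : 4 <= (1 - alpha) * j%:R by rewrite mulrC -ler_pdivrMr// ltW.
(* A lower bound for g kappa / (kappa + h + g), because kappa >= 1. *)
pose g' := g / (1 + h + g).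
have s0 : 0 < 1 + h + g by lra.
have g'0 : 0 < g' by rewrite divr_gt0.
exists ((g' / j%:R) ^- j); split; first by rewrite invr_ge0 exprn_ge0// divr_ge0// ltW.
move=> n n0; have k1 := k_ge1 n0; have n1 : 1 <= n%:R :> R by rewrite ler1n.
have np : 0 < n%:R :> R by rewrite ltr0n.
have k0 : 0 < kappa n by rewrite (lt_le_trans ltr01).
have kh0 : 0 < kappa n + h by lra.
set y := g / (kappa n + h).
have y0 : 0 < y by rewrite divr_gt0.
have step1 : expR (g' * (n%:R / kappa n)) <= (1 + y) ^+ n.
  (* This is 1 + u <= exp u at u = - y / (1 + y), where the left side equals 1 / (1 + y). *)
  have h1 : expR (y / (1 + y)) <= 1 + y.
    have e1 := expR_ge1Dx (- (y / (1 + y))).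
    have e2 : 1 + - (y / (1 + y)) = (1 + y)^-1 by field; rewrite gt_eqF//; lra.
    rewrite e2 expRN in e1.
    by move: e1; rewrite lef_pV2// posrE ?expR_gt0//; lra.
  apply: (@le_trans _ _ (expR (y / (1 + y)) ^+ n)); last first.
    by apply: lerXn2r; rewrite ?nnegrE ?expR_ge0//; lra.
  rewrite -expRM_natl ler_expR mulrCA ler_wpM2l// ?ler0n//.
  have -> : y / (1 + y) = g / (kappa n + h + g).
    by rewrite /y; field; rewrite !gt_eqF//; lra.
  rewrite /g' -mulrA -invfM ler_wpM2l ?(ltW g0)//.
  rewrite lef_pV2 ?posrE ?mulr_gt0//; last by lra.
  by nra.
have step2 : (g' / j%:R) ^+ j * n%:R ^+ 4 <= expR (g' * (n%:R / kappa n)).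
  set z := g' * (n%:R / kappa n).
  have z0 : 0 < z by rewrite mulr_gt0// divr_gt0.
  have h1 : (z / j%:R) ^+ j <= expR z.
    have -> : expR z = expR (z / j%:R) ^+ j.
      by rewrite -expRM_natl mulrC divfK// gt_eqF.
    apply: lerXn2r; rewrite ?nnegrE ?expR_ge0 ?divr_ge0 ?(ltW z0)//.
    by have := expR_ge1Dx (z / j%:R); lra.
  apply: (le_trans _ h1).
  have -> : z / j%:R = g' / j%:R * (n%:R / kappa n) by rewrite /z; field; rewrite !gt_eqF.
  have gj : 0 <= (g' / j%:R) ^+ j by apply/exprn_ge0/ltW/divr_gt0.
  rewrite (exprMn j (g' / j%:R)) ler_wpM2l//.
  rewrite k_exponent// -powR_mulrn ?ler0n// -powR_mulrn ?powR_ge0// -powRrM.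
  exact: ler_powR.
have c0 : 0 < (g' / j%:R) ^+ j by rewrite exprn_gt0// divr_gt0.
rewrite ler_pdivrMr; last by rewrite exprn_gt0//; lra.
have h3 := le_trans step2 step1.
set c := (g' / j%:R) ^+ j in c0 h3 *.
have -> : n%:R ^+ 3 = c^-1 * n%:R^-1 * (c * n%:R ^+ 4).
  by field; rewrite !gt_eqF.
by rewrite ler_wpM2l// mulr_ge0 ?invr_ge0 ?ler0n// ltW.
Qed.

End rates.

Section root_limits.
Context {R : realType}.
Variables (alpha gamma delta e : R).
Hypotheses (halpha : 0 < alpha < 1) (delta0 : 0 < delta)
  (deltagamma : delta < gamma) (e2 : e ^+ 2 = 1).
Local Notation kappa n := (k_ alpha n).

(* [e] is 1 when theta dominates and -1 when rho does. *)
Definition dominant_root n : R := e * (1 + gamma / kappa n).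
Definition minor_root n : R := - e * (1 + delta / kappa n).
Local Notation a := dominant_root.
Local Notation b := minor_root.

Let gamma0 : 0 < gamma. Proof. exact: lt_trans deltagamma. Qed.
Let ne : `|e| = 1.
Proof.
apply/eqP; rewrite -(@eqrXn2 _ 2)//; apply/eqP.
by rewrite real_normK ?num_real// e2 expr1n.
Qed.
Let e0 : e != 0. Proof. by rewrite -normr_gt0 ne. Qed.

Let k0 n : (0 < n)%N -> 0 < kappa n.
Proof. by move=> n0; rewrite (lt_le_trans ltr01)// k_ge1. Qed.

Lemma normr_dominant_root n : (0 < n)%N -> `|a n| = 1 + gamma / kappa n.
Proof.
move=> n0; rewrite normrM ne mul1r gtr0_norm// addr_gt0// divr_gt0//.
exact: k0.
Qed.

Lemma normr_minor_root n : (0 < n)%N -> `|b n| = 1 + delta / kappa n.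
Proof.
move=> n0; rewrite normrM normrN ne mul1r gtr0_norm// addr_gt0// divr_gt0//.
exact: k0.
Qed.

Lemma minor_root_gt1 n : (0 < n)%N -> 1 < `|b n|.
Proof. by move=> n0; rewrite normr_minor_root// ltrDl divr_gt0// k0. Qed.

Lemma minor_root_lt n : (0 < n)%N -> `|b n| < `|a n|.
Proof.
move=> n0; rewrite normr_minor_root// normr_dominant_root// ltrD2l.
by rewrite ltr_pM2r// invr_gt0 k0.
Qed.

Lemma dominant_root_le2 : \forall n \near \oo, `|a n| <= 2.
Proof.
have /cvgrPdist_le/(_ gamma^-1) := kV_cvg0 halpha.
rewrite invr_gt0 => /(_ gamma0) h; near=> n.
have n0 : (0 < n)%N by near: n; exists 1%N.
rewrite normr_dominant_root//.
have : `|0 - (kappa n)^-1| <= gamma^-1 by near: n.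
rewrite sub0r normrN ger0_norm ?invr_ge0 ?(ltW (k0 n0))// => h1.
have : gamma * (kappa n)^-1 <= gamma * gamma^-1 by rewrite ler_wpM2l// ltW.
by rewrite divff ?gt_eqF//; lra.
Unshelve. all: by end_near. Qed.

Lemma roots_mul_lt0 n : (0 < n)%N -> a n * b n < 0.
Proof.
move=> n0; rewrite /a /b; have := k0 n0 => kn.
have -> : e * (1 + gamma / kappa n) * (- e * (1 + delta / kappa n)) =
    - ((1 + gamma / kappa n) * (1 + delta / kappa n)) * e ^+ 2 by ring.
rewrite e2 mulr1 oppr_lt0 mulr_gt0// addr_gt0// divr_gt0//.
Qed.

Lemma dominant_root_sqr n : a n ^+ 2 = (1 + gamma * (kappa n)^-1) ^+ 2.
Proof. by rewrite /a exprMn e2 mul1r. Qed.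

Lemma dominant_root_gap n : (0 < n)%N -> 2 * gamma / kappa n <= a n ^+ 2 - 1.
Proof.
move=> n0; rewrite dominant_root_sqr; have i0 : 0 < (kappa n)^-1 by rewrite invr_gt0 k0.
by move: i0; set i := (kappa n)^-1 => i0; have := sqr_ge0 (gamma * i); nra.
Qed.

Lemma dominant_root_ratioE n : (0 < n)%N -> kappa n * (a n ^+ 2 - 1) =
  2 * gamma + gamma ^+ 2 * (kappa n)^-1.
Proof. by move=> n0; rewrite dominant_root_sqr; field; rewrite gt_eqF// k0. Qed.

Lemma minor_root_ratioE n : (0 < n)%N -> kappa n * (b n ^+ 2 - 1) =
  2 * delta + delta ^+ 2 * (kappa n)^-1.
Proof.
move=> n0; have -> : b n ^+ 2 = (1 + delta * (kappa n)^-1) ^+ 2.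
  by rewrite /b exprMn sqrrN e2 mul1r.
by field; rewrite gt_eqF// k0.
Qed.

Lemma dominant_root_ratio n : (0 < n)%N ->
  (2 * gamma)^-1 <= a n ^+ 2 / (kappa n * (a n ^+ 2 - 1)).
Proof.
move=> n0; rewrite dominant_root_ratioE// dominant_root_sqr.
have i0 : 0 < (kappa n)^-1 by rewrite invr_gt0 k0.
move: i0; set i := (kappa n)^-1 => i0.
have d0 : 0 < 2 * gamma + gamma ^+ 2 * i by rewrite addr_gt0 ?mulr_gt0 ?exprn_gt0.
rewrite ler_pdivlMr// mulrC ler_pdivrMr ?mulr_gt0//.
have h1 : 0 < gamma * i by rewrite mulr_gt0.
have h2 : 0 < gamma * (gamma * i) by rewrite mulr_gt0.
have h3 : 0 <= gamma * (gamma * i) ^+ 2 by rewrite mulr_ge0 ?sqr_ge0// ltW.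
by nra.
Qed.

Lemma dominant_root_ratio_cvg :
  a n ^+ 2 / (kappa n * (a n ^+ 2 - 1)) @[n --> \oo] --> (2 * gamma)^-1.
Proof.
have kc := kV_cvg0 halpha.
have h : (1 + gamma * (kappa n)^-1) ^+ 2 / (2 * gamma + gamma ^+ 2 * (kappa n)^-1)
    @[n --> \oo] --> (1 + gamma * 0) ^+ 2 / (2 * gamma + gamma ^+ 2 * 0).
  have h1 : 1 + gamma * (kappa n)^-1 @[n --> \oo] --> 1 + gamma * 0.
    by apply: cvgD; [exact: cvg_cst|apply: cvgM => //; exact: cvg_cst].
  apply: cvgM; first by under eq_fun do rewrite expr2; rewrite expr2; exact: cvgM.
  apply: cvgV; first by rewrite mulr0 addr0 gt_eqF// mulr_gt0.
  by apply: cvgD; [exact: cvg_cst|apply: cvgM => //; exact: cvg_cst].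
rewrite !mulr0 !addr0 expr1n mul1r in h.
apply: cvg_trans h; apply: near_eq_cvg; near=> n.
have n0 : (0 < n)%N by near: n; exists 1%N.
by rewrite dominant_root_ratioE// dominant_root_sqr.
Unshelve. all: by end_near. Qed.

(** The first factor tends to 2 e and a b tends to -1, so the second tends to 1/2. *)
Lemma cross_ratio_cvg :
  (a n - b n) * (a n * b n / (a n * b n - 1)) @[n --> \oo] --> e.
Proof.
have kc := kV_cvg0 halpha.
have ac : a n @[n --> \oo] --> e.
  have h : a n @[n --> \oo] --> e * (1 + gamma * 0).
    apply: cvgM; first exact: cvg_cst.
    by apply: cvgD; [exact: cvg_cst|apply: cvgM => //; exact: cvg_cst].
  by rewrite mulr0 addr0 mulr1 in h.
have bc : b n @[n --> \oo] --> - e.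
  have h : b n @[n --> \oo] --> (- e) * (1 + delta * 0).
    apply: cvgM; first exact: cvg_cst.
    by apply: cvgD; [exact: cvg_cst|apply: cvgM => //; exact: cvg_cst].
  by rewrite mulr0 addr0 mulr1 in h.
have abc : a n * b n @[n --> \oo] --> (-1 : R).
  have -> : -1 = e * (- e) :> R by rewrite mulrN -expr2 e2.
  exact: cvgM.
rewrite [X in _ --> X](_ : e = (e - (- e)) * (-1 / (-1 - 1))); last by field.
apply: cvgM; first exact: cvgB.
apply: cvgM => //; apply: cvgV.
  by rewrite lt_eqF//; lra.
by apply: cvgB => //; exact: cvg_cst.
Qed.

(** One factor n comes from Cauchy-Schwarz and one from the mean n sigma^2 of the sum of squares;
    with the n inside [error_rate] they make the cube of [geometric_growth]. *)
Lemma error_rate_cvg0 :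
  n%:R ^+ 2 * error_rate (a n) (b n) n gamma @[n --> \oo] --> 0.
Proof.
have [C1 [C10 h1]] := geometric_growth halpha delta0 (lexx 0).
have [|C2 [C20 h2]] := geometric_growth halpha (g := gamma - delta) _ (ltW delta0).
  by rewrite subr_gt0.
pose K := (9 + 10 / gamma) * C1 + 56 * C2.
apply: (@squeeze_cvgr _ _ _ _ (cst 0) (fun n => K * n%:R^-1)).
- near=> n.
  have n0 : (0 < n)%N by near: n; exists 1%N.
  have kn := k0 n0.
  have {}h1 := h1 n n0; have {}h2 := h2 n n0; rewrite addr0 in h1.
  rewrite /error_rate normr_minor_root// normr_dominant_root//.
  have A0 : 0 < 1 + gamma / kappa n by rewrite addr_gt0// divr_gt0.
  have B0 : 0 < 1 + delta / kappa n by rewrite addr_gt0// divr_gt0.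
  have q : (1 + delta / kappa n) ^+ n / (1 + gamma / kappa n) ^+ n =
      ((1 + (gamma - delta) / (kappa n + delta)) ^+ n)^-1.
    rewrite -expr_div_n -exprVn; congr (_ ^+ n); field.
    by rewrite !gt_eqF//; have := delta0; have := gamma0; lra.
  rewrite q.
  have -> (x y : R) : n%:R ^+ 2 * (n%:R * ((9 + 10 / gamma) / x + 56 * y^-1)) =
      (9 + 10 / gamma) * (n%:R ^+ 3 / x) + 56 * (n%:R ^+ 3 / y) by ring.
  have g0 : 0 < 9 + 10 / gamma by rewrite addr_gt0// divr_gt0.
  have gg : 0 <= (gamma - delta) / (kappa n + delta).
    by rewrite divr_ge0 ?subr_ge0 ?(ltW deltagamma)// addr_ge0// ltW.
  apply/andP; split.
    rewrite addr_ge0// mulr_ge0 ?divr_ge0 ?exprn_ge0 ?ler0n ?(ltW g0) ?(ltW B0)//.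
    by lra.
  have -> : K * n%:R^-1 = (9 + 10 / gamma) * (C1 * n%:R^-1) + 56 * (C2 * n%:R^-1).
    by rewrite /K; ring.
  by apply: lerD; rewrite ler_wpM2l// ltW.
- exact: cvg_cst.
- rewrite -[X in _ --> X](mulr0 K); apply: cvgM; first exact: cvg_cst.
  rewrite gtr0_cvgV0; first exact: cvgr_idn.
  by exists 1%N => // n /= n1; rewrite ltr0n.
Unshelve. all: by end_near. Qed.

End root_limits.

(** * Limits of the quadratic sums of weights *)

Section weight_limits.
Context {R : realType}.
Variables (alpha gamma delta e : R).
Hypotheses (halpha : 0 < alpha < 1) (delta0 : 0 < delta)
  (deltagamma : delta < gamma) (e2 : e ^+ 2 = 1).
Local Notation kappa n := (k_ alpha n).
Local Notation a := (dominant_root alpha gamma e).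
Local Notation b := (minor_root alpha delta e).

Let gamma0 : 0 < gamma. Proof. exact: lt_trans deltagamma. Qed.
Let k0 n : (0 < n)%N -> 0 < kappa n.
Proof. by move=> n0; rewrite (lt_le_trans ltr01)// k_ge1. Qed.

Lemma geometric_sum (c : R) n : c != 0 -> c != 1 ->
  \sum_(i < n) c ^- i.+1 = (1 - c ^- n) / (c - 1).
Proof.
move=> c0 c1; have c1' : c - 1 != 0 by rewrite subr_eq0.
elim: n => [|n IH]; first by rewrite big_ord0 expr0 invr1 subrr mul0r.
rewrite big_ord_recr/= IH exprS; field.
by rewrite c1' c0 expf_neq0.
Qed.

Lemma inverse_power_cvg0 (c : nat -> R) :
  (\forall n \near \oo, `|b n| <= `|c n|) -> (c n) ^- n @[n --> \oo] --> (0 : R).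
Proof.
move=> bc; have [C [C0 h]] := geometric_growth halpha delta0 (lexx 0).
apply/norm_cvg0P; apply: (@squeeze_cvgr _ _ _ _ (cst 0) (fun n => C * n%:R^-1)).
- near=> n; have n0 : (0 < n)%N by near: n; exists 1%N.
  rewrite normr_ge0/=; have {}h := h n n0; rewrite addr0 in h.
  have bn : `|b n| <= `|c n| by near: n.
  have b1 := minor_root_gt1 halpha delta0 e2 n0.
  rewrite (normr_minor_root halpha delta0 e2 n0) in bn b1.
  set x := 1 + delta / kappa n in h bn b1.
  have x0 : 0 < x by exact: lt_trans b1.
  rewrite (le_trans _ h)// normfV normrX.
  have n1 : 1 <= n%:R ^+ 3 :> R by rewrite -natrX ler1n expn_gt0 n0.
  apply: (@le_trans _ _ (1 / x ^+ n)); last by rewrite ler_wpM2r// invr_ge0 exprn_ge0 ?ltW.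
  rewrite div1r lef_pV2 ?posrE ?exprn_gt0//; last by exact: lt_le_trans bn.
  by apply: lerXn2r; rewrite ?nnegrE ?(ltW x0).
- exact: cvg_cst.
- rewrite -[X in _ --> X](mulr0 C); apply: cvgM; first exact: cvg_cst.
  rewrite gtr0_cvgV0; first exact: cvgr_idn.
  by exists 1%N => // n /= n1; rewrite ltr0n.
Unshelve. all: by end_near. Qed.

Let near_pos : \forall n \near \oo, (0 < n)%N.
Proof. by exists 1%N. Qed.

Let ratio_cvg (c : R) : 2 * c + c ^+ 2 * (kappa n)^-1 @[n --> \oo] --> 2 * c.
Proof.
rewrite -[X in _ --> X]addr0 -[X in _ --> _ + X](mulr0 (c ^+ 2)).
apply: cvgD; first exact: cvg_cst.
by apply: cvgM; [exact: cvg_cst|exact: kV_cvg0].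
Qed.

(** One formula for two regimes. For c = d a root, kappa (c^2 - 1) has a positive limit, which gives
    the variances. For c and d the two roots, c d - 1 stays away from 0 and the factor kappa makes
    the sum vanish, which gives the asymptotic independence. *)
Let weight_sqr (c d : R) n : (0 < n)%N -> c * d != 0 -> c * d != 1 ->
  \sum_(i < n) (c ^- i.+1 / Num.sqrt (kappa n)) * (d ^- i.+1 / Num.sqrt (kappa n)) =
  (1 - (c * d) ^- n) / (kappa n * (c * d - 1)).
Proof.
move=> n0 cd0 cd1; have kn := k0 n0.
have sk : Num.sqrt (kappa n) ^+ 2 = kappa n by rewrite sqr_sqrtr// ltW.
have sk0 : Num.sqrt (kappa n) != 0 by rewrite gt_eqF// sqrtr_gt0.
transitivity ((kappa n)^-1 * \sum_(i < n) (c * d) ^- i.+1).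
  rewrite mulr_sumr; apply: eq_bigr => i _.
  have -> : (kappa n)^-1 = (Num.sqrt (kappa n))^-1 * (Num.sqrt (kappa n))^-1.
    by rewrite -invfM -expr2 sk.
  by rewrite exprMn invfM; ring.
by rewrite geometric_sum// invfM; ring.
Qed.

Let sum_square_weights (c : nat -> R) (g : R) : 0 < g ->
  (\forall n \near \oo, `|b n| <= `|c n|) ->
  (forall n, (0 < n)%N -> kappa n * (c n ^+ 2 - 1) = 2 * g + g ^+ 2 * (kappa n)^-1) ->
  \sum_(i < n) (c n ^- i.+1 / Num.sqrt (kappa n)) ^+ 2 @[n --> \oo] --> (2 * g)^-1.
Proof.
move=> g0 bc ce.
have h : (1 - (c n * c n) ^- n) * (2 * g + g ^+ 2 * (kappa n)^-1)^-1 @[n --> \oo] -->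
    (1 - 0) * (2 * g)^-1.
  apply: cvgM; last by apply: cvgV; [rewrite gt_eqF// mulr_gt0|exact: ratio_cvg].
  apply: cvgB; first exact: cvg_cst.
  apply: inverse_power_cvg0; near=> n.
  have n0 : (0 < n)%N by near: n.
  have bcn : `|b n| <= `|c n| by near: n.
  have b1 := minor_root_gt1 halpha delta0 e2 n0.
  rewrite (normrM (c n)) (le_trans bcn)// ler_peMr// (le_trans _ bcn)// ltW//.
rewrite subr0 mul1r in h.
apply: cvg_trans h; apply: near_eq_cvg; near=> n.
have n0 : (0 < n)%N by near: n.
have bcn : `|b n| <= `|c n| by near: n.
have b1 := minor_root_gt1 halpha delta0 e2 n0.
have c1 : 1 < c n * c n.
  by rewrite -expr2 -(real_normK (num_real (c n))) exprn_egt1// (lt_le_trans b1).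
under [RHS]eq_bigr do rewrite expr2.
rewrite weight_sqr//; [|by rewrite gt_eqF// (lt_trans ltr01)|by rewrite gt_eqF].
by rewrite -ce// expr2.
Unshelve. all: by end_near. Qed.

Lemma sum_dominant_weights :
  \sum_(i < n) (a n ^- i.+1 / Num.sqrt (kappa n)) ^+ 2 @[n --> \oo] --> (2 * gamma)^-1.
Proof.
apply: sum_square_weights => //; last exact: dominant_root_ratioE.
near=> n; have n0 : (0 < n)%N by near: n.
exact: (ltW (minor_root_lt halpha delta0 deltagamma e2 n0)).
Unshelve. all: by end_near. Qed.

Lemma sum_minor_weights :
  \sum_(i < n) (b n ^- i.+1 / Num.sqrt (kappa n)) ^+ 2 @[n --> \oo] --> (2 * delta)^-1.
Proof.
apply: sum_square_weights => //; last exact: minor_root_ratioE.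
exact: nearW.
Qed.

Lemma sum_cross_weights :
  \sum_(i < n) (a n ^- i.+1 / Num.sqrt (kappa n)) * (b n ^- i.+1 / Num.sqrt (kappa n))
    @[n --> \oo] --> (0 : R).
Proof.
apply/norm_cvg0P.
apply: (@squeeze_cvgr _ _ _ _ (cst 0) (fun n => 2 * (kappa n)^-1)).
- near=> n; have n0 : (0 < n)%N by near: n.
  have ab0 := roots_mul_lt0 halpha delta0 deltagamma e2 n0.
  have b1 := minor_root_gt1 halpha delta0 e2 n0.
  have ba := minor_root_lt halpha delta0 deltagamma e2 n0.
  have ab1 : 1 <= `|a n * b n|.
    by rewrite (normrM (a n)) -[1]mulr1 ler_pM// ltW// (lt_trans b1).
  rewrite normr_ge0/= weight_sqr//; last 2 first.
  - by rewrite lt_eqF.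
  - by rewrite lt_eqF// (lt_trans ab0).
  rewrite invfM mulrCA mulrC normrM.
  have kV : 0 < (kappa n)^-1 by rewrite invr_gt0 k0.
  rewrite (gtr0_norm kV) ler_wpM2r ?(ltW kV)//.
  rewrite normrM normfV.
  have d1 : 1 <= `|a n * b n - 1| by rewrite ltr0_norm; lra.
  have h1 : `|1 - (a n * b n) ^- n| <= 2.
    rewrite (le_trans (ler_normB _ _))// normr1 normfV normrX.
    have : (`|a n * b n| ^+ n)^-1 <= 1.
      by rewrite invf_le1 ?exprn_ege1// exprn_gt0// (lt_le_trans ltr01).
    by lra.
  rewrite -[2]mulr1 ler_pM//.
  by rewrite invf_le1// (lt_le_trans ltr01).
- exact: cvg_cst.
- rewrite -[X in _ --> X](mulr0 2); apply: cvgM; [exact: cvg_cst|exact: kV_cvg0].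
Unshelve. all: by end_near. Qed.

(** The Cramer-Wold device: a linear combination of the two sums is again one weighted sum of V. The
    coefficients depend on n because those of W do. *)
Definition weight (p q : nat -> R) n i : R :=
  p n * (a n ^- i.+1 / Num.sqrt (kappa n)) + q n * (b n ^- i.+1 / Num.sqrt (kappa n)).

Lemma sum_weight_sqr (p q : nat -> R) (p' q' : R) :
  p n @[n --> \oo] --> p' -> q n @[n --> \oo] --> q' ->
  \sum_(i < n) weight p q n i ^+ 2 @[n --> \oo] -->
    p' ^+ 2 / (2 * gamma) + q' ^+ 2 / (2 * delta).
Proof.
move=> pc qc.
have E : (fun n => \sum_(i < n) weight p q n i ^+ 2) = (fun n =>
   p n * p n * \sum_(i < n) (a n ^- i.+1 / Num.sqrt (kappa n)) ^+ 2 +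
   2 * p n * q n * (\sum_(i < n) (a n ^- i.+1 / Num.sqrt (kappa n)) *
     (b n ^- i.+1 / Num.sqrt (kappa n))) +
   q n * q n * \sum_(i < n) (b n ^- i.+1 / Num.sqrt (kappa n)) ^+ 2).
  apply/funext => n; rewrite !mulr_sumr -!big_split/=; apply: eq_bigr => i _.
  by rewrite /weight; ring.
rewrite E.
have -> : p' ^+ 2 / (2 * gamma) + q' ^+ 2 / (2 * delta) =
  p' * p' * (2 * gamma)^-1 + 2 * p' * q' * 0 + q' * q' * (2 * delta)^-1.
  by rewrite mulr0 addr0 -!expr2.
apply: cvgD; [apply: cvgD|].
- by apply: cvgM; [exact: cvgM|exact: sum_dominant_weights].
- apply: cvgM; last exact: sum_cross_weights.
  by apply: cvgM => //; apply: cvgM => //; exact: cvg_cst.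
- by apply: cvgM; [exact: cvgM|exact: sum_minor_weights].
Qed.

Lemma weight_small (p q : nat -> R) (p' q' : R) :
  p n @[n --> \oo] --> p' -> q n @[n --> \oo] --> q' ->
  exists r : nat -> R, r n @[n --> \oo] --> 0 /\
    forall n i, (i < n)%N -> `|weight p q n i| <= r n.
Proof.
move=> pc qc; exists (fun n => (`|p n| + `|q n|) * Num.sqrt (kappa n)^-1); split.
  rewrite -[X in _ --> X](mulr0 (`|p'| + `|q'|)); apply: cvgM.
    by apply: cvgD; exact: cvg_norm.
  rewrite -[X in _ --> X](@sqrtr0 R).
  apply: (cvg_comp (fun n => (kappa n)^-1) Num.sqrt); first exact: kV_cvg0.
  exact: sqrt_continuous.
move=> n i hi; have n0 : (0 < n)%N by case: n hi.
have kn := k0 n0.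
have s0 : 0 < (Num.sqrt (kappa n))^-1 by rewrite invr_gt0 sqrtr_gt0.
rewrite /weight sqrtrV; last exact: ltW.
have bd (c : R) : 1 <= `|c| -> `|c ^- i.+1 / Num.sqrt (kappa n)| <= (Num.sqrt (kappa n))^-1.
  move=> c1; rewrite normrM (gtr0_norm s0) ler_piMl ?(ltW s0)//.
  by rewrite normfV normrX invf_le1 ?exprn_ege1// exprn_gt0// (lt_le_trans ltr01).
rewrite (le_trans (ler_normD _ _))// mulrDl; apply: lerD; rewrite normrM ler_wpM2l//.
- apply: bd; apply: (le_trans (ltW (minor_root_gt1 halpha delta0 e2 n0))).
  exact: (ltW (minor_root_lt halpha delta0 deltagamma e2 n0)).
- by apply: bd; exact: (ltW (minor_root_gt1 halpha delta0 e2 n0)).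
Qed.

End weight_limits.

(** * The limit law *)

Section dominant_root_estimator.
Context {d : measure_display} {T : measurableType d} {R : realType}
  {P : probability T R} {V : nat -> {RV P >-> R}} {sigma : R}.
Hypotheses (hV : iid V)
  (hmean : forall k, ('E_P[V k] = 0)%E)
  (hvar : forall k, ('V_P[V k] = (sigma ^+ 2)%:E)%E)
  (hsigma : 0 < sigma ^+ 2).
Variables (alpha gamma delta e : R).
Hypotheses (halpha : 0 < alpha < 1) (delta0 : 0 < delta)
  (deltagamma : delta < gamma) (e2 : e ^+ 2 = 1).
Local Notation kappa n := (k_ alpha n).
Local Notation a := (dominant_root alpha gamma e).
Local Notation b := (minor_root alpha delta e).
Local Notation Vf := (fun k => V k : T -> R).
Local Notation s n w := (\sum_(i < n) (a n ^- i.+1 / Num.sqrt (kappa n)) * V i w).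
Local Notation t n w := (\sum_(i < n) (b n ^- i.+1 / Num.sqrt (kappa n)) * V i w).

Let gamma0 : 0 < gamma. Proof. exact: lt_trans deltagamma. Qed.
Let near_pos : \forall n \near \oo, (0 < n)%N.
Proof. by exists 1%N. Qed.

Let c : R := 1 / (2 * gamma) * Num.sqrt (delta / gamma).
(** The inverse of the limit standard deviation of s. The value of [mu] below makes the s-part of W
    tend to - x S, since the limit of [ratio] is 1 / (2 gamma), and it gives the t-part limit
    variance 1. *)
Let lambda : R := Num.sqrt (2 * gamma) / `|sigma|.
Let mu : R := 2 * gamma * lambda.
Let ratio n : R := a n ^+ 2 / (kappa n * (a n ^+ 2 - 1)).
Let cross n : R := (a n - b n) * (a n * b n / (a n * b n - 1)).

Let sigma0 : 0 < `|sigma|.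
Proof.
rewrite normr_gt0; apply/eqP => h; move: hsigma.
by rewrite h expr0n ltxx.
Qed.
Let lambda0 : 0 < lambda.
Proof. by rewrite divr_gt0// sqrtr_gt0 mulr_gt0. Qed.
Let mu0 : 0 < mu. Proof. by rewrite /mu mulr_gt0// mulr_gt0. Qed.
Let lambda_sqr : sigma ^+ 2 * lambda ^+ 2 = 2 * gamma.
Proof.
have g0 : 0 <= 2 * gamma by rewrite mulr_ge0// ltW.
have s0 : sigma != 0 by rewrite -normr_gt0.
rewrite /lambda exprMn sqr_sqrtr// exprVn real_normK ?num_real//.
by field.
Qed.
Let c_sqr : c ^+ 2 = delta / (4 * gamma ^+ 3).
Proof.
rewrite /c exprMn sqr_sqrtr ?divr_ge0 ?(ltW gamma0) ?(ltW delta0)//.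
by field; rewrite gt_eqF.
Qed.

Lemma partial_sum_weight (p q : nat -> R) n w :
  partial_sum (weight alpha gamma delta e p q n) V n w = p n * s n w + q n * t n w.
Proof.
rewrite /partial_sum !mulr_sumr -big_split/=; apply: eq_bigr => i _.
by rewrite /weight; ring.
Qed.

Let weighted_moment_bounded (p q : nat -> R) (p' q' : R) :
  p n @[n --> \oo] --> p' -> q n @[n --> \oo] --> q' ->
  \forall n \near \oo, \int[P]_w ((p n * s n w + q n * t n w) ^+ 2) <=
    sigma ^+ 2 * (p' ^+ 2 / (2 * gamma) + q' ^+ 2 / (2 * delta)) + 1.
Proof.
move=> pc qc.
have h := sum_weight_sqr halpha delta0 deltagamma e2 pc qc.
have h2 : sigma ^+ 2 * \sum_(i < n) weight alpha gamma delta e p q n i ^+ 2 @[n --> \oo] -->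
    sigma ^+ 2 * (p' ^+ 2 / (2 * gamma) + q' ^+ 2 / (2 * delta)).
  by apply: cvgM => //; exact: cvg_cst.
move/cvgrPdist_le : h2 => /(_ 1 ltr01); apply: filterS => n.
have [_ _ E] := partial_sum_second_moment hV hmean hvar (weight alpha gamma delta e p q n) n.
rewrite (_ : (fun w => partial_sum _ V n w ^+ 2) =
  (fun w => (p n * s n w + q n * t n w) ^+ 2)) in E; last first.
  by apply/funext => w; rewrite partial_sum_weight.
by rewrite E ler_distlC => /andP[_]; lra.
Qed.

Let integrable_weighted_sqr (p q : nat -> R) n :
  P.-integrable [set: T] (EFin \o (fun w => (p n * s n w + q n * t n w) ^+ 2)).
Proof.
have [_ h _] := partial_sum_second_moment hV hmean hvar (weight alpha gamma delta e p q n) n.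
rewrite (_ : (fun w => partial_sum _ V n w ^+ 2) =
  (fun w => (p n * s n w + q n * t n w) ^+ 2)) in h => //.
by apply/funext => w; rewrite partial_sum_weight.
Qed.

Let measurable_weighted (p q : nat -> R) n :
  measurable_fun [set: T] (fun w => p n * s n w + q n * t n w).
Proof.
have h := measurable_partial_sum (weight alpha gamma delta e p q n) V n.
rewrite (_ : (fun w => p n * s n w + q n * t n w) =
  partial_sum (weight alpha gamma delta e p q n) V n) => //.
by apply/funext => w; rewrite partial_sum_weight.
Qed.

(* The factors [lambda] and [mu] normalise the Gaussian limits, so that (S, W)
   converges to (G, H - x G) with G and H independent standard normal. *)
Lemma dominant_root_estimator_cvg (est : nat -> T -> R) (x : R) :
  (forall n, measurable_fun [set: T] (est n)) ->
  (forall n w, \sum_(k < n) process (a n) (b n) Vf k w ^+ 2 != 0 ->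
    est n w = (\sum_(k < n) process (a n) (b n) Vf k w * noise (b n) Vf k.+1 w) /
      (\sum_(k < n) process (a n) (b n) Vf k w ^+ 2)) ->
  fine (P [set w | c * (kappa n * a n ^+ n * b n ^- n) * est n w <= x]) @[n --> \oo] -->
  fine (\int[@lebesgue_measure R]_(y in `]-oo, x]) ((pi * (1 + y ^+ 2))^-1)%:E)%E.
Proof.
move=> mest hest.
pose S n w := lambda * s n w.
pose W n w := mu * (c * (a n - b n) * (a n * b n / (a n * b n - 1)) * t n w -
  x * ratio n * s n w).
pose r n w := error_weight gamma lambda mu c x * error_rate (a n) (b n) n gamma *
  (n%:R * \sum_(i < n) V i w ^+ 2).
(* The coefficients of s and t in A S + B W, so that every joint characteristic function value is
   that of one weighted sum. *)
pose p A B n : R := A * lambda - B * (mu * x * ratio n).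
pose q B n : R := B * (mu * c * cross n).
have SWE A B n w : A * S n w + B * W n w = p A B n * s n w + q B n * t n w.
  by rewrite /S /W /p /q /cross; ring.
have pc A B : p A B n @[n --> \oo] --> lambda * (A - B * x).
  rewrite (_ : lambda * (A - B * x) = A * lambda - B * (mu * x * (2 * gamma)^-1)); last first.
    by rewrite /mu; field; rewrite gt_eqF.
  apply: cvgB; first exact: cvg_cst.
  apply: cvgM; first exact: cvg_cst.
  apply: cvgM; first exact: cvg_cst.
  exact: (dominant_root_ratio_cvg halpha delta0 deltagamma e2).
have qc B : q B n @[n --> \oo] --> B * (mu * c * e).
  apply: cvgM; first exact: cvg_cst.
  apply: cvgM; first exact: cvg_cst.
  exact: (cross_ratio_cvg gamma delta halpha e2).
(* The limit variance is that of A G + B (H - x G). This is where the constant of the theorem is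
   checked, and where e disappears through e^2 = 1. *)
have charE A B : sigma ^+ 2 * ((lambda * (A - B * x)) ^+ 2 / (2 * gamma) +
    (B * (mu * c * e)) ^+ 2 / (2 * delta)) = (A - B * x) ^+ 2 + B ^+ 2.
  transitivity ((sigma ^+ 2 * lambda ^+ 2) * ((A - B * x) ^+ 2 / (2 * gamma) +
      (B * (2 * gamma)) ^+ 2 * c ^+ 2 * e ^+ 2 / (2 * delta))).
    by rewrite /mu; ring.
  by rewrite lambda_sqr c_sqr e2; field; rewrite !gt_eqF.
have cvg_trig A B :
    \int[P]_w cos (A * S n w + B * W n w) @[n --> \oo] -->
      \int[normal_pair]_z cos (A * z.1 + B * (z.2 - x * z.1)) /\
    \int[P]_w sin (A * S n w + B * W n w) @[n --> \oo] -->
      \int[normal_pair]_z sin (A * z.1 + B * (z.2 - x * z.1)).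
  rewrite normal_pair_linear_cos normal_pair_linear_sin.
  have [rr [r0 rb]] := weight_small halpha delta0 deltagamma e2 (pc A B) (qc B).
  have [h1 h2] := partial_sum_cvg_normal hV hmean hvar rb r0
    (sum_weight_sqr halpha delta0 deltagamma e2 (pc A B) (qc B)).
  have E n w : partial_sum (weight alpha gamma delta e (p A B) (q B) n) V n w =
      A * S n w + B * W n w by rewrite partial_sum_weight SWE.
  rewrite (_ : - _ / 2 = - (sigma ^+ 2 / 2 * ((lambda * (A - B * x)) ^+ 2 / (2 * gamma) +
    (B * (mu * c * e)) ^+ 2 / (2 * delta)))); last first.
    by rewrite -charE; ring.
  split.
    rewrite (_ : (fun n => \int[P]_w cos _) = (fun n => \int[P]_w cos
      (partial_sum (weight alpha gamma delta e (p A B) (q B) n) V n w)))//.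
    by apply/funext => n; apply: eq_Rintegral => w _; rewrite E.
  rewrite (_ : (fun n => \int[P]_w sin _) = (fun n => \int[P]_w sin
    (partial_sum (weight alpha gamma delta e (p A B) (q B) n) V n w)))//.
  by apply/funext => n; apply: eq_Rintegral => w _; rewrite E.
have SE n w : S n w = p 1 0 n * s n w + q 0 n * t n w by rewrite -SWE; ring.
have WE n w : W n w = p 0 1 n * s n w + q 1 n * t n w by rewrite -SWE; ring.
have Sf n : S n = fun w => p 1 0 n * s n w + q 0 n * t n w by apply/funext.
have Wf n : W n = fun w => p 0 1 n * s n w + q 1 n * t n w by apply/funext.
have mS n : measurable_fun [set: T] (S n) by rewrite Sf; exact: measurable_weighted.
have mW n : measurable_fun [set: T] (W n) by rewrite Wf; exact: measurable_weighted.
have iS n : P.-integrable [set: T] (EFin \o (fun w => S n w ^+ 2)).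
  by rewrite Sf; exact: integrable_weighted_sqr.
have iW n : P.-integrable [set: T] (EFin \o (fun w => W n w ^+ 2)).
  by rewrite Wf; exact: integrable_weighted_sqr.
pose M1 := sigma ^+ 2 * ((lambda * (1 - 0 * x)) ^+ 2 / (2 * gamma) +
  (0 * (mu * c * e)) ^+ 2 / (2 * delta)) + 1.
pose M2 := sigma ^+ 2 * ((lambda * (0 - 1 * x)) ^+ 2 / (2 * gamma) +
  (1 * (mu * c * e)) ^+ 2 / (2 * delta)) + 1.
pose E n := [set w | c * (kappa n * a n ^+ n * b n ^- n) * est n w <= x].
have mE n : measurable (E n).
  rewrite [X in measurable X](_ : _ =
    (fun w => c * (kappa n * a n ^+ n * b n ^- n) * est n w) @^-1` `]-oo, x]).
    by rewrite -[X in measurable X]setTI; apply: measurable_funM.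
  by apply/seteqP; split => w /=; rewrite in_itv.
have iV2 n : P.-integrable [set: T] (EFin \o (fun w => \sum_(i < n) V i w ^+ 2)) /\
    \int[P]_w (\sum_(i < n) V i w ^+ 2) = n%:R * sigma ^+ 2.
  elim: n => [|n [IH1 IH2]].
    rewrite (_ : (fun w => \sum_(i < 0) V i w ^+ 2) = cst 0); last first.
      by apply/funext => w; rewrite big_ord0.
    by split; [exact: integrable_cstT|rewrite /cst Rintegral_cstT mul0r].
  rewrite (_ : (fun w => \sum_(i < n.+1) V i w ^+ 2) =
      (fun w => \sum_(i < n) V i w ^+ 2 + V n w ^+ 2)); last first.
    by apply/funext => w; rewrite big_ord_recr.
  have iVn := integrable_sqr hmean hvar n.
  split; first exact: (integrable_addT IH1 iVn).
  rewrite (RintegralD measurableT IH1 iVn) IH2 (sqr_Rintegral hmean hvar).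
  by rewrite -natr1 mulrDl mul1r.
have ew0 : 0 <= error_weight gamma lambda mu c x.
  by rewrite /error_weight addr_ge0// !mulr_ge0 ?addr_ge0 ?mulr_ge0 ?sqr_ge0// ltW.
have er0 n : 0 <= error_rate (a n) (b n) n gamma.
  rewrite /error_rate mulr_ge0// addr_ge0 ?mulr_ge0 ?invr_ge0 ?exprn_ge0 ?addr_ge0//.
  by rewrite divr_ge0 ?(ltW gamma0).
have ir n : P.-integrable [set: T] (EFin \o r n).
  by apply: integrable_scaleT; apply: integrable_scaleT; exact: (iV2 n).1.
have r0 n w : 0 <= r n w.
  rewrite /r mulr_ge0 ?(mulr_ge0 ew0)// mulr_ge0// sumr_ge0// => i _.
  exact: sqr_ge0.
have rc : \int[P]_w r n w @[n --> \oo] --> 0.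
  have h := error_rate_cvg0 halpha delta0 deltagamma e2.
  have h2 : error_weight gamma lambda mu c x * sigma ^+ 2 *
      (n%:R ^+ 2 * error_rate (a n) (b n) n gamma) @[n --> \oo] -->
      error_weight gamma lambda mu c x * sigma ^+ 2 * 0.
    by apply: cvgM => //; exact: cvg_cst.
  rewrite mulr0 in h2.
  rewrite (_ : (fun n => \int[P]_w r n w) = (fun n =>
    error_weight gamma lambda mu c x * sigma ^+ 2 *
      (n%:R ^+ 2 * error_rate (a n) (b n) n gamma)))//.
  apply/funext => n; rewrite RintegralZl//; last first.
    by apply: integrable_scaleT; exact: (iV2 n).1.
  rewrite RintegralZl//; last exact: (iV2 n).1.
  by rewrite (iV2 n).2; ring.
have mH : measurable_fun [set: (measurableTypeR R * measurableTypeR R)%type]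
    (fun z : (measurableTypeR R * measurableTypeR R)%type => z.2 - x * z.1).
  by apply: measurable_funB => //; exact: measurable_funM.
rewrite -normal_pair_wedge.
have mG : measurable_fun [set: (measurableTypeR R * measurableTypeR R)%type]
    (fun z : (measurableTypeR R * measurableTypeR R)%type => z.1).
  exact: measurable_fst.
have cc A B := (cvg_trig A B).1.
have cs A B := (cvg_trig A B).2.
have SM : \forall n \near \oo, \int[P]_w (S n w ^+ 2) <= Num.max M1 M2.
  apply: filterS (weighted_moment_bounded (pc 1 0) (qc 0)) => n.
  by rewrite Sf => /le_trans; apply; rewrite le_max lexx.
have WM : \forall n \near \oo, \int[P]_w (W n w ^+ 2) <= Num.max M1 M2.
  apply: filterS (weighted_moment_bounded (pc 0 1) (qc 1)) => n.
  by rewrite Wf => /le_trans; apply; rewrite le_max lexx orbT.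
have := @quadrant_cvg R _ _ _ _ P normal_pair S W _ _ mS mW mG mH cc cs iS iW
  integrable_normal_pair_fst_sqr (integrable_normal_pair_linear_sqr x) E r _ SM WM
  normal_pair_fst_eq0 (normal_pair_linear_eq0 x) mE ir r0 rc.
apply.
near=> n; move=> w rSW rS.
have n0 : (0 < n)%N by near: n.
have a2 : `|a n| <= 2 by near: n; exact: (dominant_root_le2 halpha delta0 deltagamma e2).
have <- := estimator_event (V := Vf) (minor_root_gt1 halpha delta0 e2 n0)
  (minor_root_lt halpha delta0 deltagamma e2 n0) a2
  (roots_mul_lt0 halpha delta0 deltagamma e2 n0) (k_ge1 halpha n0) gamma0 lambda0 mu0 n0
  (dominant_root_gap gamma halpha e2 n0)
  (dominant_root_ratio halpha delta0 deltagamma e2 n0) (hest n w) rSW rS.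
by apply/idP/idP; rewrite inE.
Unshelve. all: by end_near. Qed.

End dominant_root_estimator.

Lemma least_squares_error (T : Type) (R : realType) (a b : R) (V : nat -> T -> R)
    n (est : T -> R) w :
  least_squares (process a b V) n est ->
  \sum_(k < n) process a b V k w ^+ 2 != 0 ->
  est w - a = (\sum_(k < n) process a b V k w * noise b V k.+1 w) /
    \sum_(k < n) process a b V k w ^+ 2.
Proof.
move=> /(_ w); rewrite !big_add1/= !big_mkord => h den0.
rewrite h//; apply: (mulIf den0); rewrite mulrBl !divfK// mulr_sumr -sumrB.
by apply: eq_bigr => k _; rewrite processS; ring.
Qed.

Lemma dominant_minor_root_neq (R : realType) (alpha gamma delta e : R) n :
  0 < gamma -> 0 < delta -> e ^+ 2 = 1 ->
  dominant_root alpha gamma e n != minor_root alpha delta e n.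
Proof.
move=> gamma0 delta0 e2; rewrite -subr_eq0 /dominant_root /minor_root.
rewrite mulNr opprK -mulrDr mulf_neq0//.
  by apply/eqP => h; move/eqP: e2; rewrite h expr0n/= eq_sym oner_eq0.
by rewrite gt_eqF// addr_gt0// ltr_wpDr ?divr_ge0 ?powR_ge0// ltW.
Qed.

(** [Y] is constrained only pointwise, so that any bundled random variable with these values fits;
    the two cases of the theorem are the instances e = 1 and e = -1. *)
Lemma dominant_root_cvg_in_law (R : realType)
    (d : measure_display) (T : measurableType d) (P : probability T R)
    (d' : measure_display) (T' : measurableType d') (P' : probability T' R)
    (C : {RV P' >-> R}) (V : nat -> {RV P >-> R}) (sigma alpha gamma delta e : R)
    (est Y : nat -> {RV P >-> R}) :
  standard_cauchy C -> iid V -> (forall k, ('E_P[V k] = 0)%E) ->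
  (forall k, ('V_P[V k] = (sigma ^+ 2)%:E)%E) -> 0 < sigma ^+ 2 ->
  0 < alpha < 1 -> 0 < delta -> delta < gamma -> e ^+ 2 = 1 ->
  (forall n, least_squares (process (dominant_root alpha gamma e n)
    (minor_root alpha delta e n) (fun k => V k)) n (est n)) ->
  (forall n w, Y n w = 1 / (2 * gamma) * Num.sqrt (delta / gamma) *
    (k_ alpha n * dominant_root alpha gamma e n ^+ n *
     minor_root alpha delta e n ^- n) * (est n w - dominant_root alpha gamma e n)) ->
  cvg_in_law Y C.
Proof.
move=> hC hV hmean hvar hsigma halpha delta0 deltagamma e2 hest hY x _.
have -> : cdf C x = (fine (\int[@lebesgue_measure R]_(y in `]-oo, x])
    ((pi * (1 + y ^+ 2))^-1)%:E)%E)%:E.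
  by rewrite -hC// fineK// fin_num_measure.
rewrite (_ : (fun n => cdf (Y n) x) = (fun n => (fine (P [set w |
    1 / (2 * gamma) * Num.sqrt (delta / gamma) *
    (k_ alpha n * dominant_root alpha gamma e n ^+ n *
     minor_root alpha delta e n ^- n) *
    (est n w - dominant_root alpha gamma e n) <= x]))%:E)); last first.
  apply/funext => n.
  have E : [set w | 1 / (2 * gamma) * Num.sqrt (delta / gamma) *
    (k_ alpha n * dominant_root alpha gamma e n ^+ n *
     minor_root alpha delta e n ^- n) *
    (est n w - dominant_root alpha gamma e n) <= x] = Y n @^-1` `]-oo, x].
    by apply/seteqP; split => w /=; rewrite hY in_itv.
  rewrite E fineK// fin_num_measure//.
  by rewrite -[X in measurable X]setTI; exact: measurable_funPT.
apply: cvg_EFin; first by near=> n.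
apply: (dominant_root_estimator_cvg hV hmean hvar hsigma halpha delta0 deltagamma e2
  (est := fun n w => est n w - dominant_root alpha gamma e n)).
  by move=> n; apply: measurable_funB => //; exact: measurable_cst.
by move=> n w den0; exact: least_squares_error.
Unshelve. all: by end_near. Qed.

Theorem theorem2p2 (R : realType)
  (d : measure_display) (T : measurableType d) (P : probability T R)
  (d' : measure_display) (T' : measurableType d') (P' : probability T' R)
  (C : {RV P' >-> R}) (hC : standard_cauchy C)
  (V : nat -> {RV P >-> R}) (hV : iid V)
  (hmean : forall k, ('E_P[V k] = 0)%E)
  (sigma : R) (hsigma : 0 < sigma ^+ 2)
  (hvar : forall k, ('V_P[V k] = (sigma ^+ 2)%:E)%E)
  (alpha gamma1 gamma2 : R) (halpha : 0 < alpha < 1)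
  (hgamma1 : 0 < gamma1) (hgamma2 : 0 < gamma2)
  (thetahat : nat -> {RV P >-> R})
  (hthetahat : forall n,
    least_squares
      (process (theta_ alpha gamma1 n) (rho_ alpha gamma2 n) (fun k => V k))
      n (thetahat n)) :
  let kn := k_ alpha in
  let theta := theta_ alpha gamma1 in
  let rho := rho_ alpha gamma2 in
  (gamma2 < gamma1 ->
    cvg_in_law
      (fun n => ((1 / (2 * gamma1) * Num.sqrt (gamma2 / gamma1)
                  * (kn n * theta n ^+ n * rho n ^- n))
                 \o* (thetahat n \- cst (theta n))) : {RV P >-> R}) C)
  /\
  (gamma1 < gamma2 ->
    cvg_in_law
      (fun n => ((1 / (2 * gamma2) * Num.sqrt (gamma1 / gamma2)
                  * (kn n * rho n ^+ n * theta n ^- n))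
                 \o* (thetahat n \- cst (rho n))) : {RV P >-> R}) C).
Proof.
have e1 n : theta_ alpha gamma1 n = dominant_root alpha gamma1 1 n.
  by rewrite /theta_ /dominant_root mul1r.
have e2 n : rho_ alpha gamma2 n = minor_root alpha gamma2 1 n.
  by rewrite /rho_ /minor_root mulN1r opprD.
have e3 n : rho_ alpha gamma2 n = dominant_root alpha gamma2 (-1) n.
  by rewrite /rho_ /dominant_root mulN1r opprD.
have e4 n : theta_ alpha gamma1 n = minor_root alpha gamma1 (-1) n.
  by rewrite /theta_ /minor_root opprK mul1r.
split=> h.
  apply: (dominant_root_cvg_in_law (e := 1) (est := thetahat)
    hC hV hmean hvar hsigma halpha hgamma2 h).
  - by rewrite expr1n.
  - by move=> n; rewrite -e1 -e2.
  - by move=> n w; rewrite -e1 -e2 /= mulrC.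
apply: (dominant_root_cvg_in_law (e := -1) (est := thetahat)
  hC hV hmean hvar hsigma halpha hgamma1 h).
- by rewrite sqrrN expr1n.
- move=> n; rewrite -e3 -e4; have := hthetahat n.
  (* The process is built with theta as autoregressive root and rho as noise root; as rho dominates
     here, the roots are exchanged, which requires them to be distinct. *)
  rewrite (_ : process _ _ _ =
    process (rho_ alpha gamma2 n) (theta_ alpha gamma1 n) (fun k => V k))//.
  apply/funext => k; apply/funext => w; rewrite e3 e4.
  apply: processC; rewrite eq_sym; apply: dominant_minor_root_neq => //.
  by rewrite sqrrN expr1n.
- by move=> n w; rewrite -e3 -e4 /= mulrC.
Qed.
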